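(* Let $\Omega_1,\Omega_2\subset\mathbb{R}^n$ ($n\ge 2$) be bounded domains forming the base domains of a one-parameter family of dumbbells $\Omega_\epsilon$ (constructed as in the context), where $\Omega_1$ is convex, $\Omega_2$ is simply connected, and the first Dirichlet eigenvalues satisfy $\lambda_1(\Omega_1)<\lambda_1(\Omega_2)$. Let $x_0$ be the unique maximum point of the non-negative first Dirichlet eigenfunction $\varphi_1^{\Omega_1}$ of $\Omega_1$. Let $D\subset\mathbb{R}^n$ be a bounded convex domain (the obstacle), and for each $\epsilon$ let $y_\epsilon+D\subset\Omega_\epsilon$ be an optimal translate of $D$, i.e. $$\lambda_1\big(\Omega_\epsilon\setminus\overline{(y_\epsilon+D)}\big)=\max\big\{\lambda_1\big(\Omega_\epsilon\setminus\overline{(y+D)}\big): y\in\mathbb{R}^n,\ y+D\subset\Omega_\epsilon\big\}.$$ Then there is a constant $C_0$ depending only on $n$ such that the following holds. For every $\delta>0$ there exists $\epsilon'>0$ such that for every $\epsilon<\epsilon'$: if the obstacle is sufficiently large in the sense that $\lambda_1\big(\Omega_\epsilon\setminus\overline{(y_\epsilon+D)}\big)>C\,\lambda_1(\Omega_\epsilon)$ for some $C\ge C_0$, then $$d(x_0,\,y_\epsilon+D)<\delta,$$ where $d(x,A)$ denotes the distance from the point $x$ to the set $A$.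
   Context: Construction of the dumbbells. Write points of $\mathbb{R}^n$, $n\ge 2$, as $(x_1,x')\in\mathbb{R}\times\mathbb{R}^{n-1}$. The base domains $\Omega_1,\Omega_2\subset\mathbb{R}^n$ are bounded, disjoint, connected open sets with smooth boundary such that, for some constant $\xi>0$, $$\overline{\Omega}_1\cap\{(x_1,x'): x_1\ge -1,\ |x'|<3\xi\}=\{(-1,x')\in\partial\Omega_1: |x'|<3\xi\},$$ $$\overline{\Omega}_2\cap\{(x_1,x'): x_1\le 1,\ |x'|<3\xi\}=\{(1,x')\in\partial\Omega_2: |x'|<3\xi\},$$ where both right-hand sides are flat pieces of boundary, i.e. $\{(-1,x'):|x'|<3\xi\}\subset\partial\Omega_1$ and $\{(1,x'):|x'|<3\xi\}\subset\partial\Omega_2$. Let $\rho$ be a positive function, $\rho\in C^\infty((-2,0))\cap C^0((-2,0])$, with $\rho(0)=2$ and $\rho(q)=1$ for $q\in(-2,-1)$ (and set $\rho(-2)=1$). For small $\epsilon>0$ (in particular $2\epsilon<3\xi$ and $\epsilon<1/2$) the dumbbell is $\Omega_\epsilon=\Omega_1\cup\Omega_2\cup Q_\epsilon$ with connector $Q_\epsilon=Q_1(\epsilon)\cup L(\epsilon)\cup Q_2(\epsilon)$, where $$Q_1(\epsilon)=\{(x_1,x'): -1\le x_1\le -1+2\epsilon,\ |x'|<\epsilon\rho(\tfrac{-1-x_1}{\epsilon})\},$$ $$Q_2(\epsilon)=\{(x_1,x'): 1-2\epsilon\le x_1\le 1,\ |x'|<\epsilon\rho(\tfrac{x_1-1}{\epsilon})\},$$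 $$L(\epsilon)=\{(x_1,x'): -1+2\epsilon\le x_1\le 1-2\epsilon,\ |x'|<\epsilon\}.$$ Here $\lambda_1(\cdot)$ always denotes the first eigenvalue of $-\Delta$ with Dirichlet boundary condition on the given bounded open set. Statements about $\epsilon$ concern only those $\epsilon>0$ for which $\Omega_\epsilon$ is defined. *)

(* Defs.v *)
From HB Require Import structures.
From mathcomp Require Import all_boot all_order all_algebra.
From mathcomp Require Import all_classical all_reals all_analysis.
Set Implicit Arguments.
Unset Strict Implicit.
Unset Printing Implicit Defensive.
Import Order.TTheory GRing.Theory Num.Theory.
Import numFieldNormedType.Exports.
Local Open Scope classical_set_scope.
Local Open Scope ring_scope.

(** * Euclidean space

Points of R^n are row vectors ['rV[R]_n]; the library norm on ['rV[R]_n] is the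
sup norm, which is only used below through the topology and boundedness. *)

Definition enorm (R : realType) (n : nat) (x : 'rV[R]_n) : R :=
  Num.sqrt (\sum_(i < n) x 0 i ^+ 2).

(* Meaningful only for [A !=set0], as [inf set0 = 0]. *)
Definition eucl_dist (R : realType) (n : nat) (x : 'rV[R]_n) (A : set 'rV[R]_n) : R :=
  inf [set enorm (x - z) | z in A].

Definition frontier (T : topologicalType) (A : set T) : set T :=
  closure A `\` interior A.

Definition domain (R : realType) (n : nat) (A : set 'rV[R]_n) : Prop :=
  [/\ A !=set0, open A & connected A].

Definition translate (R : realType) (n : nat) (y : 'rV[R]_n)
    (A : set 'rV[R]_n) : set 'rV[R]_n :=
  [set y + z | z in A].

(* For [A] open, connectedness already gives path connectedness. *)
Definition simply_connected (R : realType) (n : nat) (A : set 'rV[R]_n) : Prop :=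
  connected A /\
  forall g : R -> 'rV[R]_n,
    {within `[0, 1], continuous g} -> g @` `[0, 1] `<=` A -> g 0 = g 1 ->
    exists H : R * R -> 'rV[R]_n,
      [/\ {within `[0, 1] `*` `[0, 1], continuous H},
          H @` (`[0, 1] `*` `[0, 1]) `<=` A,
          (forall t : R, t \in `[0, 1] -> H (0, t) = g t),
          (forall t : R, t \in `[0, 1] -> H (1, t) = g 0) &
          (forall s : R, s \in `[0, 1] -> H (s, 0) = g 0 /\ H (s, 1) = g 0)].

(** * Smooth functions *)

Definition partial (R : realType) (n : nat) (i : 'I_n) (f : 'rV[R]_n -> R)
    : 'rV[R]_n -> R :=
  fun x => 'D_(delta_mx 0 i) f x.

Definition iter_partial (R : realType) (n : nat) (s : seq 'I_n)
    (f : 'rV[R]_n -> R) : 'rV[R]_n -> R :=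
  foldr (@partial R n) f s.

(* C^infinity: all iterated partial derivatives exist and are continuous; this
   is the usual notion for [U] open. *)
Definition smooth_on (R : realType) (n : nat) (U : set 'rV[R]_n)
    (f : 'rV[R]_n -> R) : Prop :=
  forall (s : seq 'I_n) x, U x ->
    {for x, continuous (iter_partial s f)} /\
    forall i, derivable (iter_partial s f) x (delta_mx 0 i).

Definition smooth_boundary (R : realType) (n : nat) (A : set 'rV[R]_n) : Prop :=
  forall p, frontier A p ->
    exists (U : set 'rV[R]_n) (h : 'rV[R]_n -> R),
      [/\ open U, U p, smooth_on U h, (exists i, partial i h p != 0) &
          A `&` U = [set x | U x /\ h x < 0]].

(** * Lebesgue measure on R^n *)

Definition rV_display : measure_display -> measure_display.
Proof. exact. Qed.

Definition rV_coord (R : realType) (n : nat) (i : 'I_n) (x : 'rV[R]_n) :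
  measurableTypeR R := x 0 i.

(* The Borel sigma-algebra of R^n, generated by the coordinates (as the library
   does for tuples). *)
HB.instance Definition _ (R : realType) (n : nat) :=
  @isMeasurable.Build (rV_display default_measure_display)
    'rV[R]_n (g_sigma_preimage (@rV_coord R n))
    (@sigma_algebra0 _ _ _) (@sigma_algebraC _ _) (@sigma_algebra_bigcup _ _ _).

Definition rV_cons (R : realType) (n : nat)
    (p : measurableTypeR R * 'rV[R]_n) : 'rV[R]_n.+1 :=
  row_mx (p.1)%:M p.2 : 'rV[R]_(1 + n).

Lemma measurable_rV_cons (R : realType) (n : nat) :
  measurable_fun setT (@rV_cons R n).
Proof.
apply: (@measurability _ _ _ _ _ _
  (\big[setU/set0]_(i < n.+1)
     preimage_set_system setT (@rV_coord R n.+1 i) measurable)) => //.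
move=> _ [B +] <-; rewrite setTI -bigcup_seq => -[i /= _ [C mC <-]].
rewrite setTI -comp_preimage.
have mf : measurable_fun setT (@rV_coord R n.+1 i \o @rV_cons R n).
  have [->|[j ->]] : i = lshift n (0 : 'I_1) \/ exists j, i = rshift 1 j.
  - by case: (splitP (i : 'I_(1 + n))) => j ij; [left|right; exists j];
      apply/val_inj => //=; rewrite ij ?ord1.
  - rewrite (_ : _ \o _ = fst); first exact: measurable_fst.
    apply/funext => p; apply: etrans (row_mxEl _ _ _ _) _.
    by rewrite mxE eqxx.
  - rewrite (_ : _ \o _ = @rV_coord R n j \o snd); last first.
      by apply/funext => p; exact: row_mxEr.
    apply: measurableT_comp => // _ A mA; rewrite setTI.
    apply: sub_sigma_algebra; rewrite -bigcup_seq; exists j => /=.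
      by rewrite mem_index_enum.
    by exists A => //; rewrite setTI.
by rewrite -[_ @^-1` _]setTI; exact: mf.
Qed.

Definition lebesgue_succ (R : realType) (n : nat)
    (mu : {measure set 'rV[R]_n -> \bar R}) : set 'rV[R]_n.+1 -> \bar R :=
  pushforward (lebesgue_measure \x^ mu)%E (@rV_cons R n).

HB.instance Definition _ (R : realType) (n : nat)
    (mu : {measure set 'rV[R]_n -> \bar R}) :=
  Measure.copy (lebesgue_succ mu)
    (measure_function_pushforward__canonical__measure_function_Measure
       (lebesgue_measure \x^ mu)%E (@measurable_rV_cons R n)).

Fixpoint lebesgue (R : realType) (n : nat) {struct n} :
    {measure set 'rV[R]_n -> \bar R} :=
  match n with
  | 0%N => \d_(0 : 'rV[R]_0)
  | m.+1 => lebesgue_succ (lebesgue R m)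
  end.

(** * The Dirichlet Laplacian

Functions in H^1_0(A) are represented by their extension by zero to R^n. *)

Definition test_function (R : realType) (n : nat) (A : set 'rV[R]_n)
    (f : 'rV[R]_n -> R) : Prop :=
  smooth_on setT f /\
  exists K : set 'rV[R]_n,
    [/\ compact K, K `<=` A & forall x, ~ K x -> f x = 0].

Definition L2 (R : realType) (n : nat) (u : 'rV[R]_n -> R) : Prop :=
  u \in Lfun (lebesgue R n) 2%:E.

Definition L2_cvg (R : realType) (n : nat) (f : nat -> 'rV[R]_n -> R)
    (u : 'rV[R]_n -> R) : Prop :=
  'N[lebesgue R n]_2%:E[EFin \o (f k \- u)%R]%E @[k --> \oo] --> 0%E.

(* [u] is in H^1_0(A), the H^1-closure of the test functions on [A], and [G] is
   its weak gradient. *)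
Definition H10_grad (R : realType) (n : nat) (A : set 'rV[R]_n)
    (u : 'rV[R]_n -> R) (G : 'I_n -> 'rV[R]_n -> R) : Prop :=
  [/\ L2 u, (forall i, L2 (G i)) &
      exists f : nat -> 'rV[R]_n -> R,
        [/\ forall k, test_function A (f k), L2_cvg f u &
            forall i, L2_cvg (fun k => partial i (f k)) (G i)]].

(* [- Delta u = l * u] weakly in [A], with [u] in H^1_0(A) and [u] nonzero. *)
Definition dirichlet_eigenfunction (R : realType) (n : nat) (A : set 'rV[R]_n)
    (l : R) (u : 'rV[R]_n -> R) : Prop :=
  ~ ae_eq (lebesgue R n) setT u (cst 0) /\
  exists G : 'I_n -> 'rV[R]_n -> R, H10_grad A u G /\
    forall v, test_function A v ->
      \int[lebesgue R n]_x (\sum_(i < n) G i x * partial i v x) =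
      l * \int[lebesgue R n]_x (u x * v x).

Definition dirichlet_eigenvalue (R : realType) (n : nat) (A : set 'rV[R]_n)
    (l : R) : Prop :=
  exists u, dirichlet_eigenfunction A l u.

(* For a nonempty bounded open [A] the infimum is attained; [lambda1 set0 = +oo]. *)
Definition lambda1 (R : realType) (n : nat) (A : set 'rV[R]_n) : \bar R :=
  ereal_inf [set l%:E | l in dirichlet_eigenvalue A].

(* Elements of H^1_0 are defined almost everywhere; the pointwise conditions
   concern the representative that is continuous in [A]. *)
Definition nonneg_first_eigenfunction (R : realType) (n : nat)
    (A : set 'rV[R]_n) (u : 'rV[R]_n -> R) : Prop :=
  (exists l : R, lambda1 A = l%:E /\ dirichlet_eigenfunction A l u) /\
  forall x, A x -> {for x, continuous u} /\ 0 <= u x.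

Definition unique_max_point (R : realType) (n : nat) (A : set 'rV[R]_n)
    (u : 'rV[R]_n -> R) (x0 : 'rV[R]_n) : Prop :=
  A x0 /\ forall x, A x -> x <> x0 -> u x < u x0.

(** * Dumbbells in R^(1 + n), with points written (x_1, x') *)

Definition axial (R : realType) (n : nat) (x : 'rV[R]_(1 + n)) : R := x 0 0.

Definition cross (R : realType) (n : nat) (x : 'rV[R]_(1 + n)) : 'rV[R]_n :=
  rsubmx x.

Definition left_base (R : realType) (n : nat) (xi : R)
    (A : set 'rV[R]_(1 + n)) : Prop :=
  [/\ domain A, bounded_set A, smooth_boundary A,
      closure A `&` [set x | -1 <= axial x /\ enorm (cross x) < 3 * xi] =
        [set x | [/\ frontier A x, axial x = -1 & enorm (cross x) < 3 * xi]] &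
      [set x | axial x = -1 /\ enorm (cross x) < 3 * xi] `<=` frontier A].

Definition right_base (R : realType) (n : nat) (xi : R)
    (A : set 'rV[R]_(1 + n)) : Prop :=
  [/\ domain A, bounded_set A, smooth_boundary A,
      closure A `&` [set x | axial x <= 1 /\ enorm (cross x) < 3 * xi] =
        [set x | [/\ frontier A x, axial x = 1 & enorm (cross x) < 3 * xi]] &
      [set x | axial x = 1 /\ enorm (cross x) < 3 * xi] `<=` frontier A].

(* The last conjunct, [rho (-2) = 1], fixes the value at the excluded endpoint,
   at which the profile is evaluated where the ends meet the cylinder. *)
Definition connector_profile (R : realType) (rho : R -> R) : Prop :=
  [/\ forall q : R, q \in `]-2, 0] -> 0 < rho q,
      forall (k : nat) (q : R), q \in `]-2, 0[ -> derivable (rho^`(k))%classic q 1,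
      {within `]-2, 0], continuous rho},
      rho 0 = 2 &
      (forall q : R, q \in `]-2, -1[ -> rho q = 1) /\ rho (-2) = 1].

Definition connector_left (R : realType) (n : nat) (rho : R -> R) (eps : R)
    : set 'rV[R]_(1 + n) :=
  [set x | -1 <= axial x <= -1 + 2 * eps /\
           enorm (cross x) < eps * rho ((-1 - axial x) / eps)].

Definition connector_right (R : realType) (n : nat) (rho : R -> R) (eps : R)
    : set 'rV[R]_(1 + n) :=
  [set x | 1 - 2 * eps <= axial x <= 1 /\
           enorm (cross x) < eps * rho ((axial x - 1) / eps)].

Definition connector_cylinder (R : realType) (n : nat) (eps : R)
    : set 'rV[R]_(1 + n) :=
  [set x | -1 + 2 * eps <= axial x <= 1 - 2 * eps /\ enorm (cross x) < eps].

Definition dumbbell (R : realType) (n : nat) (A1 A2 : set 'rV[R]_(1 + n))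
    (rho : R -> R) (eps : R) : set 'rV[R]_(1 + n) :=
  A1 `|` A2 `|` (connector_left rho eps `|` connector_cylinder eps `|`
                 connector_right rho eps).

Definition admissible (R : realType) (xi eps : R) : Prop :=
  [/\ 0 < eps, 2 * eps < 3 * xi & eps < 1 / 2].

(** * Obstacles *)

Definition perforated (R : realType) (n : nat) (A D : set 'rV[R]_n)
    (y : 'rV[R]_n) : set 'rV[R]_n :=
  A `\` closure (translate y D).

Definition optimal_translate (R : realType) (n : nat) (A D : set 'rV[R]_n)
    (y : 'rV[R]_n) : Prop :=
  translate y D `<=` A /\
  forall z, translate z D `<=` A ->
    (lambda1 (perforated A D z) <= lambda1 (perforated A D y))%E.

(* Main.v *)
(** Let [l = lambda1 Omega1].  An obstacle at positive distance from [x0] lies in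
a half-space with [x0] on the open complementary side.  The domain [Omega1] contains a
ball of radius [1 / (4 sqrt l)] about the maximum point [x0]: if [Omega1] lies in the
half-space [e.(z - x) > 0], then [w = 2 M (1 - exp (- sqrt l e.(z - x)))], where [M] is
the maximum of the eigenfunction [phi], satisfies [- Delta w = l (2 M - w)], and
comparison of [phi] with [w] gives [phi x0 <= w x0], i.e. [e.(z - x0)] is at least of
order [1 / sqrt l].  Hence the half of that ball away from the obstacle contains a cube of
size of order [1 / sqrt l], and a bump on this cube shows that the perforated dumbbell has
first eigenvalue at most [c l], with [c] depending only on the dimension.

Conversely, for small [eps], [lambda1] of the dumbbell is at least [c' l].  A test
function [u] on the dumbbell is cut off near the two mouths of the connector, at scale
[r] of order [eps].  What the cutoff destroys, and the part of [u] in the connector,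
is controlled by [u (x + V) - u x] for vectors [V] of length of order [r] such that
[x + V] lies outside the dumbbell, so it costs only [r^2] times the Dirichlet
energy of [u] in mass, and a constant times that energy in the gradient.

So [C0 = c / c'] works.  The eigenvalues themselves are reached through test functions
by compactness: Rellich's theorem is proved by averaging over a grid of cubes. *)
Require Import Defs.
From HB Require Import structures.
From mathcomp Require Import all_boot all_order all_algebra.
From mathcomp Require Import all_classical all_reals all_analysis.
From mathcomp Require Import measurable_realfun.
From mathcomp Require Import ring lra.
Import Order.TTheory GRing.Theory Num.Theory.
Import numFieldNormedType.Exports.
Local Open Scope classical_set_scope.
Local Open Scope ring_scope.
Set Implicit Arguments.
Unset Strict Implicit.
Unset Printing Implicit Defensive.

(** Elements of H^1_0 are known only as limits of test functions, so estimates are proved for test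
    functions, where derivatives exist, and then carried to the limit. Thus the comparison with the
    barrier [w] is a weak maximum principle tested with [theta (f - w)], a smooth substitute for the
    positive part of [f - w]; the slope of [theta] is kept in [0, 1] so that this truncation does
    not increase the gradient.

    [lambda1] is an infimum over eigenvalues, not over Rayleigh quotients. A lower bound follows by
    testing the weak equation, but a Rayleigh quotient bounds [lambda1] from above only once some
    eigenvalue is known to lie below it; this is what compactness provides.

    One estimate recurs: the L2 norm of [f (x + v) - f x] is at most the sum over [i] of [|v_i|]
    times the norm of the i-th partial derivative. For a shift that leaves the support it is the
    Poincare inequality; averaged over small shifts it gives Rellich's theorem; for a shift that
    leaves the connector it bounds the mass inside. *)

(** * Square-integrable functions on a measure space: Cauchy-Schwarz and completeness *)

Section square_integrable.
Context d (T : measurableType d) (R : realType).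
Variable mu : {measure set T -> \bar R}.
Implicit Types (f g h : T -> R).

(** Functions rather than classes, with integrability of the square as the criterion, so that
    products are integrable by domination ([sqint_mul]). [L2_sqint] identifies this with the [Lfun]
    membership behind H^1_0. *)
Definition sqint f :=
  measurable_fun setT f /\ mu.-integrable setT (EFin \o (fun x => f x ^+ 2)).

Definition ip f g : R := \int[mu]_x (f x * g x).

Definition nrm f : R := Num.sqrt (ip f f).

Lemma sqint_dom f g : measurable_fun setT g -> (forall x, g x ^+ 2 <= f x ^+ 2) ->
  sqint f -> sqint g.
Proof.
move=> mg fg [mf intf]; split => //.
apply: le_integrable intf => //; first exact/measurable_EFinP/measurable_funX.
by move=> x _ /=; rewrite lee_fin !ger0_norm ?sqr_ge0.
Qed.

Lemma sqint_mul f g : sqint f -> sqint g ->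
  mu.-integrable setT (EFin \o (fun x => f x * g x)).
Proof.
move=> [mf If] [mg Ig].
have I2 : mu.-integrable setT (EFin \o (fun x => f x ^+ 2 + g x ^+ 2)).
  have := @integrableD _ _ _ mu setT measurableT _ _ If Ig.
  by apply: eq_integrable.
apply: le_integrable I2 => //.
  by apply/measurable_EFinP; apply: measurable_funM.
move=> x _ /=; rewrite lee_fin [leRHS]ger0_norm ?addr_ge0 ?sqr_ge0// normrM.
rewrite -[f x ^+ 2]real_normK ?num_real// -[g x ^+ 2]real_normK ?num_real//.
have := sqr_ge0 (`|f x| - `|g x|).
have := normr_ge0 (f x); have := normr_ge0 (g x); nra.
Qed.

Lemma sqintZ a f : sqint f -> sqint (fun x => a * f x).
Proof.
move=> [mf If]; split; first exact: measurable_funM.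
have := @integrableZl _ _ _ mu setT measurableT (a ^+ 2) _ If.
by apply: eq_integrable => // x _ /=; rewrite exprMn EFinM.
Qed.

Lemma sqintD f g : sqint f -> sqint g -> sqint (fun x => f x + g x).
Proof.
move=> sf sg; split; first by apply: measurable_funD; [case: sf|case: sg].
have := @integrableD _ _ _ mu setT measurableT _ _
  (@integrableD _ _ _ mu setT measurableT _ _ sf.2 sg.2)
  (@integrableZl _ _ _ mu setT measurableT 2 _ (sqint_mul sf sg)).
apply: eq_integrable => // x _ /=; rewrite -!EFinM -!EFinD; congr EFin; ring.
Qed.

Lemma sqintB f g : sqint f -> sqint g -> sqint (fun x => f x - g x).
Proof.
move=> sf sg; have := sqintD sf (sqintZ (-1) sg).
by under eq_fun do rewrite mulN1r.
Qed.

Lemma ipC f g : ip f g = ip g f.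
Proof. by apply: eq_Rintegral => x _; rewrite mulrC. Qed.

Lemma ipDl f g h : sqint f -> sqint g -> sqint h ->
  ip (fun x => f x + g x) h = ip f h + ip g h.
Proof.
move=> sf sg sh; rewrite /ip -RintegralD//; try exact: sqint_mul.
by apply: eq_Rintegral => x _; rewrite mulrDl.
Qed.

Lemma ipZl a f g : sqint f -> sqint g -> ip (fun x => a * f x) g = a * ip f g.
Proof.
move=> sf sg; rewrite /ip -RintegralZl//; try exact: sqint_mul.
by apply: eq_Rintegral => x _; rewrite mulrA.
Qed.

Lemma ipBl f g h : sqint f -> sqint g -> sqint h ->
  ip (fun x => f x - g x) h = ip f h - ip g h.
Proof.
move=> sf sg sh; rewrite /ip -RintegralB//; try exact: sqint_mul.
by apply: eq_Rintegral => x _; rewrite mulrBl.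
Qed.

Lemma ipDr f g h : sqint f -> sqint g -> sqint h ->
  ip h (fun x => f x + g x) = ip h f + ip h g.
Proof. by move=> *; rewrite ipC ipDl// !(ipC h). Qed.

Lemma ipZr a f g : sqint f -> sqint g -> ip f (fun x => a * g x) = a * ip f g.
Proof. by move=> *; rewrite ipC ipZl// ipC. Qed.

Lemma ipBr f g h : sqint f -> sqint g -> sqint h ->
  ip h (fun x => f x - g x) = ip h f - ip h g.
Proof. by move=> *; rewrite ipC ipBl// !(ipC h). Qed.

Lemma ip_ge0 f : 0 <= ip f f.
Proof. by apply: Rintegral_ge0 => x _; rewrite -expr2 sqr_ge0. Qed.

Lemma ip_le f g : sqint f -> sqint g -> (forall x, f x ^+ 2 <= g x ^+ 2) ->
  ip f f <= ip g g.
Proof.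
move=> sf sg fg; apply: le_Rintegral => //; [exact: sqint_mul|exact: sqint_mul|].
by move=> x _; have := fg x; rewrite !expr2.
Qed.

Lemma nrm_ge0 f : 0 <= nrm f. Proof. exact: sqrtr_ge0. Qed.

Lemma nrm_sqr f : nrm f ^+ 2 = ip f f.
Proof. by rewrite sqr_sqrtr// ip_ge0. Qed.

Lemma ipD_sqr f g : sqint f -> sqint g ->
  ip (fun x => f x + g x) (fun x => f x + g x) = ip f f + 2 * ip f g + ip g g.
Proof.
move=> sf sg; have sfg := sqintD sf sg.
by rewrite ipDl// !ipDr// (ipC g f); ring.
Qed.

Lemma ipB_sqr f g : sqint f -> sqint g ->
  ip (fun x => f x - g x) (fun x => f x - g x) = ip f f - 2 * ip f g + ip g g.
Proof.
move=> sf sg; have sfg := sqintB sf sg.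
by rewrite ipBl// !ipBr// (ipC g f); ring.
Qed.

(** Discriminant argument: the square norm of [f + t g] is a nonnegative quadratic in [t], evaluated
    at its minimum [t = - ip f g / ip g g]. *)
Lemma ip_normrM f g : sqint f -> sqint g -> `|ip f g| <= nrm f * nrm g.
Proof.
move=> sf sg.
have H t : 0 <= ip f f + 2 * (t * ip f g) + t ^+ 2 * ip g g.
  have := ip_ge0 (fun x => f x + t * g x).
  have stg := sqintZ t sg.
  by rewrite ipD_sqr// (ipZl t sg stg) !ipZr// [t * (_ * _)]mulrA -expr2.
rewrite -(@ler_pXn2r _ 2)// ?nnegrE ?mulr_ge0 ?nrm_ge0//.
rewrite exprMn !nrm_sqr real_normK ?num_real//.
have := ip_ge0 f; have := ip_ge0 g; move: H.
move: (ip f f) (ip f g) (ip g g) => a b c H c0 a0.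
have [c_eq0|cneq0] := eqVneq c 0.
  suff -> : b = 0 by rewrite c_eq0; nra.
  apply/eqP/negP => /negP b0.
  (* Without its quadratic term the polynomial is affine in [t]; if [b] were nonzero this [t] would
     give it the value -1. *)
  have := H (- (a + 1) / (2 * b)); rewrite c_eq0.
  have -> : a + 2 * (- (a + 1) / (2 * b) * b) + (- (a + 1) / (2 * b)) ^+ 2 * 0 = -1.
    by field.
  lra.
have cp : 0 < c by rewrite lt_neqAle eq_sym cneq0.
have := H (- b / c).
have -> : a + 2 * (- b / c * b) + (- b / c) ^+ 2 * c = (a * c - b ^+ 2) / c.
  by field.
by rewrite pmulr_lge0 ?invr_gt0//; lra.
Qed.

Lemma nrmD f g : sqint f -> sqint g -> nrm (fun x => f x + g x) <= nrm f + nrm g.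
Proof.
move=> sf sg; rewrite -(@ler_pXn2r _ 2)// ?nnegrE ?addr_ge0 ?nrm_ge0//.
rewrite nrm_sqr ipD_sqr// sqrrD !nrm_sqr.
have := le_trans (ler_norm _) (ip_normrM sf sg); rewrite mulr2n; nra.
Qed.

Lemma nrmZ a f : sqint f -> nrm (fun x => a * f x) = `|a| * nrm f.
Proof.
move=> sf; rewrite /nrm ipZl ?ipZr//; last exact: sqintZ.
by rewrite mulrA -expr2 sqrtrM ?sqr_ge0// sqrtr_sqr.
Qed.

Lemma nrmB_le f g : sqint f -> sqint g -> nrm (fun x => f x - g x) <= nrm f + nrm g.
Proof.
move=> sf sg; have := nrmD sf (sqintZ (-1) sg); rewrite nrmZ// normrN1 mul1r.
by rewrite (_ : (fun x => f x + -1 * g x) = (fun x => f x - g x))//; apply/funext => x; rewrite mulN1r.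
Qed.

Lemma nrm_le f g : sqint f -> sqint g -> (forall x, f x ^+ 2 <= g x ^+ 2) ->
  nrm f <= nrm g.
Proof. by move=> sf sg fg; rewrite ler_wsqrtr// ip_le. Qed.

Lemma L2_sqint f : (f \in Lfun mu 2%:E) <-> sqint f.
Proof.
split=> [fL|[mf If]].
  split; last exact: Lfun2_integrable_sqr.
  by move: fL; rewrite inE => /andP[/[!inE]].
rewrite inE; apply/andP; split; rewrite inE//=.
rewrite /finite_norm unlock poweR_lty//.
have /integrableP[_] := If; apply: le_lt_trans.
rewrite le_eqVlt; apply/orP; left; apply/eqP; apply: eq_integral => x _ /=.
by rewrite powR_mulrn// normrX.
Qed.

Lemma Lnorm2_nrm f : sqint f -> ('N[mu]_2%:E[EFin \o f] = (nrm f)%:E)%E.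
Proof.
move=> [mf If]; rewrite unlock.
have -> : (\int[mu]_x (`|(EFin \o f) x| `^ 2) = (ip f f)%:E)%E.
  rewrite /ip /Rintegral fineK; last first.
    by have := integrable_fin_num measurableT If; under eq_fun do rewrite /= expr2.
  by apply: eq_integral => x _ /=; rewrite powR_mulrn// -normrX ger0_norm ?sqr_ge0// expr2.
by rewrite /nrm -powR12_sqrt ?ip_ge0.
Qed.

Lemma nrm0_ae f : sqint f -> nrm f = 0 -> ae_eq mu setT f (cst 0).
Proof.
move=> sf f0; have := @Lnorm_eq0_eq0 _ _ _ mu (EFin \o f) 2%:E.
rewrite Lnorm2_nrm// f0 => /(_ _ _ erefl) H.
have : ae_eq mu setT (EFin \o f) (cst 0%E).
  by apply: H; [exact/measurable_EFinP/(sf.1)|rewrite lte_fin].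
by apply: filterS => x /(_ I) /= [].
Qed.

Lemma ae0_nrm f : ae_eq mu setT f (cst 0) -> measurable_fun setT f -> nrm f = 0.
Proof.
move=> f0 mf; rewrite /nrm /ip /Rintegral.
rewrite (_ : (\int[mu]_x (f x * f x)%:E = 0)%E) ?sqrtr0//.
rewrite -[RHS](@integral0 _ _ _ mu setT); apply: ae_eq_integral => //.
  by apply/measurable_EFinP; apply: measurable_funM.
by apply: filterS f0 => x /= f0 _; rewrite f0// mulr0.
Qed.

Lemma ip_cvg (f g : nat -> T -> R) f' g' :
  (forall k, sqint (f k)) -> (forall k, sqint (g k)) -> sqint f' -> sqint g' ->
  nrm (fun x => f k x - f' x) @[k --> \oo] --> 0 ->
  nrm (fun x => g k x - g' x) @[k --> \oo] --> 0 ->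
  ip (f k) (g k) @[k --> \oo] --> ip f' g'.
Proof.
move=> sf sg sf' sg' cf cg.
have E k : ip (f k) (g k) - ip f' g' =
    ip (fun x => f k x - f' x) (fun x => g k x - g' x)
    + (ip (fun x => f k x - f' x) g' + ip f' (fun x => g k x - g' x)).
  by rewrite !ipBl ?ipBr//; [ring|exact: sqintB].
apply/subr_cvg0/norm_cvg0P.
apply: (@squeeze_cvgr _ _ _ _ (cst 0)
  (fun k => nrm (fun x => f k x - f' x) * nrm (fun x => g k x - g' x) +
            (nrm (fun x => f k x - f' x) * nrm g' +
             nrm f' * nrm (fun x => g k x - g' x)))).
- apply: nearW => k; rewrite normr_ge0/= E.
  apply: le_trans (ler_normD _ _) _; apply: lerD.
    by apply: ip_normrM; exact: sqintB.
  apply: le_trans (ler_normD _ _) _; apply: lerD; apply: ip_normrM => //;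
    exact: sqintB.
- exact: cvg_cst.
- rewrite -[X in _ --> X](_ : 0 * 0 + (0 * nrm g' + nrm f' * 0) = 0); last by ring.
  apply: cvgD; first exact: cvgM.
  by apply: cvgD; apply: cvgM => //; exact: cvg_cst.
Qed.

(* Riesz-Fischer: the partial sums of [|g 0| + \sum |g k.+1 - g k|] are bounded in
   L2, so their limit [H] is finite almost everywhere and dominates. *)
Lemma sqint_complete (g : nat -> T -> R) :
  (forall k, sqint (g k)) ->
  (forall k, nrm (fun x => g k.+1 x - g k x) <= 2^-1 ^+ k) ->
  exists u, sqint u /\ nrm (fun x => g k x - u x) @[k --> \oo] --> 0.
Proof.
move=> sg dg.
pose S n x : R := `|g 0 x| + \sum_(k < n) `|g k.+1 x - g k x|.
have S0 n x : 0 <= S n x by rewrite addr_ge0// sumr_ge0.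
have ndS x : {homo S ^~ x : n m / (n <= m)%N >-> n <= m}.
  apply: homo_leq => [//|m n p|n]; first exact: le_trans.
  by rewrite /S big_ord_recr/= addrA lerDl.
have sqabs f : sqint f -> sqint (fun x => `|f x|).
  move=> sf; apply: (sqint_dom _ _ sf) => [|x]; first exact: measurableT_comp (proj1 sf).
  by rewrite real_normK ?num_real.
have nabs f : sqint f -> nrm (fun x => `|f x|) = nrm f.
  by move=> sf; apply/eqP; rewrite eq_le; apply/andP; split; apply: nrm_le => //;
    try exact: sqabs; move=> x; rewrite real_normK ?num_real.
have sS n : sqint (S n).
  elim: n => [|n IH].
    by rewrite /S; under eq_fun do rewrite big_ord0 addr0; exact: sqabs.
  rewrite /S; under eq_fun do rewrite big_ord_recr/= addrA.
  by apply: sqintD => //; apply: sqabs; exact: sqintB.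
(* The geometric sum is kept in closed form so that the induction closes. *)
have nS n : nrm (S n) <= nrm (g 0) + 2 - 2 * 2^-1 ^+ n.
  elim: n => [|n IH].
    rewrite /S; under eq_fun do rewrite big_ord0 addr0.
    by rewrite nabs//= expr0; lra.
  rewrite /S; under eq_fun do rewrite big_ord_recr/= addrA.
  apply: le_trans (nrmD (sS n) (sqabs _ (sqintB (sg n.+1) (sg n)))) _.
  rewrite nabs; last exact: sqintB.
  apply: le_trans (lerD IH (dg n)) _.
  by rewrite exprS; lra.
pose B := (nrm (g 0) + 2) ^+ 2.
have ipS n : ip (S n) (S n) <= B.
  rewrite -nrm_sqr ler_pXn2r// ?nnegrE ?nrm_ge0 ?addr_ge0 ?nrm_ge0//.
  by apply: le_trans (nS n) _; rewrite lerBlDr lerDl mulr_ge0// exprn_ge0.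
pose H x := ereal_sup (range (fun n => (S n x ^+ 2)%:E)).
have ndS2 x : {homo (fun n => (S n x ^+ 2)%:E) : n m / (n <= m)%N >-> (n <= m)%E}.
  move=> n m nm; rewrite lee_fin ler_pXn2r// ?nnegrE//; exact: ndS.
have cS2 x : (S n x ^+ 2)%:E @[n --> \oo] --> H x by exact: ereal_nondecreasing_cvgn.
have SH n x : ((S n x ^+ 2)%:E <= H x)%E by apply: ereal_sup_ubound; exists n.
have H0 x : (0 <= H x)%E by apply: le_trans (SH 0%N x); rewrite lee_fin sqr_ge0.
have mS2 n : measurable_fun setT (fun x => (S n x ^+ 2)%:E).
  by apply/measurable_EFinP/measurable_funX; case: (sS n).
have mH : measurable_fun setT H.
  by apply: (emeasurable_fun_cvg _ _ mS2) => x _; exact: cS2.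
have IH : mu.-integrable setT H.
  apply/integrableP; split => //.
  apply: (@le_lt_trans _ _ B%:E); last exact: ltry.
  have -> : (\int[mu]_x `|H x| = \int[mu]_x (limn (fun n => (S n x ^+ 2)%:E)))%E.
    apply: eq_integral => x _; rewrite gee0_abs//; apply/esym.
    by apply: cvg_lim => //; exact: cS2.
  rewrite monotone_convergence//; last first.
    by move=> n x _; rewrite lee_fin sqr_ge0.
  apply: lime_le.
    apply: ereal_nondecreasing_is_cvgn => n m nm; apply: ge0_le_integral => //.
    + by move=> x _; rewrite lee_fin sqr_ge0.
    + by move=> x _; exact: ndS2.
  apply: nearW => n; apply: le_trans (_ : (ip (S n) (S n))%:E <= _)%E; last first.
    by rewrite lee_fin.
  rewrite /ip /Rintegral fineK; last first.
    by apply: integrable_fin_num => //; apply: sqint_mul.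
  by under [leLHS]eq_integral do rewrite expr2.
(* Where [H] is infinite, a null set, the sequence may diverge. Cutting to [E] gives [ge], which
   converges everywhere, so its limit [u] is measurable. *)
pose E := [set x | H x \is a fin_num].
have mE : measurable E by rewrite -[E]setTI; exact: emeasurable_fin_num.
have cg x : E x -> cvgn (g ^~ x).
  move=> Ex.
  have : cvgn [normed series (telescope (g ^~ x))].
    apply: nondecreasing_is_cvgn.
      apply: homo_leq => [//|m n p|n]; first exact: le_trans.
      by rewrite [X in _ <= X]seriesSr lerDl; exact: normr_ge0.
    exists (1 + fine (H x)) => _ [n _ <-].
    have SHn : S n x ^+ 2 <= fine (H x) by rewrite -lee_fin fineK//.
    apply: (@le_trans _ _ (S n x)); last by have := sqr_ge0 (S n x - 1); nra.
    rewrite (_ : [normed series _]%classic n = \sum_(k < n) `|g k.+1 x - g k x|).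
      by rewrite lerDr.
    by rewrite /normed_series_of seriesEord.
  move/normed_cvg; rewrite telescopeK => cgx.
  rewrite (_ : g ^~ x = (fun n => [sequence g n x - g 0 x]_n n + g 0 x)); last first.
    by apply/funext => n /=; rewrite subrK.
  by apply: is_cvgD => //; exact: is_cvg_cst.
pose ge n x := \1_E x * g n x.
have mge n : measurable_fun setT (ge n).
  by apply: measurable_funM; [exact: measurable_indic|case: (sg n)].
pose u x := \1_E x * limn (g ^~ x).
have cge x : ge n x @[n --> \oo] --> u x.
  rewrite /ge /u indicE; have [|xE] := boolP (x \in E).
    by rewrite inE => Ex; under eq_fun do rewrite mul1r; rewrite mul1r; exact: cg.
  by under eq_fun do rewrite mul0r; rewrite mul0r; exact: cvg_cst.
have mu_ : measurable_fun setT u.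
  by apply: (measurable_fun_cvg mge) => x _; exact: cge.
have gS n x : `|g n x| <= S n x.
  have -> : g n x = g 0 x + \sum_(k < n) (g k.+1 x - g k x).
    rewrite (eq_sum_telescope (g ^~ x) n); congr (_ + _).
    by rewrite seriesEord.
  by apply: le_trans (ler_normD _ _) _; rewrite lerD2l ler_norm_sum.
have geH n x : ((ge n x ^+ 2)%:E <= H x)%E.
  rewrite /ge indicE; case: (x \in E); rewrite ?mul0r ?mul1r ?expr0n//.
  apply: le_trans (SH n x); rewrite lee_fin -real_normK ?num_real//.
  by rewrite ler_pXn2r ?nnegrE.
have uH x : ((u x ^+ 2)%:E <= H x)%E.
  have c2 : (ge n x ^+ 2)%:E @[n --> \oo] --> (u x ^+ 2)%:E.
    by apply: cvg_EFin; [exact: nearW|rewrite expr2; under eq_fun do rewrite /= expr2; exact: cvgM].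
  rewrite -(cvg_lim _ c2)//; apply: lime_le; first by apply/cvg_ex; eexists; exact: c2.
  exact: nearW.
have su : sqint u.
  split => //; apply: le_integrable IH => //.
    exact/measurable_EFinP/measurable_funX.
  by move=> x _ /=; rewrite [X in (_ <= X)%E]gee0_abs// ger0_norm ?sqr_ge0.
exists u; split => //.
(* The bound [4 H] comes from [(a - b)^2 <= 2 a^2 + 2 b^2], both squares being at most [H]. *)
have D3 := @dominated_convergence _ _ _ mu setT measurableT
  (fun n x => ((ge n x - u x) ^+ 2)%:E) (cst 0%E) (fun x => 4%:E * H x)%E.
have {}D3 : (\int[mu]_x (((ge n x - u x) ^+ 2)%:E))%E @[n --> \oo] --> 0%E.
  rewrite -[X in _ --> X](@integral0 _ _ _ mu setT); case: D3; last by move=> _ _.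
  - by move=> n; apply/measurable_EFinP/measurable_funX/measurable_funB.
  - exact: measurable_cst.
  - apply: nearW => x _; apply: cvg_EFin; first exact: nearW.
    rewrite /comp/= -[X in _ --> X](_ : (u x - u x) * (u x - u x) = 0); last by ring.
    under eq_fun do rewrite /= expr2.
    by apply: cvgM; apply: cvgB => //; exact: cvg_cst.
  - exact: integrableZl.
  - apply: nearW => x n _ /=; rewrite ger0_norm ?sqr_ge0//.
    apply: (@le_trans _ _ (2%:E * (ge n x ^+ 2)%:E + 2%:E * (u x ^+ 2)%:E)%E).
      rewrite -!EFinM -EFinD lee_fin; have := sqr_ge0 (ge n x + u x); nra.
    have -> : (4%:E * H x = 2%:E * H x + 2%:E * H x)%E.
      by rewrite -ge0_muleDl ?lee_fin// -EFinD; congr (_%:E * _)%E; ring.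
    by apply: leeD; apply: lee_pmul => //; rewrite lee_fin ?sqr_ge0.
have E1 n : nrm (fun x => g n x - u x) ^+ 2 = fine (\int[mu]_x (((ge n x - u x) ^+ 2)%:E))%E.
  rewrite nrm_sqr /ip /Rintegral; congr fine.
  apply: ae_eq_integral => //.
  - apply/measurable_EFinP; apply: measurable_funM; apply: measurable_funB => //;
      by case: (sg n).
  - by apply/measurable_EFinP/measurable_funX/measurable_funB.
  - have := integrable_ae measurableT IH.
    apply: filterS => x /(_ I) Hx _; rewrite /ge indicE mem_set// mul1r expr2.
    by [].
have : fine (\int[mu]_x (((ge n x - u x) ^+ 2)%:E))%E @[n --> \oo] --> 0.
  exact: fine_cvg.
under eq_fun do rewrite -E1.
move=> /(continuous_cvg _ (@sqrt_continuous R 0)).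
rewrite sqrtr0; apply: cvg_trans; apply: near_eq_cvg; apply: nearW => n /=.
by rewrite sqrtr_sqr ger0_norm// nrm_ge0.
Qed.

End square_integrable.

(** * Lebesgue measure on row vectors: open sets, boxes, Tonelli, translation invariance *)

Section lebesgue_rV.
Variable R : realType.
Implicit Types n : nat.

Lemma measurable_rV_coord n (i : 'I_n) :
  measurable_fun setT (fun x : 'rV[R]_n => x 0 i).
Proof.
move=> _ A mA; rewrite setTI; apply: sub_sigma_algebra; rewrite -bigcup_seq.
by exists i => /=; [rewrite mem_index_enum|exists A => //; rewrite setTI].
Qed.

Lemma measurable_rV d (T : measurableType d) n (f : T -> 'rV[R]_n) :
  (forall i, measurable_fun setT (fun t => f t 0 i)) -> measurable_fun setT f.
Proof.
move=> mf.
apply: (@measurability _ _ _ _ _ _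
  (\big[setU/set0]_(i < n) preimage_set_system setT (@rV_coord R n i) measurable)) => //.
move=> _ [B +] <-; rewrite setTI -bigcup_seq => -[i /= _ [C mC <-]].
rewrite setTI -comp_preimage -[_ @^-1` _]setTI.
exact: (mf i).
Qed.

Definition box n (I : 'I_n -> set R) : set 'rV[R]_n :=
  [set x | forall i, I i (x 0 i)].

Lemma measurable_box n (I : 'I_n -> set (measurableTypeR R)) :
  (forall i, measurable (I i)) -> measurable (box I).
Proof.
move=> mI.
have -> : box I = \bigcap_(i in [set: 'I_n]) ((fun x : 'rV[R]_n => x 0 i) @^-1` I i).
  by apply/seteqP; split => [x xI i _|x xI i] /=; [exact: xI|exact: (xI i)].
apply: fin_bigcap_measurable => // i _.
by rewrite -[_ @^-1` _]setTI; exact: (measurable_rV_coord i measurableT (mI i)).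
Qed.

Lemma rV_ballP n (x y : 'rV[R]_n) e : 0 < e ->
  ball x e y <-> forall i, `|x 0 i - y 0 i| < e.
Proof.
move=> e0; split=> [xy i|xy].
  by have [_ h] := xy; exact: h.
split => // i j; rewrite (ord1 i); exact: xy.
Qed.

(** The sigma-algebra is generated by the coordinates, not by the topology. An open set is the union
    of the open boxes with rational centre and half-side [1 / (m + 1)] that it contains, and there
    are countably many of them. *)
Lemma open_measurable_rV n (U : set 'rV[R]_n) : open U -> measurable U.
Proof.
move=> oU.
pose B (p : 'rV[rat]_n * nat) : set 'rV[R]_n :=
  box (fun i => `](ratr (p.1 0 i) - p.2.+1%:R^-1 : R), (ratr (p.1 0 i) + p.2.+1%:R^-1)[%classic).
have -> : U = \bigcup_p (if pselect (B p `<=` U) then B p else set0).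
  apply/seteqP; split => [x Ux|x [p _]]; last by case: pselect => // pU; exact: pU.
  have /nbhs_ballP[e /= e0 eU] : nbhs x U by exact: open_nbhs_nbhs.
  (* Half of [e], because [x] and any other point of the box are each within [t] of the rational
     centre. *)
  have [m me] : exists m, m.+1%:R^-1 < e / 2.
    have e20 : 0 < e / 2 by rewrite divr_gt0.
    have [m] := ltr_add_invr e20.
    by rewrite add0r => ?; exists m.
  pose t : R := m.+1%:R^-1.
  have mp : 0 < t by rewrite invr_gt0.
  have {}me : t < e / 2 by [].
  have qx i : exists q : rat, ratr q \in `](x 0 i - t), (x 0 i + t)[.
    by apply: rat_in_itvoo; lra.
  pose q : 'rV[rat]_n := \row_i projT1 (cid (qx i)).
  have Eq i : x 0 i - t < ratr (q 0 i) < x 0 i + t.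
    by rewrite mxE; case: cid => r /=; rewrite in_itv.
  exists (q, m) => //; case: pselect => [_ i /=|nU]; first by rewrite in_itv/= -/t; case/andP: (Eq i) => ? ?; apply/andP; split; lra.
  exfalso; apply: nU => y By; apply: eU; apply/rV_ballP => // i.
  have := By i; rewrite /= in_itv/= -/t => /andP[? ?]; case/andP: (Eq i) => ? ?.
  by rewrite ltr_norml; apply/andP; split; lra.
apply: countable_bigcupT_measurable; first exact: countableP.
move=> p; case: (pselect (B p `<=` U)) => BU /=; last exact: measurable0.
by apply: measurable_box => i; exact: measurable_itv.
Qed.

Lemma continuous_measurable_rV n (f : 'rV[R]_n -> R) : continuous f -> measurable_fun setT f.
Proof.
move=> cf.
apply: (measurability _ (RGenOpens.measurableE R)) => _ [_ [a [b ->] <-]].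
rewrite setTI; apply: open_measurable_rV.
by have /continuousP := cf; apply; exact: interval_open.
Qed.

Lemma rV_cons0 n (s : R) (x : 'rV[R]_n) : rV_cons (s, x) 0 ord0 = s.
Proof.
have -> : ord0 = lshift n (ord0 : 'I_1) :> 'I_(1 + n) by exact/val_inj.
by apply: etrans (row_mxEl _ _ _ _) _; rewrite mxE eqxx.
Qed.

Lemma rV_consS n (s : R) (x : 'rV[R]_n) i : rV_cons (s, x) 0 (lift ord0 i) = x 0 i.
Proof.
have -> : lift ord0 i = rshift 1 i :> 'I_(1 + n) by exact/val_inj.
exact: row_mxEr.
Qed.

Lemma rV_consD n (s : R) (x : 'rV[R]_n) (v : 'rV[R]_n.+1) :
  rV_cons (s, x) + v = rV_cons (s + v 0 ord0, x + \row_i v 0 (lift ord0 i)).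
Proof.
apply/rowP => i; rewrite [LHS]mxE.
by case: (unliftP ord0 i) => [j ->|->]; rewrite ?rV_cons0// !rV_consS [RHS]mxE [X in _ = _ + X]mxE.
Qed.

Lemma lebesgue_box n (I : 'I_n -> set (measurableTypeR R)) (c : 'I_n -> R) :
  (forall i, measurable (I i)) -> (forall i, lebesgue_measure (I i) = (c i)%:E) ->
  lebesgue R n (box I) = (\prod_i c i)%:E.
Proof.
elim: n I c => [|n IH] I c mI Ic.
  rewrite big_ord0 /= diracE mem_set//.
  by case.
rewrite big_ord_recl /= /lebesgue_succ /pushforward.
rewrite (_ : _ @^-1` _ = I ord0 `*` box (fun i => I (lift ord0 i))).
  rewrite product_measure2E//; last by apply: measurable_box => i; exact: mI.
  rewrite (IH (fun i => I (lift ord0 i)) (fun i => c (lift ord0 i)))// EFinM.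
  by congr (_ * _)%E; exact: Ic.
apply/seteqP; split => [[s x] /= sx|[s x] [/= Is Ix] i].
  split => /= [|i]; first by have := sx ord0; rewrite rV_cons0.
  by have := sx (lift ord0 i); rewrite rV_consS.
by case: (unliftP ord0 i) => [j ->|->]; rewrite ?rV_cons0 ?rV_consS.
Qed.

Definition cube n (r : R) : set 'rV[R]_n := box (fun=> `[- r, r]%classic).

Lemma cubeP n r (x : 'rV[R]_n) : @cube n r x <-> forall i, `|x 0 i| <= r.
Proof.
by split=> xr i; have := xr i; rewrite /= in_itv/= ler_norml.
Qed.

Lemma measurable_cube n r : measurable (@cube n r).
Proof. by apply: measurable_box => i; exact: measurable_itv. Qed.

Lemma bigcup_cube n : \bigcup_k @cube n k%:R = setT.
Proof.
apply/seteqP; split => // x _.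
exists (Num.truncn (\sum_i `|x 0 i|)).+1 => //; apply/cubeP => i.
apply: le_trans (ltW (truncnS_gt _)).
by rewrite (bigD1 i)//= lerDl sumr_ge0.
Qed.

Lemma lebesgue_cube n (r : R) : 0 <= r ->
  lebesgue R n (@cube n r) = ((2 * r) ^+ n)%:E.
Proof.
move=> r0; rewrite (@lebesgue_box _ _ (fun=> 2 * r)).
- by rewrite prodr_const card_ord.
- by move=> i; exact: measurable_itv.
- move=> i; rewrite lebesgue_measure_itv/= lte_fin.
  case: ifPn => [_|]; first by rewrite -EFinB; congr EFin; ring.
  by rewrite -leNgt => r1; congr EFin; lra.
Qed.

(** An alias of [lebesgue R n] that carries the sigma-finite structure required by Tonelli's theorem
    and by the uniqueness of product measures. *)
Definition leb n : set 'rV[R]_n -> \bar R := lebesgue R n.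

HB.instance Definition _ n := Measure.copy (@leb n) (lebesgue R n).

Lemma leb_sigma_finite n : sigma_finite setT (@leb n).
Proof.
exists (fun k => @cube n k%:R); first exact/esym/bigcup_cube.
by move=> k; split; [exact: measurable_cube|rewrite /leb lebesgue_cube ?ltry].
Qed.

HB.instance Definition _ n := Measure_isSigmaFinite.Build _ _ _ (@leb n) (@leb_sigma_finite n).

Lemma lebesgue_integral_rec n (f : 'rV[R]_n.+1 -> \bar R) :
  measurable_fun setT f -> (forall x, 0 <= f x)%E ->
  (\int[lebesgue R n.+1]_x f x =
   \int[lebesgue R n]_x \int[lebesgue_measure]_s f (rV_cons (s, x)))%E.
Proof.
move=> mf f0.
have mfc : measurable_fun setT (f \o @rV_cons R n).
  by apply: measurableT_comp => //; exact: measurable_rV_cons.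
rewrite (@ge0_integral_pushforward _ _ _ _ _ _ (@measurable_rV_cons R n) (lebesgue_measure \x^ lebesgue R n)%E)//.
(* The measure is built with [\x^], whereas Tonelli is applied to [\x]; the two agree on rectangles
   and hence everywhere. *)
transitivity (\int[(lebesgue_measure \x @leb n)%E]_x (f \o @rV_cons R n) x)%E.
  apply/esym/(@eq_measure_integral _ _ _ _ ((lebesgue_measure \x^ @leb n)%E)) => A mA _.
  apply: product_measure_unique => // A1 A2 mA1 mA2; exact: product_measure2E.
exact: etrans (fubini_tonelli2 _ mfc (fun=> f0 _)) _.
Qed.

(** Both sides are measures in [A], and Lebesgue measure is determined by its values on half-open
    intervals. *)
Lemma lebesgue_measure_translation (a : R) (A : set (measurableTypeR R)) :
  measurable A -> lebesgue_measure ((fun x => x + a) @^-1` A) = lebesgue_measure A.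
Proof.
move=> mA.
have ma : measurable_fun setT (fun x : measurableTypeR R => (x + a : measurableTypeR R)).
  exact: measurable_funD.
have -> : lebesgue_measure ((fun x => x + a) @^-1` A) =
  pushforward lebesgue_measure (fun x : measurableTypeR R => (x + a : measurableTypeR R)) A by [].
apply/esym.
apply: (@lebesgue_measure_unique R (pushforward lebesgue_measure (fun x : measurableTypeR R => (x + a : measurableTypeR R)))) => //.
move=> _ [[b c] _ <-] /=.
rewrite /pushforward (_ : _ @^-1` _ = `](b - a), (c - a)]%classic).
  rewrite !lebesgue_measure_itv/= !lte_fin ltrD2r.
  by case: ifP => // _; rewrite -!EFinB; congr EFin; ring.
by apply/seteqP; split => x /=; rewrite !in_itv/=; lra.
Qed.

Lemma integral_translation1 (a : R) (g : measurableTypeR R -> \bar R) :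
  measurable_fun setT g -> (forall x, 0 <= g x)%E ->
  (\int[lebesgue_measure]_x g (x + a)%R = \int[lebesgue_measure]_x g x)%E.
Proof.
move=> mg g0.
pose t := (fun x : measurableTypeR R => (x + a : measurableTypeR R)).
have mt : measurable_fun setT t by exact: measurable_funD.
transitivity (\int[pushforward lebesgue_measure t]_x g x)%E.
  by rewrite (ge0_integral_pushforward mt).
apply: (@eq_measure_integral _ _ _ _ lebesgue_measure) => A mA _.
exact: lebesgue_measure_translation.
Qed.

Lemma measurable_translation n (v : 'rV[R]_n) : measurable_fun setT (fun x : 'rV[R]_n => x + v : 'rV[R]_n).
Proof.
apply: measurable_rV => i.
under eq_fun do rewrite mxE.
by apply: measurable_funD; [exact: measurable_rV_coord|exact: measurable_cst].
Qed.

Lemma measurable_fun_rec n (f : 'rV[R]_n.+1 -> \bar R) :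
  measurable_fun setT f -> (forall x, 0 <= f x)%E ->
  measurable_fun setT (fun x : 'rV[R]_n => \int[lebesgue_measure]_s f (rV_cons (s, x)))%E.
Proof.
move=> mf f0.
apply: (measurable_fun_fubini_tonelli_G (f \o @rV_cons R n)).
  by apply: measurableT_comp => //; exact: measurable_rV_cons.
by move=> z; exact: f0.
Qed.

(** Induction on the dimension through [lebesgue_integral_rec]: the inner one-dimensional integral
    absorbs the shift of the first coordinate, the induction hypothesis absorbs the others. *)
Lemma integral_translation n (v : 'rV[R]_n) (f : 'rV[R]_n -> \bar R) :
  measurable_fun setT f -> (forall x, 0 <= f x)%E ->
  (\int[lebesgue R n]_x f (x + v)%R = \int[lebesgue R n]_x f x)%E.
Proof.
elim: n v f => [|n IH] v f mf f0.
  by apply: eq_integral => x _; congr f; apply/rowP; case.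
have mf1 (x : 'rV[R]_n) : measurable_fun setT (fun s : measurableTypeR R => f (rV_cons (s, x))).
  apply: measurableT_comp mf _; apply: measurableT_comp (@measurable_rV_cons R n) _.
  exact: pair2_measurable.
pose F x := (\int[lebesgue_measure]_s f (rV_cons (s, x)))%E.
pose v' := \row_i v 0 (lift ord0 i).
have mfv : measurable_fun setT (fun x : 'rV[R]_n.+1 => f (x + v)%R).
  exact: measurableT_comp mf (measurable_translation v).
have F0 x : (0 <= F x)%E by exact: integral_ge0.
have mF : measurable_fun setT F by exact: measurable_fun_rec.
apply: etrans (lebesgue_integral_rec mfv (fun=> f0 _)) _.
apply: etrans _ (esym (lebesgue_integral_rec mf f0)).
apply: etrans _ (IH v' F mF F0).
apply: eq_integral => x _; rewrite /F.
rewrite -(@integral_translation1 (v 0 ord0) _ (mf1 (x + v')))//.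
by apply: eq_integral => s _; rewrite rV_consD.
Qed.

End lebesgue_rV.

(** * Smooth functions of one variable: a smooth positive part, a step and a bump *)

Section smooth_real.
Variable R : realType.
Implicit Types (b c : R -> R) (p q : {poly R}).

(** C^k with the derivative supplied as a witness: closure under sums, products and composition is
    then an induction on [k], with no formula for higher derivatives. *)
Fixpoint diffn (k : nat) (b : R -> R) : Prop :=
  if k is k'.+1 then
    exists b' : R -> R, (forall x : R, is_derive x (1 : R) b (b' x)) /\ diffn k' b'
  else continuous b.

Lemma is_derive1_continuous b (b' : R -> R) :
  (forall x : R, is_derive x (1 : R) b (b' x)) -> continuous b.
Proof.
move=> bb' x; apply: differentiable_continuous; apply/derivable1_diffP.
by have [] := bb' x.
Qed.

Lemma diffnW k b : diffn k.+1 b -> diffn k b.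
Proof.
elim: k b => [|k IH] b [b' [bb' kb']]; first exact: is_derive1_continuous bb'.
by exists b'; split => //; exact: IH.
Qed.

Lemma diffn_continuous k b : diffn k b -> continuous b.
Proof. by elim: k b => // k IH b /diffnW; exact: IH. Qed.

Definition smooth1 b := forall k, diffn k b.

Lemma diffn_cst k (a : R) : diffn k (cst a).
Proof.
elim: k a => [|k IH] a; first exact: cst_continuous.
exists (cst 0); split => [x|]; [exact: is_derive_cst|exact: IH].
Qed.

Lemma diffn_affine k (a c : R) : diffn k (fun x => a * x + c).
Proof.
have D x : is_derive x (1 : R) (fun x => a * x + c) a.
  have /is_derive_eq := is_deriveD (is_deriveZ a (is_derive_id x (1 : R))) (is_derive_cst c x (1 : R)).
  by apply; rewrite addr0 /GRing.scale/= mulr1.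
case: k => [|k]; first exact: (is_derive1_continuous D).
by exists (cst a); split => //; exact: diffn_cst.
Qed.

Lemma diffnD k b c : diffn k b -> diffn k c -> diffn k (fun x => b x + c x).
Proof.
elim: k b c => [|k IH] b c; first by move=> cb cc x; apply: cvgD; [exact: cb|exact: cc].
move=> [b' [bb' kb']] [c' [cc' kc']]; exists (fun x => b' x + c' x); split => [x|].
  by have := bb' x; have := cc' x => ? ?; exact: is_deriveD.
exact: IH.
Qed.

Lemma diffnM k b c : diffn k b -> diffn k c -> diffn k (fun x => b x * c x).
Proof.
elim: k b c => [|k IH] b c; first by move=> cb cc x; apply: cvgM; [exact: cb|exact: cc].
move=> kb kc; have [b' [bb' kb']] := kb; have [c' [cc' kc']] := kc.
exists (fun x => b x * c' x + c x * b' x); split => [x|].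
  by have := bb' x; have := cc' x => ? ?; exact: is_deriveM.
by apply: diffnD; apply: IH => //; exact: diffnW.
Qed.

Lemma diffn_comp k b c : diffn k b -> diffn k c -> diffn k (fun x => b (c x)).
Proof.
elim: k b c => [|k IH] b c; first by move=> cb cc x; apply: continuous_comp; [exact: cc|exact: cb].
move=> kb kc; have [b' [bb' kb']] := kb; have [c' [cc' kc']] := kc.
exists (fun x => b' (c x) * c' x); split => [x|].
  by apply: (@is_derive1_comp _ b c).
by apply: diffnM => //; apply: IH => //; exact: diffnW.
Qed.

Lemma diffn_expR k : diffn k (@expR R).
Proof.
elim: k => [|k IH]; first exact: continuous_expR.
by exists expR; split => // x; exact: is_derive_expR.
Qed.

Lemma pow_le_expR (m : nat) (y : R) : 0 <= y -> y ^+ m <= m`!%:R * expR y.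
Proof.
case: m => [|m] y0.
  by rewrite expr0 fact0 mul1r; apply: le_trans (expR_ge1Dx y); rewrite lerDl.
have := expR_ge1Dxn m y0; have m0 : 0 < (m.+1)`!%:R :> R by rewrite ltr0n fact_gt0.
move=> H; rewrite mulrC -ler_pdivrMr//; lra.
Qed.

(** The power [y ^+ m] is there for the induction on [p], in which multiplying [p] by ['X] raises
    [m] by one. *)
Lemma horner_le_expR p (m : nat) :
  exists2 C : R, 0 <= C & forall y : R, 0 <= y -> `|p.[y]| * y ^+ m <= C * expR y.
Proof.
elim/poly_ind: p m => [|p c IH] m.
  by exists 0 => // y y0; rewrite horner0 normr0 !mul0r.
have [C C0 CP] := IH m.+1.
exists (C + `|c| * m`!%:R) => [|y y0]; first by rewrite addr_ge0// mulr_ge0.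
rewrite hornerMXaddC.
apply: (@le_trans _ _ ((`|p.[y]| * y + `|c|) * y ^+ m)).
  rewrite ler_wpM2r ?exprn_ge0//; apply: le_trans (ler_normD _ _) _.
  by rewrite normrM (ger0_norm y0).
rewrite !mulrDl -mulrA -exprS; apply: lerD; first exact: CP.
by rewrite -mulrA ler_wpM2l// pow_le_expR.
Qed.

(** The classical flat functions, taken as a family because it is stable under differentiation: [p]
    becomes ['X^2 * (p - p')] ([flat_derive]), so smoothness is an induction. *)
Definition flat p (s : R) : R := if 0 < s then p.[s^-1] * expR (- s^-1) else 0.

Lemma flat_derive0 p : is_derive (0 : R) (1 : R) (flat p) 0.
Proof.
(* Power 2: one factor [1 / h] pays for the division in the difference quotient, the other leaves
   the bound [C * |h|]. *)
have [C C0 CP] := horner_le_expR p 2.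
have cvg0 : h^-1 *: ((flat p \o shift 0) (h *: 1) - flat p 0) @[h --> (0 : R)^'] --> (0 : R).
  apply/norm_cvg0P.
  apply: (@squeeze_cvgr _ _ _ _ (cst 0) (fun h : R => C * `|h|)).
  - near=> h; rewrite normr_ge0/= [flat p 0]/flat ltxx subr0 /comp/= addr0 /flat.
    have -> : h *: (1 : R) = h by rewrite /GRing.scale/= mulr1.
    case: ifPn => h0; last by rewrite scaler0 normr0 mulr_ge0.
    have hV0 : 0 < h^-1 by rewrite invr_gt0.
    have := CP _ (ltW hV0); rewrite /GRing.scale/= !normrM => H.
    rewrite (ger0_norm (expR_ge0 _)) (gtr0_norm hV0) (gtr0_norm h0) expRN.
    rewrite mulrA ler_pdivrMr ?expR_gt0//.
    have -> : h^-1 * `|p.[h^-1]| = h * (`|p.[h^-1]| * h^-1 ^+ 2).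
      by field; rewrite gt_eqF.
    by rewrite mulrAC -(mulrC h) ler_pM2l.
  - exact: cvg_cst.
  - rewrite -[X in _ --> X](mulr0 C) -[in X in _ --> X](normr0 R).
    apply: cvgM; first exact: cvg_cst.
    by apply: cvg_norm; apply: nbhs_dnbhs.
split; first by apply/cvg_ex; exists 0.
exact: (cvg_lim _ cvg0).
Unshelve. all: by end_near. Qed.

Lemma flat_derive p (s : R) :
  is_derive s (1 : R) (flat p) (flat ('X^2 * (p - p^`())) s).
Proof.
have [s0|s0|->] := ltgtP s 0.
- rewrite [flat ('X^2 * _) s]/flat ltNge (ltW s0)/=.
  apply: (@near_eq_is_derive _ _ _ (cst 0)).
  near=> t; rewrite /flat ifF//; apply/negbTE; rewrite -leNgt ltW//; near: t.
  exact: lt_nbhsl.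
- have s_neq0 : s != 0 by rewrite gt_eqF.
  have Dv : is_derive s (1 : R) (fun t : R => t^-1) (- s ^- 2).
    have /is_derive_eq := @is_deriveV R id s 1 1 s_neq0 (is_derive_id s (1 : R)).
    by apply; rewrite /GRing.scale/= mulr1.
  have Dp := @is_derive1_comp _ (horner p) (fun t : R => t^-1) s _ _ (is_derive_poly p s^-1) Dv.
  have De := @is_derive1_comp _ expR (fun t : R => - t^-1) s _ _ (is_derive_expR (- s^-1)) (is_deriveN Dv).
  have D : is_derive s (1 : R) (fun t => p.[t^-1] * expR (- t^-1)) (flat ('X^2 * (p - p^`())) s).
    have /is_derive_eq := is_deriveM Dp De; apply.
    rewrite [flat _ s]/flat s0 hornerM hornerXn hornerD hornerN.
    transitivity (p.[s^-1] * (expR (- s^-1) * - - s ^- 2) +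
      expR (- s^-1) * (p^`().[s^-1] * - s ^- 2)) => //.
    by move: (expR _) p.[_] p^`().[_] => *; field.
  apply: near_eq_is_derive.
  by near=> t; rewrite /flat ifT//; near: t; exact: lt_nbhsr.
- by rewrite [flat ('X^2 * _) 0]/flat ltxx; exact: flat_derive0.
Unshelve. all: by end_near. Qed.

Lemma diffn_flat k p : diffn k (flat p).
Proof.
elim: k p => [|k IH] p; first exact: (is_derive1_continuous (flat_derive p)).
by exists (flat ('X^2 * (p - p^`()))); split => // x; exact: flat_derive.
Qed.

Definition theta : R -> R := flat 1.

Lemma thetaE s : theta s = if 0 < s then expR (- s^-1) else 0.
Proof. by rewrite /theta /flat hornerC mul1r. Qed.

Lemma theta_ge0 s : 0 <= theta s.
Proof. by rewrite thetaE; case: ifP => // _; exact: expR_ge0. Qed.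

Lemma theta_gt0 s : 0 < s -> 0 < theta s.
Proof. by move=> s0; rewrite thetaE s0 expR_gt0. Qed.

Lemma theta_le0 s : s <= 0 -> theta s = 0.
Proof. by move=> s0; rewrite thetaE ltNge s0. Qed.

Definition theta' : R -> R := flat 'X^2.

Lemma theta_derive s : is_derive s (1 : R) theta (theta' s).
Proof.
have := flat_derive 1 s; rewrite derivC subr0 mulr1; exact.
Qed.

(** With [y = 1 / s] the upper bound reads [y^2 <= exp y], which follows from
    [y <= (1 + y / 4)^2 <= exp (y / 4) ^ 2]. It makes [theta] 1-Lipschitz and gives the truncation
    inequality [partial_v]. *)
Lemma theta'_itv s : 0 <= theta' s <= 1.
Proof.
rewrite /theta' /flat; case: ifP => [s0|_]; last by rewrite lexx ler01.
rewrite hornerXn; apply/andP; split; first by rewrite mulr_ge0 ?expR_ge0 ?sqr_ge0.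
rewrite expRN ler_pdivrMr ?expR_gt0// mul1r.
have s1 : 0 <= s^-1 by rewrite invr_ge0 ltW.
move: (s^-1) s1 => y y0.
have y4 : 1 + y / 4 <= expR (y / 4) by exact: expR_ge1Dx.
have -> : expR y = (expR (y / 4) ^+ 2) ^+ 2 by rewrite -exprM -expRM_natr divfK.
have y2 : y <= expR (y / 4) ^+ 2.
  apply: (@le_trans _ _ ((1 + y / 4) ^+ 2)).
    by have := sqr_ge0 (1 - y / 4); lra.
  by rewrite ler_pXn2r// nnegrE; lra.
by rewrite ler_pXn2r// nnegrE; lra.
Qed.

Lemma theta_lip s t : `|theta s - theta t| <= `|s - t|.
Proof.
wlog : s t / s < t => [H|st].
  have [st|st|->] := ltgtP s t; [exact: H| |by rewrite !subrr].
  by rewrite distrC [leRHS]distrC; exact: H.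
have ct : continuous theta by exact: (is_derive1_continuous theta_derive).
have [|c _] := @MVT R theta theta' s t st (fun x _ => theta_derive x).
  exact: continuous_subspaceT.
rewrite distrC [leRHS]distrC => ->; rewrite normrM ler_piMl//.
by have /andP[c0 c1] := theta'_itv c; rewrite ger0_norm.
Qed.

Lemma theta_le s : 0 <= s -> theta s <= s.
Proof.
by move=> s0; have := theta_lip s 0; rewrite (theta_le0 (lexx 0)) !subr0 !ger0_norm// theta_ge0.
Qed.

Lemma smooth1_theta : smooth1 theta.
Proof. by move=> k; exact: diffn_flat. Qed.

Lemma theta'_le0 s : s <= 0 -> theta' s = 0.
Proof. by move=> s0; rewrite /theta' /flat ltNge s0. Qed.

Let e : R := expR 1.

Let e0 : 0 < e. Proof. exact: expR_gt0. Qed.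

Let theta1 : e * theta 1 = 1.
Proof. by rewrite thetaE ltr01 invr1 expRN divff// gt_eqF. Qed.

Lemma theta_homo s t : s <= t -> theta s <= theta t.
Proof.
move=> st; rewrite [theta s]thetaE; case: ifPn => [s0|_]; last exact: theta_ge0.
have t0 := lt_le_trans s0 st.
by rewrite thetaE t0 ler_expR lerN2 lef_pV2.
Qed.

(* equal to 0 on [s <= 0] and to 1 on [1 <= s] *)
Definition step (s : R) : R := expR 1 * theta (1 - expR 1 * theta (1 - s)).

Definition step' (s : R) : R :=
  (expR 1 * theta' (1 - expR 1 * theta (1 - s))) * (expR 1 * theta' (1 - s)).

Lemma step_derive s : is_derive s (1 : R) step (step' s).
Proof.
have D1 : is_derive s (1 : R) (fun t : R => 1 - t) (-1).
  have /is_derive_eq := is_deriveB (is_derive_cst (1 : R) s (1 : R)) (is_derive_id s (1 : R)).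
  by apply; rewrite sub0r.
have D2 := @is_derive1_comp _ theta (fun t : R => 1 - t) s _ _ (theta_derive (1 - s)) D1.
have /is_derive_eq D3 := is_deriveB (is_derive_cst (1 : R) s (1 : R)) (is_deriveZ e D2).
have D4 : is_derive s (1 : R) (fun t : R => 1 - e * theta (1 - t)) (e * theta' (1 - s)).
  by apply: D3; rewrite /GRing.scale/= sub0r mulrN1 mulrN opprK.
have D5 := @is_derive1_comp _ theta (fun t : R => 1 - e * theta (1 - t)) s _ _ (theta_derive _) D4.
have /is_derive_eq := is_deriveZ e D5; apply.
by rewrite /GRing.scale/= /step' /e !mulrA.
Qed.

Lemma smooth1_step : smooth1 step.
Proof.
move=> k.
have A (a : R) : diffn k (fun x => 1 - a * x).
  have := diffn_affine k (- a) 1; congr diffn.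
  by apply/funext => x; ring.
have B (a : R) : diffn k (fun x => a * x).
  by have := diffn_affine k a 0; congr diffn; apply/funext => x; ring.
rewrite /step; apply: (diffn_comp (B e)).
apply: (diffn_comp (smooth1_theta k)).
apply: (diffn_comp (A e)); apply: (diffn_comp (smooth1_theta k)).
have := A 1; congr diffn; apply/funext => x; ring.
Qed.

Lemma step_le0 s : s <= 0 -> step s = 0.
Proof.
move=> s0; rewrite /step theta_le0 ?mulr0//.
have : theta 1 <= theta (1 - s) by apply: theta_homo; lra.
by rewrite -(ler_pM2l e0) theta1 /e; lra.
Qed.

Lemma step'_le0 s : s <= 0 -> step' s = 0.
Proof.
move=> s0; rewrite /step' (theta'_le0 (s := 1 - _)) ?mulr0 ?mul0r//.
have : theta 1 <= theta (1 - s) by apply: theta_homo; lra.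
by rewrite -(ler_pM2l e0) theta1 /e; lra.
Qed.

Lemma step_ge1 s : 1 <= s -> step s = 1.
Proof.
move=> s1; rewrite /step (theta_le0 (s := 1 - s)); last by lra.
by rewrite mulr0 subr0 theta1.
Qed.

Lemma step_itv s : 0 <= step s <= 1.
Proof.
rewrite mulr_ge0 ?theta_ge0 ?expR_ge0//= -theta1 ler_pM2l//.
by apply: theta_homo; rewrite gerBl mulr_ge0 ?theta_ge0 ?expR_ge0.
Qed.

Lemma step'_itv s : 0 <= step' s <= expR 1 ^+ 2.
Proof.
rewrite /step'; set u := 1 - expR 1 * _; set v := 1 - s.
have /andP[u0 u1] := theta'_itv u; have /andP[v0 v1] := theta'_itv v.
have := e0; rewrite /e => E0.
apply/andP; split; first by rewrite !mulr_ge0// ltW.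
rewrite expr2; apply: ler_pM; rewrite ?mulr_ge0// ?(ltW E0)//.
  by rewrite ger_pMr.
by rewrite ger_pMr.
Qed.

Definition bump (s : R) : R := step (2 + s) * step (2 - s).

Definition bump' (s : R) : R := step' (2 + s) * step (2 - s) - step (2 + s) * step' (2 - s).

Lemma smooth1_bump : smooth1 bump.
Proof.
move=> k; apply: diffnM; apply: (diffn_comp (smooth1_step k)).
  by have := diffn_affine k 1 2; congr diffn; apply/funext => x; ring.
by have := diffn_affine k (-1) 2; congr diffn; apply/funext => x; ring.
Qed.

Lemma bump_derive s : is_derive s (1 : R) bump (bump' s).
Proof.
have D1 : is_derive s (1 : R) (fun t : R => 2 + t) 1.
  have /is_derive_eq := is_deriveD (is_derive_cst (2 : R) s (1 : R)) (is_derive_id s (1 : R)).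
  by apply; rewrite add0r.
have D2 : is_derive s (1 : R) (fun t : R => 2 - t) (-1).
  have /is_derive_eq := is_deriveB (is_derive_cst (2 : R) s (1 : R)) (is_derive_id s (1 : R)).
  by apply; rewrite sub0r.
have E1 := @is_derive1_comp _ step _ s _ _ (step_derive (2 + s)) D1.
have E2 := @is_derive1_comp _ step _ s _ _ (step_derive (2 - s)) D2.
have /is_derive_eq := is_deriveM E1 E2; apply.
rewrite /GRing.scale/= /bump'.
transitivity (step (2 + s) * (step' (2 - s) * -1) + step (2 - s) * (step' (2 + s) * 1)) => //.
move: (step _) (step (2 - s)) (step' _) (step' (2 - s)) => u v u' v'; ring.
Qed.

Lemma bump_itv s : 0 <= bump s <= 1.
Proof.
rewrite /bump; move: (step_itv (2 + s)) (step_itv (2 - s)).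
move: (step _) (step (2 - s)) => u v /andP[u0 u1] /andP[v0 v1].
by rewrite mulr_ge0//= mulr_ile1.
Qed.

Lemma bump1 s : `|s| <= 1 -> bump s = 1.
Proof.
rewrite ler_norml => /andP[? ?].
by rewrite /bump !step_ge1 ?mulr1//; lra.
Qed.

Lemma bump_out s : 2 <= `|s| -> bump s = 0 /\ bump' s = 0.
Proof.
rewrite ler_normr /bump /bump' => /orP[s2|s2].
  have s0 : 2 - s <= 0 by lra.
  by rewrite (step_le0 s0) (step'_le0 s0) !mulr0 subr0.
have s0 : 2 + s <= 0 by lra.
by rewrite (step_le0 s0) (step'_le0 s0) !mul0r subr0.
Qed.

Lemma bump'_le s : `|bump' s| <= 2 * expR 1 ^+ 2.
Proof.
rewrite /bump'.
move: (step_itv (2 + s)) (step_itv (2 - s)) (step'_itv (2 + s)) (step'_itv (2 - s)).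
move: (step _) (step (2 - s)) (step' _) (step' (2 - s)) => u v u' v'.
move=> /andP[u0 u1] /andP[v0 v1] /andP[u'0 u'1] /andP[v'0 v'1].
have h1 : u' * v <= expR 1 ^+ 2 by rewrite -[leRHS]mulr1 ler_pM.
have h2 : u * v' <= expR 1 ^+ 2 by rewrite -[leRHS]mul1r ler_pM.
have h3 : 0 <= u' * v by rewrite mulr_ge0.
have h4 : 0 <= u * v' by rewrite mulr_ge0.
by rewrite ler_norml; apply/andP; split; lra.
Qed.

End smooth_real.

(** * Smooth functions of several variables *)

Section smooth_rV.
Variables (R : realType) (n : nat).
Implicit Types (f g : 'rV[R]_n -> R) (x : 'rV[R]_n) (i j : 'I_n).

Definition is_partial i f f' := forall x, is_derive x (delta_mx 0 i) f (f' x).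

Fixpoint Ck (k : nat) f : Prop :=
  continuous f /\
  (if k is k'.+1 then exists f' : 'I_n -> 'rV[R]_n -> R,
    (forall i, is_partial i f (f' i)) /\ forall i, Ck k' (f' i) else True).

Lemma is_partialE i f f' : is_partial i f f' -> partial i f = f'.
Proof. by move=> ff'; apply/funext => x; exact: (@derive_val _ _ _ _ _ _ _ (ff' x)). Qed.

Lemma Ck_continuous k f : Ck k f -> continuous f.
Proof. by case: k => [|k] []. Qed.

Lemma CkW k f : Ck k.+1 f -> Ck k f.
Proof.
elim: k f => [|k IH] f [cf [f' [ff' kf']]]; first by split.
by split => //; exists f'; split => // i; exact: IH.
Qed.

Lemma smoothP f : smooth_on setT f <-> forall k, Ck k f.
Proof.
split=> [sf k|kf s].
  elim: k f sf => [|k IH] f sf; have cf : continuous f by move=> x; have [] := sf [::] x I.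
    by split.
  split=> //; exists (fun i => partial i f); split => i.
    by move=> x; apply: derivableP; exact: (sf [::] x I).2.
  by apply: IH => s x _; have := sf (rcons s i) x I; rewrite /iter_partial -cats1 foldr_cat.
(* [foldr] applies the last index of the list first, hence the induction from the end. *)
elim/last_ind: s f kf => [|s i IH] f kf x _.
  split; first exact: (kf 0%N).1.
  by have [_ [f' [ff' _]]] := kf 1%N; move=> i; have [] := ff' i x.
rewrite /iter_partial -cats1 foldr_cat /=; apply: IH => // k.
have [_ [f' [ff' kf']]] := kf k.+1.
rewrite (is_partialE (ff' i)); exact: kf'.
Qed.

(** Reduces directional derivatives to one variable, where the chain rule is available. *)
Lemma is_deriveP f x v (a : R) :
  is_derive x v f a <-> is_derive (0 : R) (1 : R) (fun h : R => f (h *: v + x)) a.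
Proof.
have E : (fun h : R => h^-1 *: (((fun h : R => f (h *: v + x)) \o shift 0) (h *: (1 : R)) - f (0 *: v + x)))
    = (fun h : R => h^-1 *: ((f \o shift x) (h *: v) - f x)).
  by apply/funext => h; rewrite /= scale0r add0r addr0 /GRing.scale/= mulr1.
by split=> -[d <-]; split; rewrite /derivable /derive ?E// -?E.
Qed.

Lemma is_derive_comp (b : R -> R) f x v (b' a : R) :
  is_derive (f x) (1 : R) b b' -> is_derive x v f a ->
  is_derive x v (fun x => b (f x)) (b' * a).
Proof.
move=> bb' /is_deriveP fa; apply/is_deriveP.
apply: (@is_derive1_comp _ b (fun h : R => f (h *: v + x))) => //.
by rewrite scale0r add0r.
Qed.

Lemma Ck_cst k (a : R) : Ck k (cst a).
Proof.
elim: k a => [|k IH] a; first by split => //; exact: cst_continuous.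
split; first exact: cst_continuous.
by exists (fun=> cst 0); split => // i x; exact: is_derive_cst.
Qed.

Lemma is_partial_coord i j :
  is_partial i (fun x : 'rV[R]_n => x 0 j) (cst ((i == j)%:R)).
Proof.
move=> x; apply/is_deriveP.
have /is_derive_eq := is_deriveD
  (is_deriveZ ((i == j)%:R : R) (is_derive_id (0 : R) (1 : R))) (is_derive_cst (x 0 j) (0 : R) (1 : R)).
move=> /(_ (i == j)%:R) H.
rewrite (_ : (fun h : R => _) = (((i == j)%:R : R) \*: id + cst (x 0 j))).
  by apply: H; rewrite addr0 /GRing.scale/= mulr1.
apply/funext => h; rewrite !mxE eqxx/= eq_sym; exact: (congr1 (fun y => y + _) (mulrC _ _)).
Qed.

Lemma Ck_coord k j : Ck k (fun x : 'rV[R]_n => x 0 j).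
Proof.
have c : continuous (fun x : 'rV[R]_n => x 0 j) by exact: coord_continuous.
case: k => [|k]; split => //.
exists (fun i => cst (i == j)%:R); split => i; first exact: is_partial_coord.
exact: Ck_cst.
Qed.

Lemma CkD k f g : Ck k f -> Ck k g -> Ck k (fun x => f x + g x).
Proof.
elim: k f g => [|k IH] f g kf kg; have c : continuous (fun x => f x + g x)
  by move=> x; exact: (cvgD (@Ck_continuous _ _ kf x) (@Ck_continuous _ _ kg x)).
  by split.
have [_ [f' [ff' kf']]] := kf; have [_ [g' [gg' kg']]] := kg.
split=> //; exists (fun i x => f' i x + g' i x); split => i.
  by move=> x; exact: (is_deriveD (ff' i x) (gg' i x)).
exact: (IH _ _ (kf' i) (kg' i)).
Qed.

Lemma is_partialM i f g f' g' : is_partial i f f' -> is_partial i g g' ->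
  is_partial i (fun x => f x * g x) (fun x => f x * g' x + g x * f' x).
Proof. by move=> ff' gg' x; exact: (is_deriveM (ff' x) (gg' x)). Qed.

Lemma CkM k f g : Ck k f -> Ck k g -> Ck k (fun x => f x * g x).
Proof.
elim: k f g => [|k IH] f g kf kg; have c : continuous (fun x => f x * g x)
  by move=> x; exact: (cvgM (@Ck_continuous _ _ kf x) (@Ck_continuous _ _ kg x)).
  by split.
have [_ [f' [ff' kf']]] := kf; have [_ [g' [gg' kg']]] := kg.
split=> //; exists (fun i x => f x * g' i x + g x * f' i x); split => i.
  exact: is_partialM.
apply: CkD; apply: IH; by [exact: kf'|exact: kg'|exact: CkW].
Qed.

Lemma is_partial_comp i (b b' : R -> R) f f' :
  (forall s : R, is_derive s (1 : R) b (b' s)) -> is_partial i f f' ->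
  is_partial i (fun x => b (f x)) (fun x => b' (f x) * f' x).
Proof. by move=> bb' ff' x; apply: is_derive_comp. Qed.

Lemma Ck_comp k (b : R -> R) f : diffn k b -> Ck k f -> Ck k (fun x => b (f x)).
Proof.
elim: k b f => [|k IH] b f kb kf; have c : continuous (fun x => b (f x))
  by move=> x; apply: continuous_comp; [exact: (@Ck_continuous _ _ kf x)|exact: (@diffn_continuous _ _ _ kb (f x))].
  by split.
have [_ [f' [ff' kf']]] := kf; have [b' [bb' kb']] := kb.
split=> //; exists (fun i x => b' (f x) * f' i x); split => i.
  exact: is_partial_comp.
by apply: CkM; [apply: IH => //; exact: CkW|exact: kf'].
Qed.

Lemma Ck_local k f :
  (forall x, exists g e, [/\ Ck k g, 0 < e & forall y, ball x e y -> g y = f y]) ->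
  Ck k f.
Proof.
elim: k f => [|k IH] f lf; have c : continuous f.
- move=> x; have [g [e [cg e0 gf]]] := lf x.
  have gfx : {near x, g =1 f} by apply/nbhs_ballP; exists e.
  rewrite /continuous_at -(gf _ (ballxx _ e0)).
  exact: (cvg_trans (near_eq_cvg gfx) (@Ck_continuous _ _ cg x)).
- by split.
- move=> x; have [g [e [cg e0 gf]]] := lf x.
  have gfx : {near x, g =1 f} by apply/nbhs_ballP; exists e.
  rewrite /continuous_at -(gf _ (ballxx _ e0)).
  exact: (cvg_trans (near_eq_cvg gfx) (@Ck_continuous _ _ cg x)).
split=> //; exists (fun i => partial i f); split => i.
  move=> x; have [g [e [[_ [g' [gg' _]]] e0 gf]]] := lf x.
  have gfx : {near x, g =1 f} by apply/nbhs_ballP; exists e.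
  have := near_eq_is_derive gfx (gg' i x) => d.
  exact: (derivableP (@ex_derive _ _ _ _ _ _ _ d)).
apply: IH => x; have [g [e [[_ [g' [gg' kg']]] e0 gf]]] := lf x.
have e20 : 0 < e / 2 by rewrite divr_gt0.
(* Halving the radius leaves, around each such [y], a ball on which [g] and [f] agree, so that their
   partial derivatives agree at [y]. *)
exists (g' i), (e / 2); split => // [|y xy]; first exact: kg'.
have gfy : {near y, g =1 f}.
  apply/nbhs_ballP; exists (e / 2) => // z yz; apply: gf.
  by rewrite [e]splitr; exact: ball_triangle xy yz.
have := near_eq_is_derive gfy (gg' i y) => d.
by rewrite /partial (@derive_val _ _ _ _ _ _ _ d).
Qed.

Definition smooth f := smooth_on setT f.

Lemma smooth_continuous f : smooth f -> continuous f.
Proof. by move=> /smoothP/(_ 0%N)/Ck_continuous. Qed.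

Lemma smooth_partial i f : smooth f -> smooth (partial i f).
Proof.
move=> /smoothP sf; apply/smoothP => k; have [_ [f' [ff' kf']]] := sf k.+1.
rewrite (is_partialE (ff' i)); exact: kf'.
Qed.

Lemma smooth_is_partial i f : smooth f -> is_partial i f (partial i f).
Proof.
move=> /smoothP sf; have [_ [f' [ff' kf']]] := sf 1%N.
rewrite (is_partialE (ff' i)); exact: ff'.
Qed.

Lemma smooth_cst (a : R) : smooth (cst a).
Proof. by apply/smoothP => k; exact: Ck_cst. Qed.

Lemma smooth_coord j : smooth (fun x => x 0 j).
Proof. by apply/smoothP => k; exact: Ck_coord. Qed.

Lemma smoothD f g : smooth f -> smooth g -> smooth (fun x => f x + g x).
Proof. by move=> /smoothP sf /smoothP sg; apply/smoothP => k; exact: CkD. Qed.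

Lemma smoothM f g : smooth f -> smooth g -> smooth (fun x => f x * g x).
Proof. by move=> /smoothP sf /smoothP sg; apply/smoothP => k; exact: CkM. Qed.

Lemma smoothZ (a : R) f : smooth f -> smooth (fun x => a * f x).
Proof. by move=> sf; apply: smoothM => //; exact: smooth_cst. Qed.

Lemma smoothB f g : smooth f -> smooth g -> smooth (fun x => f x - g x).
Proof.
move=> sf sg; have := smoothD sf (smoothZ (-1) sg).
by under eq_fun do rewrite mulN1r.
Qed.

Lemma smooth_comp (b : R -> R) f : smooth1 b -> smooth f -> smooth (fun x => b (f x)).
Proof. by move=> sb /smoothP sf; apply/smoothP => k; exact: Ck_comp. Qed.

Lemma smooth_sum (I : Type) (s : seq I) (P : pred I) (F : I -> 'rV[R]_n -> R) :
  (forall a, P a -> smooth (F a)) -> smooth (fun x => \sum_(a <- s | P a) F a x).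
Proof.
move=> sF; elim: s => [|a s IH].
  by under eq_fun do rewrite big_nil; exact: smooth_cst.
have [Pa|Pa] := boolP (P a); last by under eq_fun do rewrite big_cons (negbTE Pa).
under eq_fun do rewrite big_cons Pa.
by apply: smoothD => //; exact: sF.
Qed.

Lemma smooth_prod (I : Type) (s : seq I) (P : pred I) (F : I -> 'rV[R]_n -> R) :
  (forall a, P a -> smooth (F a)) -> smooth (fun x => \prod_(a <- s | P a) F a x).
Proof.
move=> sF; elim: s => [|a s IH].
  by under eq_fun do rewrite big_nil; exact: smooth_cst.
have [Pa|Pa] := boolP (P a); last by under eq_fun do rewrite big_cons (negbTE Pa).
under eq_fun do rewrite big_cons Pa.
by apply: smoothM => //; exact: sF.
Qed.

Lemma smooth_local f :
  (forall x, exists g e, [/\ smooth g, 0 < e & forall y, ball x e y -> g y = f y]) ->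
  smooth f.
Proof.
move=> lf; apply/smoothP => k; apply: Ck_local => x.
by have [g [e [/smoothP sg e0 gf]]] := lf x; exists g, e.
Qed.

Lemma partial_local i f g x e : 0 < e -> (forall y, ball x e y -> g y = f y) ->
  partial i f x = partial i g x.
Proof.
move=> e0 gf; rewrite /partial; apply/esym/near_eq_derive.
by apply/nbhs_ballP; exists e.
Qed.

Lemma partialD i f g : smooth f -> smooth g ->
  partial i (fun x => f x + g x) = fun x => partial i f x + partial i g x.
Proof.
move=> sf sg; apply: is_partialE => x.
exact: (is_deriveD (smooth_is_partial i sf x) (smooth_is_partial i sg x)).
Qed.

Lemma partialZ i (a : R) f : smooth f ->
  partial i (fun x => a * f x) = fun x => a * partial i f x.
Proof.
by move=> sf; apply: is_partialE => x; exact: (is_deriveZ a (smooth_is_partial i sf x)).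
Qed.

Lemma partialB i f g : smooth f -> smooth g ->
  partial i (fun x => f x - g x) = fun x => partial i f x - partial i g x.
Proof.
move=> sf sg; apply: is_partialE => x.
exact: (is_deriveB (smooth_is_partial i sf x) (smooth_is_partial i sg x)).
Qed.

Lemma partialM i f g : smooth f -> smooth g ->
  partial i (fun x => f x * g x) = fun x => f x * partial i g x + g x * partial i f x.
Proof.
by move=> sf sg; apply: is_partialE; apply: is_partialM; exact: smooth_is_partial.
Qed.

Lemma partial_compE i (b b' : R -> R) f :
  (forall s : R, is_derive s (1 : R) b (b' s)) -> smooth f ->
  partial i (fun x => b (f x)) = fun x => b' (f x) * partial i f x.
Proof.
by move=> bb' sf; apply: is_partialE; apply: is_partial_comp => //; exact: smooth_is_partial.
Qed.

Lemma partial_cst i (a : R) : partial i (cst a) = cst 0.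
Proof. by apply: is_partialE => x; exact: is_derive_cst. Qed.

End smooth_rV.

(** Dominated convergence applied to the squared differences, which are at most [4 h^2]. *)
Lemma sqint_dominated d (T : measurableType d) (R : realType)
    (mu : {measure set T -> \bar R}) (g : nat -> T -> R) (g0 h : T -> R) :
  (forall k, measurable_fun setT (g k)) -> sqint mu h ->
  (forall k x, `|g k x| <= h x) ->
  (forall x, g k x @[k --> \oo] --> g0 x) ->
  sqint mu g0 /\ nrm mu (fun x => g k x - g0 x) @[k --> \oo] --> 0.
Proof.
move=> mg sh gh cg.
have h0 x : 0 <= h x by apply: le_trans (gh 0%N x).
have mg0 : measurable_fun setT g0 by apply: (measurable_fun_cvg mg) => x _; exact: cg.
have g0h x : `|g0 x| <= h x.
  have c : `|g k x| @[k --> \oo] --> `|g0 x| by apply: cvg_norm; exact: cg.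
  rewrite -(cvg_lim _ c)//; apply: limr_le; first by apply/cvg_ex; eexists; exact: c.
  exact: nearW.
have sq (u : T -> R) : measurable_fun setT u -> (forall x, `|u x| <= h x) -> sqint mu u.
  move=> m_u uh; apply: (sqint_dom _ _ sh) => // x.
  by rewrite -[_ ^+ 2]real_normK ?num_real// ler_pXn2r ?nnegrE.
have sg0 : sqint mu g0 by exact: sq.
split => //.
have sd k : sqint mu (fun x => g k x - g0 x) by apply: sqintB => //; exact: sq.
have D3 := @dominated_convergence _ _ _ mu setT measurableT
  (fun k x => ((g k x - g0 x) ^+ 2)%:E) (cst 0%E) (fun x => 4%:E * (h x ^+ 2)%:E)%E.
have {}D3 : (\int[mu]_x (((g k x - g0 x) ^+ 2)%:E))%E @[k --> \oo] --> 0%E.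
  rewrite -[X in _ --> X](@integral0 _ _ _ mu setT); case: D3; last by move=> _ _.
  - by move=> k; apply/measurable_EFinP/measurable_funX/measurable_funB.
  - exact: measurable_cst.
  - apply: nearW => x _; apply: cvg_EFin; first exact: nearW.
    rewrite /comp/= -[X in _ --> X](_ : (g0 x - g0 x) * (g0 x - g0 x) = 0); last by ring.
    under eq_fun do rewrite /= expr2.
    by apply: cvgM; apply: cvgB => //; exact: cvg_cst.
  - by apply: integrableZl => //; case: sh.
  - apply: nearW => x k _ /=; rewrite ger0_norm ?sqr_ge0// -EFinM lee_fin.
    have := gh k x; have := g0h x; rewrite !ler_norml => /andP[? ?] /andP[? ?].
    nra.
have : fine (\int[mu]_x (((g k x - g0 x) ^+ 2)%:E))%E @[k --> \oo] --> 0.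
  exact: fine_cvg.
have E k : fine (\int[mu]_x (((g k x - g0 x) ^+ 2)%:E))%E = nrm mu (fun x => g k x - g0 x) ^+ 2.
  by rewrite nrm_sqr /ip /Rintegral; under [in RHS]eq_integral do rewrite -expr2.
under eq_fun do rewrite E.
move=> /(continuous_cvg _ (@sqrt_continuous R 0)).
rewrite sqrtr0; apply: cvg_trans; apply: near_eq_cvg; apply: nearW => k /=.
by rewrite sqrtr_sqr ger0_norm// nrm_ge0.
Qed.

(** * Compactly supported smooth functions: translations, integration by parts, Poincare
    inequality *)

Section compactly_supported.
Variables (R : realType) (n : nat).
Local Notation mu := (lebesgue R n).
Implicit Types (f g : 'rV[R]_n -> R) (x v : 'rV[R]_n) (i j : 'I_n).

Definition suppc (B : R) f := forall x, f x != 0 -> cube B x.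

Definition Cc f := smooth f /\ exists B, suppc B f.

Lemma suppc_ge B B' f : B <= B' -> suppc B f -> suppc B' f.
Proof.
by move=> BB' sf x /sf /cubeP fx; apply/cubeP => i; exact: le_trans (fx i) BB'.
Qed.

Lemma compact_cube B : compact (@cube R n B).
Proof. by apply: rV_compact => i; exact: segment_compact. Qed.

Lemma compact_sub_cube (K : set 'rV[R]_n) : compact K -> exists B, K `<=` cube B.
Proof.
move=> cK; have [B [_ KB]] := compact_bounded cK.
exists (B + 1) => x Kx; apply/cubeP => i.
apply: le_trans (KB (B + 1) _ x Kx); last by rewrite ltrDl.
rewrite [leRHS]mx_normrE.
exact: (@le_bigmax _ _ _ 0 (fun i : 'I_1 * 'I_n => `|x i.1 i.2|) (0, i)).
Qed.

Lemma test_function_Cc A f : test_function A f -> Cc f.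
Proof.
move=> [sf [K [cK KA Kf]]]; split => //.
have [B KB] := compact_sub_cube cK; exists B => x fx.
by apply: KB; apply: contrapT => nKx; move: fx; rewrite Kf// eqxx.
Qed.

Lemma Cc_bounded f : Cc f -> exists2 M, 0 <= M & forall x, `|f x| <= M.
Proof.
move=> [sf [B sB]].
have cf : {within cube B, continuous f}.
  by apply: continuous_subspaceT; exact: smooth_continuous sf.
have /compact_bounded[M [_ Mf]] := continuous_compact cf (@compact_cube B).
exists (`|M| + 1) => [|x]; first by rewrite addr_ge0.
have [fx|/sB xB] := eqVneq (f x) 0; first by rewrite fx normr0 addr_ge0.
apply: (Mf (`|M| + 1)); last by exists x.
by apply: le_lt_trans (ler_norm M) _; rewrite ltrDl.
Qed.

Lemma sqint_cube B (M : R) : sqint mu (fun x => M * \1_(cube B) x).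
Proof.
apply: sqintZ; split; first by apply: measurable_indic; exact: measurable_cube.
rewrite (_ : EFin \o _ = EFin \o \1_(cube B)); last first.
  by apply/funext => x /=; rewrite indicE; case: (_ \in _); rewrite ?expr1n ?expr0n.
apply/integrableP; split.
  by apply/measurable_EFinP; apply: measurable_indic; exact: measurable_cube.
under eq_integral => x _ do rewrite /= ger0_norm//.
rewrite integral_indic ?setIT//; last exact: measurable_cube.
have [B0|B0] := leP 0 B; first by rewrite lebesgue_cube ?ltry.
apply: (@le_lt_trans _ _ (mu (cube 0))).
  apply: le_measure; rewrite ?inE; [exact: measurable_cube|exact: measurable_cube|].
  by move=> x /cubeP xB; apply/cubeP => i; apply: le_trans (xB i) _; exact: ltW.
by rewrite lebesgue_cube ?ltry.
Qed.

Lemma integrable_cube B (M : R) :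
  mu.-integrable setT (EFin \o (fun x => M * \1_(cube B) x)).
Proof.
have := sqint_mul (sqint_cube B M) (sqint_cube B 1); congr integrable.
by apply/funext => x /=; rewrite indicE; case: (x \in _) => /=; rewrite ?mulr1 ?mulr0.
Qed.

Lemma suppc_le B f (M : R) : suppc B f -> (forall x, `|f x| <= M) ->
  forall x, `|f x| <= M * \1_(cube B) x.
Proof.
move=> sB fM x; have [fx|/sB xB] := eqVneq (f x) 0.
  by rewrite fx normr0 mulr_ge0//; exact: le_trans (fM x).
by rewrite indicE mem_set// mulr1.
Qed.

Lemma Cc_measurable f : Cc f -> measurable_fun setT f.
Proof. by move=> [sf _]; apply: continuous_measurable_rV; exact: smooth_continuous. Qed.

Lemma Cc_sqint f : Cc f -> sqint mu f.
Proof.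
move=> cf; have [M M0 fM] := Cc_bounded cf; have [_ [B sB]] := cf.
apply: (sqint_dom _ _ (sqint_cube B M)); first exact: Cc_measurable.
move=> x; rewrite -[f x ^+ 2]real_normK ?num_real// ler_pXn2r ?nnegrE ?mulr_ge0//.
exact: suppc_le.
Qed.

Lemma Cc_integrable f : Cc f -> mu.-integrable setT (EFin \o f).
Proof.
move=> cf; have [M M0 fM] := Cc_bounded cf; have [_ [B sB]] := cf.
apply: le_integrable (integrable_cube B M) => //.
  by apply/measurable_EFinP; exact: Cc_measurable.
by move=> x _ /=; rewrite lee_fin [leRHS]ger0_norm ?mulr_ge0//; exact: suppc_le.
Qed.

Lemma partial_suppc B i f : smooth f -> suppc B f -> suppc B (partial i f).
Proof.
move=> sf sB x; apply: contra_neqP => nx.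
have /nbhs_ballP[e e0 ef] : nbhs x (~` cube B).
  apply: open_nbhs_nbhs; split => //; apply: closed_openC.
  by apply: compact_closed; [exact: norm_hausdorff|exact: compact_cube].
rewrite (@partial_local _ _ i f (cst 0) x e)//; first exact: (congr1 (fun h => h x) (partial_cst i 0)).
move=> y /ef yB /=; apply/esym/eqP; apply: contrapT => /negP /sB; exact: yB.
Qed.

Lemma Cc_partial i f : Cc f -> Cc (partial i f).
Proof.
by move=> [sf [B sB]]; split; [exact: smooth_partial|exists B; exact: partial_suppc].
Qed.

Lemma CcD f g : Cc f -> Cc g -> Cc (fun x => f x + g x).
Proof.
move=> [sf [B sB]] [sg [C sC]]; split; first exact: smoothD.
exists (Num.max B C) => x fgx.
have [fx|fx] := eqVneq (f x) 0.
  by apply: (suppc_ge _ sC); [rewrite le_max lexx orbT|move: fgx; rewrite fx add0r].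
by apply: (suppc_ge _ sB) => //; rewrite le_max lexx.
Qed.

Lemma CcM f g : smooth f -> Cc g -> Cc (fun x => f x * g x).
Proof.
move=> sf [sg [C sC]]; split; first exact: smoothM.
by exists C => x; rewrite mulf_eq0 => /norP[_ gx]; exact: sC.
Qed.

Lemma CcZ (a : R) f : Cc f -> Cc (fun x => a * f x).
Proof. by move=> cf; apply: CcM => //; exact: smooth_cst. Qed.

Lemma CcB f g : Cc f -> Cc g -> Cc (fun x => f x - g x).
Proof.
move=> cf cg; have := CcD cf (CcZ (-1) cg).
by under eq_fun do rewrite mulN1r.
Qed.

Lemma integral_translationT v (f : 'rV[R]_n -> \bar R) : measurable_fun setT f ->
  (\int[mu]_x f (x + v)%R = \int[mu]_x f x)%E.
Proof.
move=> mf; rewrite [LHS]integralE [RHS]integralE.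
congr (_ - _)%E.
  under eq_integral do rewrite funeposE -(funeposE f).
  by apply: (@integral_translation R n v (f^\+)%E) => //; exact: measurable_funepos.
under eq_integral do rewrite funenegE -(funenegE f).
  by apply: (@integral_translation R n v (f^\-)%E) => //; exact: measurable_funeneg.
Qed.

Lemma sqint_translation v f : sqint mu f -> sqint mu (fun x => f (x + v)).
Proof.
move=> [mf If]; have mv := measurable_translation v.
split; first exact: measurableT_comp mf mv.
have /integrableP[m2 i2] := If; apply/integrableP; split.
  exact: measurableT_comp m2 mv.
by rewrite (integral_translationT v (f := fun x => `|(EFin \o (fun x => f x ^+ 2)%R) x|%E))//; exact: measurableT_comp.
Qed.

Lemma nrm_translation v f : measurable_fun setT f ->
  nrm mu (fun x => f (x + v)) = nrm mu f.
Proof.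
move=> mf; rewrite /nrm /ip /Rintegral; congr (Num.sqrt (fine _)).
rewrite (integral_translationT v (f := fun x => (f x * f x)%:E))//.
by apply/measurable_EFinP; exact: measurable_funM.
Qed.

Definition e_ i : 'rV[R]_n := delta_mx 0 i.

Lemma partial_MVT i f x (h M : R) : smooth f -> (forall x, `|partial i f x| <= M) ->
  `|f (x + h *: e_ i) - f x| <= `|h| * M.
Proof.
move=> sf fM.
have D (t : R) : is_derive t (1 : R) (fun t : R => f (t *: e_ i + x)) (partial i f (t *: e_ i + x)).
  have /is_deriveP := smooth_is_partial i sf (t *: e_ i + x).
  have /is_derive_eq Dt : is_derive t (1 : R) (fun s : R => s - t) 1.
    have /is_derive_eq := is_deriveB (is_derive_id t (1 : R)) (is_derive_cst t t (1 : R)).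
    by apply; rewrite subr0.
  move=> D0.
  have D0' : is_derive (t - t) (1 : R) (fun h : R => f (h *: delta_mx 0 i + (t *: e_ i + x)))
      (partial i f (t *: e_ i + x)) by rewrite subrr.
  have := @is_derive1_comp _ (fun h : R => f (h *: delta_mx 0 i + (t *: e_ i + x)))
    (fun s : R => s - t) t _ _ D0' (Dt 1 erefl).
  rewrite mulr1; congr is_derive; apply/funext => s /=; congr f.
  by rewrite addrA -scalerDl subrK.
have cD : continuous (fun t : R => f (t *: e_ i + x)) by exact: is_derive1_continuous D.
have dist (a b : R) : a < b -> `|f (b *: e_ i + x) - f (a *: e_ i + x)| <= (b - a) * M.
  move=> ab.
  have [|c _ ->] := @MVT R (fun t : R => f (t *: e_ i + x))
    (fun t : R => partial i f (t *: e_ i + x)) a b ab (fun t _ => D t).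
    exact: continuous_subspaceT.
  rewrite normrM (gtr0_norm (x := b - a)) ?subr_gt0// mulrC.
  by rewrite ler_wpM2l// subr_ge0 ltW.
have [h0|h0|->] := ltgtP h 0.
- have := dist _ _ h0; rewrite scale0r add0r sub0r (ltr0_norm h0) distrC.
  by rewrite (addrC x).
- have := dist _ _ h0; rewrite scale0r add0r subr0 (gtr0_norm h0).
  by rewrite (addrC x).
- by rewrite scale0r addr0 subrr normr0 mul0r.
Qed.

Definition diffq i f (h : R) x : R := h^-1 * (f (x + h *: e_ i) - f x).

(** Prepares dominated convergence. The mean value theorem bounds the quotients by the supremum of
    the derivative, and [|h k| <= |h 0|] keeps all their supports in one cube. *)
Lemma diffq_cvg i f (h : nat -> R) : Cc f -> (forall k, h k != 0) ->
  h k @[k --> \oo] --> 0 -> (forall k, `|h k| <= `|h 0%N|) ->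
  (forall x, diffq i f (h k) x @[k --> \oo] --> partial i f x) /\
  exists M B, forall k x, `|diffq i f (h k) x| <= M * \1_(cube B) x.
Proof.
move=> cf h0 ch hle; split => [x|].
  have := smooth_is_partial i cf.1 x => d.
  have c0 := @ex_derive _ _ _ _ _ _ _ d; have c1 := @derive_val _ _ _ _ _ _ _ d.
  have {c0 c1} c : h^-1 *: ((f \o shift x) (h *: delta_mx 0 i) - f x) @[h --> (0 : R)^'] --> partial i f x.
    by rewrite -[X in _ --> X]c1; exact: c0.
  by move/cvgr_dnbhsP : c => /(_ h (conj h0 ch)); under eq_fun do rewrite /= [_ + x]addrC.
have [M M0 fM] := Cc_bounded (Cc_partial i cf); have [sf [B sB]] := cf.
exists M, (B + `|h 0%N|) => k x.
have [xB|xB] := boolP (x \in @cube R n (B + `|h 0%N|)).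
  rewrite indicE xB mulr1 /diffq normrM normfV ler_pdivrMl ?normr_gt0//.
  exact: partial_MVT.
have out y : cube B y -> (forall j, `|x 0 j - y 0 j| <= `|h 0%N|) -> False.
  move=> yB xy; move/negP : xB; apply; rewrite inE; apply/cubeP => j.
  have := xy j; move/cubeP : yB => /(_ j) yj xj.
  rewrite -[x 0 j](subrK (y 0 j)) addrC; apply: le_trans (ler_normD _ _) _; exact: lerD.
rewrite indicE (negbTE xB) mulr0 /diffq.
have -> : f x = 0.
  apply/eqP; apply: contrapT => /negP /sB xB'; apply: (out x xB') => j.
  by rewrite subrr normr0.
have -> : f (x + h k *: e_ i) = 0.
  apply/eqP; apply: contrapT => /negP /sB xB'; apply: (out _ xB') => j.
  rewrite !mxE opprD addNKr normrN eqxx/=.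
  apply: le_trans (hle k); case: eqVneq => _; rewrite ?mulr1// mulr0 normr0.
  exact: normr_ge0.
by rewrite subrr mulr0 normr0.
Qed.

Lemma measurable_diffq i f h : measurable_fun setT f -> measurable_fun setT (diffq i f h).
Proof.
move=> mf; apply: measurable_funM => //; apply: measurable_funB => //.
exact: measurableT_comp mf (measurable_translation (h *: e_ i)).
Qed.

Lemma diffq_nrm_cvg i f (h : nat -> R) : Cc f -> (forall k, h k != 0) ->
  h k @[k --> \oo] --> 0 -> (forall k, `|h k| <= `|h 0%N|) ->
  nrm mu (fun x => diffq i f (h k) x - partial i f x) @[k --> \oo] --> 0.
Proof.
move=> cf h0 ch hle; have [c [M [B b]]] := diffq_cvg i cf h0 ch hle.
have := @sqint_dominated _ _ _ mu (fun k => diffq i f (h k)) (partial i f) (fun x => M * \1_(cube B) x).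
by case=> // [k|]; [apply: measurable_diffq; exact: Cc_measurable|exact: sqint_cube].
Qed.

(* Telescope the translation into [k.+1] equal steps and let [k] go to infinity. *)
Lemma nrm_translation1_le i f (a : R) : Cc f ->
  nrm mu (fun x => f (x + a *: e_ i) - f x) <= `|a| * nrm mu (partial i f).
Proof.
move=> cf; have [->|a0] := eqVneq a 0.
  rewrite normr0 mul0r le_eqVlt; apply/orP; left; apply/eqP; apply: ae0_nrm.
    by apply: nearW => x _; rewrite scale0r addr0 subrr.
  under eq_fun do rewrite scale0r addr0 subrr; exact: measurable_cst.
pose h k : R := a / k.+1%:R.
have h0 k : h k != 0 by rewrite mulf_neq0// invr_eq0 pnatr_eq0.
have ch : h k @[k --> \oo] --> 0.
  rewrite -(mulr0 a); apply: cvgM; [exact: cvg_cst|exact: cvg_harmonic].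
have hle k : `|h k| <= `|h 0%N|.
  rewrite /h !normrM ler_wpM2l// invr1 normr1 gtr0_norm ?invr_gt0//.
  by rewrite invf_le1 ?ler1n.
have sf := Cc_sqint cf.
have step (b : R) : sqint mu (fun x => f (x + b *: e_ i) - f x).
  by apply: sqintB => //; exact: sqint_translation.
have tel k m : nrm mu (fun x => f (x + (m%:R * h k) *: e_ i) - f x) <=
    m%:R * nrm mu (fun x => f (x + h k *: e_ i) - f x).
  elim: m => [|m IH].
    rewrite !mul0r le_eqVlt; apply/orP; left; apply/eqP; apply: ae0_nrm.
      by apply: nearW => x _; rewrite scale0r addr0 subrr.
    under eq_fun do rewrite scale0r addr0 subrr; exact: measurable_cst.
  rewrite (_ : (fun x => _) = (fun x =>
    (f ((x + (m%:R * h k) *: e_ i) + h k *: e_ i) - f (x + (m%:R * h k) *: e_ i)) +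
    (f (x + (m%:R * h k) *: e_ i) - f x))); last first.
    apply/funext => x; rewrite addrA subrK -addrA -scalerDl.
    by congr (f (x + _ *: _) - _); rewrite -natr1 mulrDl mul1r.
  apply: le_trans (nrmD (sqint_translation ((m%:R * h k) *: e_ i) (step (h k))) (step _)) _.
  rewrite (nrm_translation ((m%:R * h k) *: e_ i) (f := fun x => f (x + h k *: e_ i) - f x)); last by case: (step (h k)).
  by rewrite -natr1 mulrDl mul1r addrC lerD2r.
have bd k : nrm mu (fun x => f (x + a *: e_ i) - f x) <= `|a| * nrm mu (diffq i f (h k)).
  have ahk : a = k.+1%:R * h k by rewrite /h mulrC divfK// pnatr_eq0.
  have -> : nrm mu (fun x => f (x + a *: e_ i) - f x) =
      nrm mu (fun x => f (x + (k.+1%:R * h k) *: e_ i) - f x) by rewrite -ahk.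
  apply: le_trans (tel k k.+1) _.
  rewrite /diffq (nrmZ _ (step (h k))) mulrA -normrM {1}ahk mulfK//.
  by rewrite ger0_norm.
have c : `|a| * (nrm mu (fun x => diffq i f (h k) x - partial i f x) + nrm mu (partial i f))
    @[k --> \oo] --> `|a| * nrm mu (partial i f).
  rewrite -{2}[nrm mu _]add0r; apply: cvgM; first exact: cvg_cst.
  by apply: cvgD; [exact: diffq_nrm_cvg|exact: cvg_cst].
rewrite -(cvg_lim _ c)//; apply: limr_ge; first by apply/cvg_ex; eexists; exact: c.
apply: nearW => k; apply: le_trans (bd k) _; rewrite ler_wpM2l//.
have sp := Cc_sqint (Cc_partial i cf).
have sd : sqint mu (diffq i f (h k)) by apply: sqintZ; exact: step.
have := nrmD (sqintB sd sp) sp.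
rewrite (_ : (fun x => diffq i f (h k) x - partial i f x + partial i f x) = diffq i f (h k))//.
by apply/funext => x; rewrite subrK.
Qed.

(** Walks from [x] to [x + v] one coordinate at a time. Each leg is a translate of a one-coordinate
    difference, and the norm is translation invariant. *)
Lemma nrm_translation_le f v : Cc f ->
  nrm mu (fun x => f (x + v) - f x) <= \sum_i `|v 0 i| * nrm mu (partial i f).
Proof.
move=> cf.
have -> : v = \sum_(i <- index_enum 'I_n) v 0 i *: e_ i.
  by rewrite {1}[v]row_sum_delta.
have E i : (\sum_(i <- index_enum 'I_n) v 0 i *: e_ i : 'rV[R]_n) 0 i = v 0 i.
  by rewrite -row_sum_delta.
under [leRHS]eq_bigr do rewrite E.
have sf := Cc_sqint cf.
elim: (index_enum _) => [|i s IH].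
  rewrite !big_nil le_eqVlt; apply/orP; left; apply/eqP; apply: ae0_nrm.
    by apply: nearW => x _; rewrite addr0 subrr.
  by under eq_fun do rewrite addr0 subrr; exact: measurable_cst.
rewrite !big_cons; set W := \sum_(j <- s) _ in IH *.
have st : sqint mu (fun x => f (x + v 0 i *: e_ i) - f x).
  by apply: sqintB => //; exact: sqint_translation.
rewrite (_ : (fun x => _) = (fun x =>
    (f ((x + W) + v 0 i *: e_ i) - f (x + W)) + (f (x + W) - f x))); last first.
  by apply/funext => x; rewrite [X in f X - _]addrCA [X in f X - _]addrC; ring.
apply: le_trans (nrmD (sqint_translation W st) _) _.
  by apply: sqintB => //; exact: sqint_translation.
apply: lerD => //.
rewrite (nrm_translation W (f := fun x => f (x + v 0 i *: e_ i) - f x)); last by case: st.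
exact: nrm_translation1_le.
Qed.

(** Translation invariance makes the integral of every difference quotient vanish; dominated
    convergence passes this to the derivative. *)
Lemma integral_partial i f : Cc f -> \int[mu]_x partial i f x = 0.
Proof.
move=> cf; pose h k : R := k.+1%:R^-1.
have h0 k : h k != 0 by rewrite invr_eq0 pnatr_eq0.
have ch : h k @[k --> \oo] --> 0 by exact: cvg_harmonic.
have hle k : `|h k| <= `|h 0%N|.
  by rewrite /h invr1 normr1 gtr0_norm ?invr_gt0// invf_le1 ?ler1n.
have [c [M [B b]]] := diffq_cvg i cf h0 ch hle.
have If := Cc_integrable cf.
have D3 := @dominated_convergence _ _ _ mu setT measurableT
  (fun k x => (diffq i f (h k) x)%:E) (fun x => (partial i f x)%:E)
  (fun x => (M * \1_(cube B) x)%:E).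
have {}D3 : (\int[mu]_x (diffq i f (h k) x)%:E)%E @[k --> \oo] --> (\int[mu]_x (partial i f x)%:E)%E.
  case: D3; last by move=> _ _.
  - by move=> k; apply/measurable_EFinP; apply: measurable_diffq; exact: Cc_measurable.
  - by apply/measurable_EFinP; apply: Cc_measurable; exact: Cc_partial.
  - by apply: nearW => x _; apply: cvg_EFin; [exact: nearW|exact: c].
  - exact: integrable_cube.
  - by apply: nearW => x k _; rewrite /= lee_fin.
have E k : (\int[mu]_x (diffq i f (h k) x)%:E = 0)%E.
  rewrite /diffq; under eq_integral do rewrite EFinM EFinB.
  have mt : measurable_fun setT (fun x => f (x + h k *: e_ i)).
    exact: measurableT_comp (Cc_measurable cf) (measurable_translation _).
  have It : mu.-integrable setT (fun x => (f (x + h k *: e_ i))%:E).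
    have /integrableP[m2 i2] := If; apply/integrableP; split; first exact/measurable_EFinP.
    by rewrite (integral_translationT (h k *: e_ i) (f := fun x => `|(f x)%:E|%E))//; exact: measurableT_comp.
  rewrite integralZl//; last exact: integrableB.
  rewrite integralB//.
  rewrite (integral_translationT (h k *: e_ i) (f := fun x => (f x)%:E))//; last by case/integrableP : If.
  by rewrite subee ?mule0//; apply: integrable_fin_num.
rewrite /Rintegral -[RHS](_ : fine 0%E = 0)//; congr fine.
move: D3; under eq_fun do rewrite E; move=> c0.
by rewrite -(cvg_lim _ c0)// lim_cst.
Qed.

(** The product of [partial i f] and [g] has compact support, so its i-th derivative integrates to
    zero. Only [g] carries the support condition: [f] will be the barrier [w], which does not vanish
    at infinity. *)
Lemma integration_by_parts_Cc i f g : smooth f -> Cc g ->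
  ip mu (partial i f) (partial i g) = - \int[mu]_x (partial i (partial i f) x * g x).
Proof.
move=> sf cg; have sp := smooth_partial i sf.
have := integral_partial i (CcM sp cg).
rewrite (partialM i sp cg.1) RintegralD//.
- rewrite /ip; under [X in _ + X]eq_Rintegral do rewrite mulrC.
  by move/eqP; rewrite addr_eq0 => /eqP.
- by apply: (Cc_integrable (f := fun x => partial i f x * partial i g x)); exact: CcM sp (Cc_partial i cg).
- apply: (Cc_integrable (f := fun x => g x * partial i (partial i f) x)).
  under eq_fun do rewrite mulrC.
  exact: CcM (smooth_partial i sp) cg.
Qed.

(** A shift by [2 B + 1] moves the cube off itself, so wherever [f x] is nonzero it equals, up to
    sign, the difference bounded by [nrm_translation1_le]. *)
Lemma poincare B i f : 0 <= B -> Cc f -> suppc B f ->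
  nrm mu f <= (2 * B + 1) * nrm mu (partial i f).
Proof.
move=> B0 cf sB; have sf := Cc_sqint cf.
have B1 : 0 <= 2 * B + 1 by rewrite addr_ge0// mulr_ge0.
rewrite -{1}[2 * B + 1]ger0_norm//.
apply: le_trans (nrm_translation1_le i (2 * B + 1) cf).
apply: nrm_le => //.
  by apply: sqintB => //; exact: sqint_translation.
move=> x; have [->|fx] := eqVneq (f x) 0; first by rewrite expr0n sqr_ge0.
have -> : f (x + (2 * B + 1) *: e_ i) = 0; last by rewrite sub0r sqrrN.
apply/eqP; apply: contrapT => /negP /sB /cubeP/(_ i); rewrite !mxE !eqxx mulr1.
have /cubeP/(_ i) := sB x fx.
by rewrite !ler_norml => /andP[? ?] /andP[? ?]; lra.
Qed.

End compactly_supported.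

(** * A Poincare inequality modulo averages over a grid of cubes *)

Section cells.
Variables (R : realType) (n : nat).
Local Notation mu := (lebesgue R n).
Implicit Types (f g : 'rV[R]_n -> R) (x y z v : 'rV[R]_n) (i : 'I_n).

Lemma ip_EFin d (T : measurableType d) (nu : {measure set T -> \bar R}) (u : T -> R) :
  sqint nu u -> (\int[nu]_x (u x ^+ 2)%:E = (ip nu u u)%:E)%E.
Proof.
move=> [m_u Iu]; rewrite /ip /Rintegral fineK.
  by apply: eq_integral => x _; rewrite expr2.
by have := integrable_fin_num measurableT Iu; under eq_fun do rewrite /= expr2.
Qed.

Section one_cell.
Variables (Q : set 'rV[R]_n) (mQ : measurable Q) (m : R) (Qm : mu Q = m%:E).
Variables (f : 'rV[R]_n -> R) (cf : Cc f).

Let q : 'rV[R]_n -> R := \1_Q.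
Let fQ x := q x * f x.
Let a := ip mu fQ fQ.
Let b := ip mu fQ q.

Lemma sqint_indic : sqint mu q.
Proof.
split; first exact: measurable_indic.
rewrite (_ : EFin \o _ = EFin \o q); last first.
  by apply/funext => x /=; rewrite /q indicE; case: (x \in _); rewrite /= ?expr1n ?expr0n.
apply/integrableP; split; first by apply/measurable_EFinP; exact: measurable_indic.
under eq_integral => x _ do rewrite /= ger0_norm//.
by rewrite integral_indic ?setIT// Qm ltry.
Qed.

Let sq := sqint_indic.

Let sfQ : sqint mu fQ.
Proof.
apply: (sqint_dom _ _ (Cc_sqint cf)).
  by apply: measurable_funM; [exact: measurable_indic|exact: Cc_measurable].
by move=> x; rewrite /fQ /q indicE; case: (x \in _); rewrite /= ?mul1r// mul0r expr0n sqr_ge0.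
Qed.

Lemma ip_indic : ip mu q q = m.
Proof.
apply: EFin_inj; rewrite -ip_EFin// -Qm.
rewrite -[in RHS](setIT Q) -integral_indic//.
by apply: eq_integral => x _; rewrite /q indicE; case: (x \in _); rewrite /= ?expr1n ?expr0n.
Qed.

Let qq := ip_indic.

Lemma cell_inner y :
  (\int[mu]_x (q x * q y * (f x - f y) ^+ 2)%:E =
   (a * (q y * q y) + (- 2 * b) * (fQ y * q y) + m * (fQ y * fQ y))%:E)%E.
Proof.
(* Indicators are idempotent, so for fixed [y] the integrand is the square of a combination of [fQ]
   and [q]. *)
have E x : q x * q y * (f x - f y) ^+ 2 = (q y * fQ x - fQ y * q x) ^+ 2.
  by rewrite /fQ /q !indicE; case: (x \in _); case: (y \in _) => /=; ring.
under eq_integral do rewrite E.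
have s1 := sqintZ (q y) sfQ; have s2 := sqintZ (fQ y) sq.
rewrite ip_EFin; last exact: sqintB.
congr EFin; rewrite (ipBl s1 s2 (sqintB s1 s2)) (ipBr s1 s2 s1) (ipBr s1 s2 s2).
rewrite (ipZl (q y) sfQ s1) (ipZl (q y) sfQ s2) (ipZl (fQ y) sq s1) (ipZl (fQ y) sq s2).
rewrite (ipZr (q y) sfQ sfQ) (ipZr (fQ y) sfQ sq) (ipZr (q y) sq sfQ) (ipZr (fQ y) sq sq).
by rewrite (ipC _ q fQ) qq -/a -/b; ring.
Qed.

(** The variance identity on [Q]: a bound on the double integral controls [a], the mass of [f] on
    [Q], by [b^2 / m], with [b] the integral of [f] over [Q]. *)
Lemma cell_double :
  (\int[mu]_y \int[mu]_x (q x * q y * (f x - f y) ^+ 2)%:E =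
   (2 * m * a - 2 * b ^+ 2)%:E)%E.
Proof.
under eq_integral do rewrite cell_inner.
have i1 := sqint_mul sq sq; have i2 := sqint_mul sfQ sq; have i3 := sqint_mul sfQ sfQ.
have scale (c : R) (u : 'rV[R]_n -> R) : mu.-integrable setT (EFin \o u) ->
    mu.-integrable setT (EFin \o (fun x => c * u x)).
  move=> Iu; have := @integrableZl _ _ _ mu setT measurableT c _ Iu.
  exact: eq_integrable.
have add (u v : 'rV[R]_n -> R) : mu.-integrable setT (EFin \o u) ->
    mu.-integrable setT (EFin \o v) -> mu.-integrable setT (EFin \o (fun x => u x + v x)).
  move=> Iu Iv; have := @integrableD _ _ _ mu setT measurableT _ _ Iu Iv.
  exact: eq_integrable.
have j1 := scale a _ i1; have j2 := scale (- 2 * b) _ i2; have j3 := scale m _ i3.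
rewrite -[LHS]fineK; last by apply: integrable_fin_num => //; exact: add _ _ (add _ _ j1 j2) j3.
congr EFin.
rewrite -[LHS]/(\int[mu]_y (a * (q y * q y) + (- 2 * b) * (fQ y * q y) + m * (fQ y * fQ y))).
rewrite RintegralD//; last exact: add.
rewrite RintegralD// !RintegralZl//.
rewrite -/(ip mu q q) -/(ip mu fQ q) -/(ip mu fQ fQ) qq -/a -/b.
by ring.
Qed.

End one_cell.

Variables (lo h : R) (h0 : 0 < h) (N : nat).

(** Half-open, so that the cells tile the large box and their indicators sum exactly to its
    indicator ([sum_cell]). *)
Definition cell_itv (k : nat) : set R := `[lo + h * k%:R, lo + h * k.+1%:R[%classic.

Definition cell (j : {ffun 'I_n -> 'I_N}) : set 'rV[R]_n := box (fun i => cell_itv (j i)).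

Lemma measurable_cell j : measurable (cell j).
Proof. by apply: measurable_box => i; exact: measurable_itv. Qed.

Lemma lebesgue_cell j : mu (cell j) = (h ^+ n)%:E.
Proof.
rewrite (@lebesgue_box _ _ _ (fun=> h)) ?prodr_const ?card_ord//.
- by move=> i; exact: measurable_itv.
- move=> i; rewrite lebesgue_measure_itv/= lte_fin ltrD2l ltr_pM2l// ltr_nat ltnSn.
  by rewrite -EFinB; congr EFin; rewrite -natr1; ring.
Qed.

Lemma sum_cell_itv M (s : R) :
  \sum_(k < M) (\1_(cell_itv k) s : R) = \1_(`[lo, lo + h * M%:R[%classic) s.
Proof.
elim: M => [|M IH].
  rewrite big_ord0 indicE memNset//= in_itv/= mulr0 addr0 => /andP[? ?]; lra.
rewrite big_ord_recr/= IH !indicE.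
have hM : 0 <= h * M%:R by rewrite mulr_ge0// ltW.
have hS : h * M.+1%:R = h * M%:R + h by rewrite -natr1; ring.
have mE (P : set R) : (s \in P) = `[< P s >] by [].
rewrite !mE /cell_itv /= !in_itv/= !asboolb hS; have hp : 0 < h := h0; move: (h * M%:R) hM => t t0.
have [s1|s1] := leP lo s; have [s2|s2] := ltP s (lo + t) => /=;
  have [s3|s3] := ltP s (lo + (t + h)) => /=; first [by rewrite ?addr0 ?add0r | exfalso; lra].
Qed.

Lemma indic_box (I : 'I_n -> set R) x : \1_(box I) x = \prod_i \1_(I i) (x 0 i) :> R.
Proof.
rewrite indicE; have [xI|xI] := boolP (x \in box I).
  rewrite big1// => i _; rewrite indicE mem_set//; move: xI; rewrite inE; exact.
apply/esym/eqP; rewrite prodf_seq_eq0; apply/hasP.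
have : ~ (forall i, I i (x 0 i)) by move=> h1; move/negP : xI; apply; rewrite inE.
move=> /existsNP[i nI]; exists i; first by rewrite mem_index_enum.
by rewrite indicE memNset/=.
Qed.

(** Distributivity: a product over coordinates of sums over intervals is a sum over the functions
    [j] that index the cells. *)
Lemma sum_cell x : \sum_j \1_(cell j) x =
  \1_(box (fun=> `[lo, lo + h * N%:R[%classic)) x :> R.
Proof.
rewrite indic_box; under [RHS]eq_bigr do rewrite -sum_cell_itv.
rewrite bigA_distr_bigA/=; apply: eq_bigr => j _.
exact: indic_box.
Qed.

Variables (f : 'rV[R]_n -> R) (cf : Cc f).

Let S := \sum_i nrm mu (partial i f).

(** Two points of one cell differ by an element of [cube h]. Hence the double integrals over all
    cells together are at most the integral of [G], whatever the number of cells. *)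
Let G (y : 'rV[R]_n) : \bar R := (\int[mu]_z (\1_(cube h) z * (f (y + z) - f y) ^+ 2)%:E)%E.

Let mF : measurable_fun setT (fun p : 'rV[R]_n * 'rV[R]_n =>
  (\1_(cube h) p.2 * (f (p.1 + p.2) - f p.1) ^+ 2)%:E).
Proof.
have madd : measurable_fun setT (fun p : 'rV[R]_n * 'rV[R]_n => p.1 + p.2 : 'rV[R]_n).
  apply: measurable_rV => i; under eq_fun do rewrite mxE.
  apply: measurable_funD.
    exact: measurableT_comp (measurable_rV_coord i) measurable_fst.
  exact: measurableT_comp (measurable_rV_coord i) measurable_snd.
apply/measurable_EFinP; apply: measurable_funM.
  have mc : measurable_fun setT (\1_(cube h) : 'rV[R]_n -> R).
    by apply: measurable_indic; exact: measurable_cube.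
  exact: measurableT_comp mc measurable_snd.
apply: measurable_funX; apply: measurable_funB.
  exact: measurableT_comp (Cc_measurable cf) madd.
exact: measurableT_comp (Cc_measurable cf) measurable_fst.
Qed.

Let F0 (p : 'rV[R]_n * 'rV[R]_n) : (0 <= (\1_(cube h) p.2 * (f (p.1 + p.2) - f p.1) ^+ 2)%:E)%E.
Proof. by rewrite lee_fin mulr_ge0 ?sqr_ge0. Qed.

Let G0 y : (0 <= G y)%E. Proof. by apply: integral_ge0 => z _; exact: (F0 (y, z)). Qed.

Let mG : measurable_fun setT G.
Proof. exact: (@measurable_fun_fubini_tonelli_F _ _ _ _ _ (@leb R n) _ mF F0). Qed.

(** After exchanging the integrals, each shift [z] in [cube h] costs at most [(h * S) ^+ 2] by
    [nrm_translation_le]; [(2 * h) ^+ n] is the volume of that cube. *)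
Let intG : (\int[mu]_y G y <= ((2 * h) ^+ n * (h * S) ^+ 2)%:E)%E.
Proof.
have -> : (\int[mu]_y G y = \int[mu]_z \int[mu]_y (\1_(cube h) z * (f (y + z) - f y) ^+ 2)%:E)%E.
  exact: (@fubini_tonelli _ _ _ _ _ (@leb R n) (@leb R n) _ mF F0).
have S0 : 0 <= S by apply: sumr_ge0 => i _; exact: nrm_ge0.
have sT z : sqint mu (fun y => f (y + z) - f y).
  by apply: sqintB; [apply: sqint_translation|]; exact: Cc_sqint.
apply: (@le_trans _ _ (\int[mu]_z (((h * S) ^+ 2)%:E * (\1_(cube h) z)%:E))%E); last first.
  rewrite ge0_integralZl//; last 2 first.
  - by apply/measurable_EFinP; apply: measurable_indic; exact: measurable_cube.
  - by rewrite lee_fin sqr_ge0.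
  rewrite integral_indic//; last exact: measurable_cube.
  by rewrite setIT lebesgue_cube ?(ltW h0)// -EFinM mulrC.
apply: ge0_le_integral => //.
- by move=> z _; apply: integral_ge0 => y _; exact: (F0 (y, z)).
- exact: (@measurable_fun_fubini_tonelli_G _ _ _ _ _ (@leb R n) _ mF F0).
- apply/measurable_EFinP; apply: measurable_funM => //.
  by apply: measurable_indic; exact: measurable_cube.
move=> z _.
have [zh|zh] := boolP (z \in cube h); last first.
  rewrite integral0_eq ?mule_ge0 ?lee_fin ?sqr_ge0// => y _.
  by rewrite indicE (negbTE zh) mul0r.
under eq_integral do rewrite indicE zh mul1r.
rewrite ip_EFin// indicE zh mule1 lee_fin -nrm_sqr ler_pXn2r ?nnegrE ?nrm_ge0 ?mulr_ge0 ?(ltW h0)//.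
apply: le_trans (nrm_translation_le z cf) _.
rewrite /S mulr_sumr; apply: ler_sum => i _; rewrite ler_wpM2r ?nrm_ge0//.
by move: zh; rewrite inE => /cubeP.
Qed.

Let inner_le j y :
  (\int[mu]_x (\1_(cell j) x * \1_(cell j) y * (f x - f y) ^+ 2)%:E <=
   (\1_(cell j) y)%:E * G y)%E.
Proof.
have [yj|yj] := boolP (y \in cell j); last first.
  rewrite integral0_eq ?mule_ge0 ?lee_fin// => x _.
  by rewrite [X in _ * X * _]indicE (negbTE yj) mulr0 mul0r.
rewrite [X in (_ <= X%:E * _)%E]indicE yj mul1e.
have mj : measurable_fun setT (\1_(cell j) : 'rV[R]_n -> R).
  by apply: measurable_indic; exact: measurable_cell.
have mi : measurable_fun setT (fun x => (\1_(cell j) x * \1_(cell j) y * (f x - f y) ^+ 2)%:E).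
  apply/measurable_EFinP; apply: measurable_funM; first exact: measurable_funM.
  by apply: measurable_funX; apply: measurable_funB => //; exact: Cc_measurable.
have i0 x : (0 <= (\1_(cell j) x * \1_(cell j) y * (f x - f y) ^+ 2)%:E)%E.
  by rewrite lee_fin mulr_ge0 ?sqr_ge0.
rewrite -(integral_translation y mi i0) /G; apply: ge0_le_integral => //.
- exact: measurableT_comp mi (measurable_translation y).
- exact: measurableT_comp mF (pair1_measurable y).
move=> z _; rewrite lee_fin [z + y]addrC ler_wpM2r ?sqr_ge0//.
rewrite !indicE yj mulr1; have [yz|] := boolP (y + z \in cell j) => //.
rewrite mem_set//=; apply/cubeP => i.
move: yz yj; rewrite !inE => /(_ i) + /(_ i); rewrite /cell_itv /= !in_itv/= mxE -natr1.
have := h0; rewrite mulrDr mulr1; move: (h * _) => t hp /andP[? ?] /andP[? ?].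
by rewrite ler_norml; apply/andP; split; lra.
Qed.

Hypothesis supp_f : forall x, f x != 0 -> box (fun=> `[lo, lo + h * N%:R[%classic) x.

(** The variance identity summed over the cells, with [intG] as the bound. Apart from finitely many
    averages the norm of [f] is at most of order mesh times gradient, which is the form compactness
    needs. *)
Lemma poincare_cells :
  ip mu f f <= h ^- n * (\sum_j (ip mu f \1_(cell j)) ^+ 2) + 2 ^+ n * (h * S) ^+ 2.
Proof.
pose a j := ip mu (fun x => \1_(cell j) x * f x) (fun x => \1_(cell j) x * f x).
pose b j := ip mu (fun x => \1_(cell j) x * f x) \1_(cell j).
have D j := cell_double (measurable_cell j) (lebesgue_cell j) cf.
have mj j : measurable_fun setT (\1_(cell j) : 'rV[R]_n -> R).
  by apply: measurable_indic; exact: measurable_cell.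
have sumD : ((\sum_j (2 * h ^+ n * a j - 2 * b j ^+ 2))%:E <= \int[mu]_y G y)%E.
  rewrite -sumEFin; under eq_bigr do rewrite -D.
  apply: (@le_trans _ _ (\sum_j \int[mu]_y ((\1_(cell j) y)%:E * G y))%E).
    apply: lee_sum => j _; apply: ge0_le_integral => //.
    - by move=> y _; apply: integral_ge0 => x _; rewrite lee_fin mulr_ge0 ?sqr_ge0.
    - under eq_fun do rewrite (cell_inner (measurable_cell j) (lebesgue_cell j) cf).
      have mfq : measurable_fun setT (fun x => \1_(cell j) x * f x).
        by apply: measurable_funM; [exact: mj|exact: Cc_measurable].
      apply/measurable_EFinP; apply: measurable_funD; [apply: measurable_funD|];
        by apply: measurable_funM; [exact: measurable_cst|apply: measurable_funM].
    - by apply: emeasurable_funM => //; apply/measurable_EFinP.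
  rewrite -ge0_integral_sum//; last 2 first.
  - by move=> j; apply: emeasurable_funM => //; apply/measurable_EFinP.
  - by move=> j y _; rewrite mule_ge0 ?lee_fin.
  apply: ge0_le_integral => //.
  - by move=> y _; apply: sume_ge0 => j _; rewrite mule_ge0 ?lee_fin.
  - by apply: emeasurable_sum => j; apply: emeasurable_funM => //; apply/measurable_EFinP.
  move=> y _; rewrite -ge0_sume_distrl; last by move=> j _; rewrite lee_fin.
  rewrite sumEFin sum_cell indicE; case: (y \in _); rewrite /= ?mul1e// mul0e.
  exact: G0.
have suma : \sum_j a j = ip mu f f.
  apply: EFin_inj; rewrite -sumEFin -(ip_EFin (Cc_sqint cf)).
  have sj j : sqint mu (fun x => \1_(cell j) x * f x).
    apply: (sqint_dom _ _ (Cc_sqint cf)); first exact: measurable_funM (mj j) (Cc_measurable cf).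
    by move=> x; rewrite indicE; case: (x \in _); rewrite /= ?mul1r// mul0r expr0n sqr_ge0.
  under eq_bigr do rewrite -(ip_EFin (sj _)).
  rewrite -ge0_integral_sum//; last 2 first.
  - by move=> j; apply/measurable_EFinP; apply: measurable_funX; case: (sj j).
  - by move=> j x _; rewrite lee_fin sqr_ge0.
  apply: eq_integral => x _; rewrite sumEFin; congr EFin.
  have [fx|fx] := eqVneq (f x) 0.
    by rewrite big1 ?fx ?expr0n// => j _; rewrite mulr0 expr0n.
  transitivity (\sum_j \1_(cell j) x * f x ^+ 2).
    apply: eq_bigr => j _; rewrite indicE; case: (_ \in _); rewrite /= ?mul1r//.
    by rewrite !mul0r expr0n.
  by rewrite -mulr_suml sum_cell indicE mem_set ?mul1r//; exact: supp_f.
have sumb j : b j = ip mu f \1_(cell j).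
  by rewrite /b /ip; apply: eq_Rintegral => x _; rewrite !indicE; case: (_ \in _); rewrite /= ?mul1r// mul0r !mulr0.
have := le_trans sumD intG; rewrite lee_fin sumrB -!mulr_sumr suma.
under eq_bigr do rewrite sumb.
have hn : 0 < h ^+ n by rewrite exprn_gt0.
move: (\sum_j _) => B; rewrite exprMn -/S => H.
rewrite -(ler_pM2l (_ : 0 < 2 * h ^+ n)); last by rewrite mulr_gt0.
rewrite mulrDr; have -> : 2 * h ^+ n * (h ^- n * B) = 2 * B by field; rewrite gt_eqF.
have : 0 <= 2 ^+ n * h ^+ n * (h * S) ^+ 2 by rewrite mulr_ge0 ?sqr_ge0 ?mulr_ge0 ?exprn_ge0 ?(ltW h0).
lra.
Qed.

End cells.

(** * Rellich's compactness theorem *)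

Section rellich.
Variables (R : realType) (n : nat).
Local Notation mu := (lebesgue R n).
Implicit Types (f g : 'rV[R]_n -> R).

(** A bounded real sequence clusters at some [p] along [U]; since an ultrafilter contains each set
    or its complement, the sequence is in fact close to [p] on a set of [U]. *)
Lemma ultra_near (U : set_system nat) (s : nat -> R) (M t : R) :
  UltraFilter U -> (forall k, `|s k| <= M) -> 0 < t ->
  exists p, U [set k | `|s k - p| < t].
Proof.
move=> UU sM t0.
have [p [_ pc]] : `[- M, M]%classic `&` cluster (s @ U) !=set0.
  apply: segment_compact; apply: (@filterE _ U _ (s @^-1` `[- M, M])) => k /=.
  rewrite in_itv/= -ler_norml; exact: sM.
exists p; have [//|UV] := in_ultra_setVsetC [set k | `|s k - p| < t] UU.
have [||_ [[k /= nk <-] sk]] := pc (s @` (~` [set k | `|s k - p| < t])) (ball p t).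
- by apply: (@filterS _ U _ _ _ _ UV) => k nk; exists k.
- exact: (@nbhsx_ballx R R p t t0).
- by exfalso; apply: nk; rewrite distrC.
Qed.

(** A single ultrafilter replaces diagonal extraction: along it the cell averages of every mesh
    settle at once, and [poincare_cells] turns this into closeness in L2. *)
Lemma rellich (u : nat -> 'rV[R]_n -> R) (B K : R) : 0 <= B ->
  (forall k, Cc (u k)) -> (forall k, suppc B (u k)) ->
  (forall k, nrm mu (u k) <= K) -> (forall k i, nrm mu (partial i (u k)) <= K) ->
  exists phi : nat -> nat, (forall m, (m <= phi m)%N) /\
    forall m, nrm mu (fun x => u (phi m.+1) x - u (phi m) x) <= 2^-1 ^+ m.
Proof.
move=> B0 cu su uK duK.
have K0 : 0 <= K by apply: le_trans (uK 0%N); exact: nrm_ge0.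
have [U [UU FU]] := @ultraFilterLemma nat \oo _.
have claim (eta : R) : 0 < eta ->
    exists V, U V /\ forall k l, V k -> V l -> nrm mu (fun x => u k x - u l x) <= eta.
  move=> eta0.
  (* Each derivative of a difference has norm at most [2 K], whence [S0]. [N] makes the gradient
     term of [poincare_cells] at most [eta^2 / 2]. The grid covers the box from [- (B + 1)] to
     [B + 1], which although half-open contains the closed cube of size [B]. *)
  pose S0 : R := n%:R * (2 * K).
  have S00 : 0 <= S0 by apply: mulr_ge0 => //; apply: mulr_ge0.
  pose c : R := 2 * (B + 1) * S0.
  pose N := (Num.truncn (2 ^+ n.+1 * c ^+ 2 / eta ^+ 2)).+1.
  have N0 : 0 < N%:R :> R by [].
  pose h : R := 2 * (B + 1) / N%:R.
  have h0 : 0 < h by rewrite divr_gt0// mulr_gt0//; lra.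
  have hN : h * N%:R = 2 * (B + 1) by rewrite divfK// gt_eqF.
  pose J := #|{ffun 'I_n -> 'I_N}|.
  (* Averages within [t] of common values differ by at most [2 t], so the [J] squares sum to at most
     [4 J t2], which is below [h^n eta^2 / 2]. *)
  pose t2 : R := eta ^+ 2 * h ^+ n / (8 * J.+1%:R).
  have t20 : 0 < t2 by rewrite divr_gt0// mulr_gt0// exprn_gt0.
  pose t := Num.sqrt t2.
  have t0 : 0 < t by rewrite sqrtr_gt0.
  pose q (j : {ffun 'I_n -> 'I_N}) : 'rV[R]_n -> R := \1_(cell (- (B + 1)) h j).
  have sq j : sqint mu (q j).
    apply: sqint_indic; [exact: measurable_cell|exact: lebesgue_cell].
  have bd k j : `|ip mu (u k) (q j)| <= K * nrm mu (q j).
    apply: le_trans (ip_normrM (Cc_sqint (cu k)) (sq j)) _.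
    by rewrite ler_wpM2r ?nrm_ge0.
  have P j := cid (ultra_near UU (bd ^~ j) t0).
  exists [set k | forall j, `|ip mu (u k) (q j) - projT1 (P j)| < t]; split.
    by apply: filter_forall => j; case: (P j).
  move=> k l Vk Vl.
  have cuk := CcB (cu k) (cu l).
  have supp x : u k x - u l x != 0 ->
      box (fun=> `[- (B + 1), - (B + 1) + h * N%:R[%classic) x.
    move=> ukl; have /cubeP xB : @cube R n B x.
      have [ukx|] := eqVneq (u k x) 0; last exact: su.
      by apply: (su l); move: ukl; rewrite ukx sub0r oppr_eq0.
    move=> i; rewrite hN /= in_itv/=; have := xB i; rewrite ler_norml => /andP[? ?].
    by apply/andP; split; lra.
  have H := poincare_cells h0 cuk supp.
  rewrite -(@ler_pXn2r _ 2)// ?nnegrE ?nrm_ge0 ?(ltW eta0)// nrm_sqr.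
  apply: le_trans H _.
  have -> : eta ^+ 2 = eta ^+ 2 / 2 + eta ^+ 2 / 2 by field.
  apply: lerD.
    apply: (@le_trans _ _ (h ^- n * \sum_(j : {ffun 'I_n -> 'I_N}) (4 * t2))).
      rewrite ler_pM2l ?invr_gt0 ?exprn_gt0//; apply: ler_sum => j _.
      rewrite -/(q j) (ipBl (Cc_sqint (cu k)) (Cc_sqint (cu l)) (sq j)).
      have -> : 4 * t2 = (2 * t) ^+ 2 by rewrite exprMn sqr_sqrtr ?(ltW t20)//; ring.
      rewrite -real_normK ?num_real// ler_pXn2r// ?nnegrE ?mulr_ge0 ?(ltW t0)//.
      have := Vk j; have := Vl j; move: (projT1 _) => p; rewrite !ltr_norml ler_norml.
      by move=> /andP[? ?] /andP[? ?]; apply/andP; split; lra.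
    rewrite sumr_const -/J /t2 -mulr_natl.
    have hn : h ^+ n != 0 by rewrite gt_eqF// exprn_gt0.
    rewrite [leLHS](_ : _ = eta ^+ 2 / 2 * (J%:R / J.+1%:R)).
      rewrite ler_piMr ?divr_ge0 ?sqr_ge0// ler_pdivrMr// mul1r ler_nat.
      exact: leqnSn.
    have : J.+1%:R != 0 :> R by rewrite pnatr_eq0.
    by move: (J.+1%:R) (h ^+ n) hn => w w' w0 w'0; field; rewrite ?w0 ?w'0.
  apply: (@le_trans _ _ (2 ^+ n * (h * S0) ^+ 2)).
    have S1 : 0 <= \sum_i nrm mu (partial i (fun x => u k x - u l x)).
      by apply: sumr_ge0 => i _; exact: nrm_ge0.
    have S2 : \sum_i nrm mu (partial i (fun x => u k x - u l x)) <= S0.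
      rewrite /S0 mulr_natl -[X in _ *+ X]card_ord -sumr_const.
      apply: ler_sum => i _; rewrite (partialB i (cu k).1 (cu l).1).
      have s1 := Cc_sqint (Cc_partial i (cu k)); have s2 := Cc_sqint (Cc_partial i (cu l)).
      apply: le_trans (nrmB_le s1 s2) _.
      by rewrite mulr_natl mulr2n lerD.
    rewrite ler_pM2l ?exprn_gt0// ler_pXn2r// ?nnegrE.
    - by rewrite ler_pM2l.
    - exact: mulr_ge0 (ltW h0) S1.
    - exact: mulr_ge0 (ltW h0) S00.
  have -> : 2 ^+ n * (h * S0) ^+ 2 = 2 ^+ n.+1 * c ^+ 2 / N%:R ^+ 2 / 2.
    have : N%:R != 0 :> R by rewrite gt_eqF.
    by rewrite /h /c [2 ^+ n.+1]exprS; move: (2 ^+ n) N%:R => a b b0; field.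
  rewrite ler_pM2r ?invr_gt0// ler_pdivrMr ?exprn_gt0//.
  have := truncnS_gt (2 ^+ n.+1 * c ^+ 2 / eta ^+ 2); rewrite -/N ltr_pdivrMr ?exprn_gt0// => H.
  apply: ltW; apply: lt_le_trans H _; rewrite mulrC ler_pM2l ?exprn_gt0//.
  by rewrite expr2 ler_peMr ?ler1n// ltW.
have eta0 m : 0 < (2^-1 : R) ^+ m by rewrite exprn_gt0// invr_gt0.
pose V m := projT1 (cid (claim _ (eta0 m))).
have UV m : U (V m) by have [h _] := projT2 (cid (claim _ (eta0 m))); exact: h.
have VP m k l : V m k -> V m l -> nrm mu (fun x => u k x - u l x) <= 2^-1 ^+ m.
  by have [_ h] := projT2 (cid (claim _ (eta0 m))); exact: h.
(* The index for [m] is taken in all of [V 0], ..., [V m], so that the one for [m + 1] also lies in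
   [V m]. *)
have W m : exists k, (m <= k)%N /\ forall i : 'I_m.+1, V i k.
  have : U [set k | (m <= k)%N /\ forall i : 'I_m.+1, V i k].
    apply: filterI; first by apply: FU; exists m.
    by apply: filter_forall => i; exact: UV.
  by move=> /filter_ex[k [? ?]]; exists k.
exists (fun m => projT1 (cid (W m))); split=> m; first by case: (cid (W m)) => k [].
have [_ Vk] := projT2 (cid (W m)); have [_ Vl] := projT2 (cid (W m.+1)).
apply: VP; last exact: (Vk ord_max).
exact: (Vl (widen_ord (leqnSn _) ord_max)).
Qed.

End rellich.

Lemma Rintegral_sum d (T : measurableType d) (R : realType)
    (mu : {measure set T -> \bar R}) (I : finType) (F : I -> T -> R) :
  (forall i, mu.-integrable setT (EFin \o F i)) ->
  \int[mu]_x (\sum_i F i x) = \sum_i \int[mu]_x F i x.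
Proof.
move=> IF.
suff : forall s : seq I,
  mu.-integrable setT (EFin \o (fun x => \sum_(i <- s) F i x)) /\
  \int[mu]_x (\sum_(i <- s) F i x) = \sum_(i <- s) \int[mu]_x F i x.
  by move=> /(_ (index_enum _))[].
elim=> [|i s [IH1 IH2]].
  split.
    under eq_fun do rewrite big_nil; exact: integrable0.
  rewrite big_nil; under eq_Rintegral do rewrite big_nil.
  by rewrite /Rintegral integral0.
split.
  have := @integrableD _ _ _ mu setT measurableT _ _ (IF i) IH1.
  by apply: eq_integrable => // x _; rewrite /= big_cons EFinD.
rewrite big_cons -IH2 -RintegralD//.
by apply: eq_Rintegral => x _; rewrite big_cons.
Qed.

(** * Dirichlet eigenvalues and Rayleigh quotients *)

Section eigenvalues.
Variables (R : realType) (n : nat).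
Local Notation mu := (lebesgue R n).
Implicit Types (A : set 'rV[R]_n) (f g u v : 'rV[R]_n -> R).

Definition energy f : R := \sum_i ip mu (partial i f) (partial i f).

(** Defined on arbitrary fields, since the weak gradient of an eigenfunction is not given by
    [partial]. *)
Definition energy2 (G H : 'I_n -> 'rV[R]_n -> R) : R := \sum_i ip mu (G i) (H i).

Lemma energy_ge0 f : 0 <= energy f.
Proof. by apply: sumr_ge0 => i _; exact: ip_ge0. Qed.

Lemma L2_cvgP (f : nat -> 'rV[R]_n -> R) u :
  (forall k, sqint mu (f k)) -> sqint mu u ->
  L2_cvg f u <-> nrm mu (fun x => f k x - u x) @[k --> \oo] --> 0.
Proof.
move=> sf su; rewrite /L2_cvg.
have E k : ('N[mu]_2%:E[EFin \o (f k \- u)%R] = (nrm mu (fun x => f k x - u x))%:E)%E.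
  by apply: Lnorm2_nrm; exact: sqintB.
under eq_fun do rewrite E; split => [c|c].
  exact: (fine_cvg c).
by apply: cvg_EFin => //; exact: nearW.
Qed.

Lemma test_functionD A f g : test_function A f -> test_function A g ->
  test_function A (fun x => f x + g x).
Proof.
move=> [sf [K [cK KA Kf]]] [sg [L [cL LA Lg]]]; split; first exact: (smoothD (sf : smooth f) sg).
exists (K `|` L); split; first exact: compactU.
  by move=> x [/KA|/LA].
by move=> x /not_orP[nK nL]; rewrite Kf// Lg// addr0.
Qed.

Lemma test_functionZ A (a : R) f : test_function A f -> test_function A (fun x => a * f x).
Proof.
move=> [sf [K [cK KA Kf]]]; split; first exact: (smoothZ a (sf : smooth f)).
by exists K; split => // x nK; rewrite Kf// mulr0.
Qed.

Lemma energyZ (a : R) f : Cc f -> energy (fun x => a * f x) = a ^+ 2 * energy f.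
Proof.
move=> cf; rewrite /energy mulr_sumr; apply: eq_bigr => i _.
have sp := Cc_sqint (Cc_partial i cf).
by rewrite (partialZ i a cf.1) ipZl ?ipZr//; [rewrite mulrA expr2|exact: sqintZ].
Qed.

Lemma energyD f g : Cc f -> Cc g ->
  energy (fun x => f x + g x) = energy f +
    2 * energy2 (fun i => partial i f) (fun i => partial i g) + energy g.
Proof.
move=> cf cg; rewrite /energy /energy2 mulr_sumr -!big_split/=; apply: eq_bigr => i _.
rewrite (partialD i cf.1 cg.1); apply: ipD_sqr; apply: Cc_sqint; exact: Cc_partial.
Qed.

Lemma energyB f g : Cc f -> Cc g ->
  energy (fun x => f x - g x) = energy f -
    2 * energy2 (fun i => partial i f) (fun i => partial i g) + energy g.
Proof.
move=> cf cg; rewrite /energy /energy2 mulr_sumr -sumrB -big_split/=; apply: eq_bigr => i _.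
rewrite (partialB i cf.1 cg.1); apply: ipB_sqr; apply: Cc_sqint; exact: Cc_partial.
Qed.

Lemma energy_parallelogram f g : Cc f -> Cc g ->
  energy (fun x => f x + g x) + energy (fun x => f x - g x) = 2 * energy f + 2 * energy g.
Proof.
move=> cf cg; rewrite (energyD cf cg) (energyB cf cg).
by move: (energy f) (energy g) (energy2 _ _) => a b c; ring.
Qed.

Lemma ip_parallelogram f g : Cc f -> Cc g ->
  ip mu (fun x => f x + g x) (fun x => f x + g x) +
  ip mu (fun x => f x - g x) (fun x => f x - g x) = 2 * ip mu f f + 2 * ip mu g g.
Proof.
move=> cf cg; have sf := Cc_sqint cf; have sg := Cc_sqint cg.
rewrite (ipD_sqr sf sg) (ipB_sqr sf sg).
by move: (ip mu f f) (ip mu g g) (ip mu f g) => a b c; ring.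
Qed.

Lemma Rintegral_energy2 (G H : 'I_n -> 'rV[R]_n -> R) :
  (forall i, sqint mu (G i)) -> (forall i, sqint mu (H i)) ->
  \int[mu]_x (\sum_i G i x * H i x) = energy2 G H.
Proof. by move=> sG sH; rewrite Rintegral_sum// => i; exact: sqint_mul. Qed.

Lemma sqint_complete_scaled (g : nat -> 'rV[R]_n -> R) (C : R) : 0 < C ->
  (forall k, sqint mu (g k)) ->
  (forall k, nrm mu (fun x => g k.+1 x - g k x) <= C * 2^-1 ^+ k) ->
  exists u, sqint mu u /\ nrm mu (fun x => g k x - u x) @[k --> \oo] --> 0.
Proof.
move=> C0 sg gC.
have [|k|u [su cu]] := @sqint_complete _ _ _ mu (fun k x => C^-1 * g k x).
- by move=> k; exact: sqintZ.
- under eq_fun do rewrite -mulrBr.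
  rewrite nrmZ; last exact: sqintB.
  by rewrite gtr0_norm ?invr_gt0// mulrC ler_pdivrMr// mulrC.
exists (fun x => C * u x); split; first exact: sqintZ.
have E k : nrm mu (fun x => g k x - C * u x) = C * nrm mu (fun x => C^-1 * g k x - u x).
  rewrite -{2}(gtr0_norm C0) -nrmZ; last by apply: sqintB => //; exact: sqintZ.
  by congr nrm; apply/funext => x; rewrite mulrBr mulVKf// gt_eqF.
under eq_fun do rewrite E.
by rewrite -(mulr0 C); apply: cvgM => //; exact: cvg_cst.
Qed.

Lemma energy2_cvg (G H : nat -> 'I_n -> 'rV[R]_n -> R) (G0 H0 : 'I_n -> 'rV[R]_n -> R) :
  (forall k i, sqint mu (G k i)) -> (forall k i, sqint mu (H k i)) ->
  (forall i, sqint mu (G0 i)) -> (forall i, sqint mu (H0 i)) ->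
  (forall i, nrm mu (fun x => G k i x - G0 i x) @[k --> \oo] --> 0) ->
  (forall i, nrm mu (fun x => H k i x - H0 i x) @[k --> \oo] --> 0) ->
  energy2 (G k) (H k) @[k --> \oo] --> energy2 G0 H0.
Proof.
move=> sG sH sG0 sH0 cG cH; rewrite /energy2.
elim: (index_enum _) => [|i s IH].
  by under eq_fun do rewrite big_nil; rewrite big_nil; exact: cvg_cst.
under eq_fun do rewrite big_cons; rewrite big_cons.
by apply: cvgD => //; exact: ip_cvg.
Qed.

Lemma nrm_cvg_cst u : nrm mu (fun x => u x - u x) @[k --> \oo] --> 0.
Proof.
rewrite (_ : nrm _ _ = 0); first exact: cvg_cst.
under eq_fun do rewrite subrr.
by apply: ae0_nrm; [exact: nearW|exact: measurable_cst].
Qed.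

(** The weak equation accepts only test functions, so it is tested with the approximants [f k]. In
    the limit the energy of the weak gradient equals [l] times the square norm of [u], and the
    assumed inequality for [f k] passes to the same limit. *)
Lemma eigenvalue_ge A (c l : R) : dirichlet_eigenvalue A l ->
  (forall f, test_function A f -> c * ip mu f f <= energy f) -> c <= l.
Proof.
move=> [u [u0 [G [[/L2_sqint su LG [f [tf cf cG]]] EL]]]] H.
have sG i : sqint mu (G i) by apply/L2_sqint; exact: LG.
have Cf k : Cc (f k) by exact: test_function_Cc (tf k).
have sf k := Cc_sqint (Cf k).
have sp k i := Cc_sqint (Cc_partial i (Cf k)).
have {}cf : nrm mu (fun x => f k x - u x) @[k --> \oo] --> 0 by apply/L2_cvgP.
have {}cG i : nrm mu (fun x => partial i (f k) x - G i x) @[k --> \oo] --> 0.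
  by have /L2_cvgP := cG i; apply.
have c1 : energy (f k) @[k --> \oo] --> energy2 G G.
  by apply: (@energy2_cvg (fun k i => partial i (f k)) (fun k i => partial i (f k))).
have c2 : energy2 G (fun i => partial i (f k)) @[k --> \oo] --> energy2 G G.
  apply: (@energy2_cvg (fun=> G) (fun k i => partial i (f k))) => // i; exact: nrm_cvg_cst.
have c3 : ip mu u (f k) @[k --> \oo] --> ip mu u u.
  by apply: (ip_cvg (f := fun=> u)) => //; exact: nrm_cvg_cst.
have c4 : ip mu (f k) (f k) @[k --> \oo] --> ip mu u u by exact: ip_cvg.
have E k : energy2 G (fun i => partial i (f k)) = l * ip mu u (f k).
  by rewrite -(EL _ (tf k)) Rintegral_energy2.
have GG : energy2 G G = l * ip mu u u.
  have c5 : l * ip mu u (f k) @[k --> \oo] --> l * ip mu u u.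
    by apply: cvgM => //; exact: cvg_cst.
  move: c2; under eq_fun do rewrite E; move=> c2.
  by rewrite -(cvg_lim _ c2)// (cvg_lim _ c5).
have uu0 : 0 < ip mu u u.
  rewrite lt_neqAle ip_ge0 andbT eq_sym; apply/eqP => uu.
  by apply: u0; apply: nrm0_ae => //; rewrite /nrm uu sqrtr0.
suff : c * ip mu u u <= l * ip mu u u by rewrite ler_pM2r.
rewrite -GG -subr_ge0.
have c6 : energy (f k) - c * ip mu (f k) (f k) @[k --> \oo] --> energy2 G G - c * ip mu u u.
  by apply: cvgB => //; apply: cvgM => //; exact: cvg_cst.
rewrite -(cvg_lim _ c6)//; apply: limr_ge; first by apply/cvg_ex; eexists; exact: c6.
by apply: nearW => k; rewrite subr_ge0; exact: H.
Qed.

Lemma lambda1_ge A (c : R) :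
  (forall f, test_function A f -> c * ip mu f f <= energy f) -> (c%:E <= lambda1 A)%E.
Proof.
move=> H; apply: le_ereal_inf_tmp => _ [l /= Al <-]; rewrite lee_fin.
exact: eigenvalue_ge Al H.
Qed.

Section existence.
Variables (A : set 'rV[R]_n) (B : R).
Hypotheses (B0 : 0 <= B) (AB : A `<=` cube B).

Let suppA f : test_function A f -> suppc B f.
Proof.
move=> [_ [K [_ KA Kf]]] x fx; apply: AB; apply: KA.
by apply: contrapT => nK; move: fx; rewrite Kf ?eqxx.
Qed.

(* The infimum [m] of the Rayleigh quotient is attained: a minimizing sequence,
   made Cauchy in L2 by Rellich's theorem, is Cauchy in H1 by the parallelogram law. *)
Lemma rayleigh_min : (exists f, test_function A f /\ 0 < ip mu f f) ->
  exists m, dirichlet_eigenvalue A m /\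
    forall f, test_function A f -> m * ip mu f f <= energy f.
Proof.
move=> [f0 [tf0 f00]].
pose E : set R := [set energy f / ip mu f f | f in [set f | test_function A f /\ 0 < ip mu f f]].
have E0 : E !=set0 by exists (energy f0 / ip mu f0 f0), f0.
have lE : lbound E 0.
  by move=> _ [f [_ f1] <-]; rewrite divr_ge0 ?energy_ge0// ltW.
have hE : has_inf E by split => //; exists 0.
pose m := inf E.
have m0 : 0 <= m by apply: lb_le_inf.
have mE f : test_function A f -> m * ip mu f f <= energy f.
  move=> tf; have [f1|f1] := leP (ip mu f f) 0.
    have -> : ip mu f f = 0 by apply/eqP; rewrite eq_le f1 ip_ge0.
    by rewrite mulr0 energy_ge0.
  by rewrite -ler_pdivlMr//; apply: ge_inf; [exists 0|exists f].
exists m; split => //.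
have d0 k : 0 < (2^-1 ^+ k) ^+ 2 :> R by rewrite !exprn_gt0// invr_gt0.
(* The error is squared because it is measured in energy; after a square root it becomes the
   summable rate [2^-k]. *)
have minim k : exists g, [/\ test_function A g, ip mu g g = 1 & energy g <= m + (2^-1 ^+ k) ^+ 2].
  have [_ [f [tf f1] <-] fm] := inf_adherent (d0 k) hE.
  have cf := test_function_Cc tf; have sf := Cc_sqint cf.
  pose a := (Num.sqrt (ip mu f f))^-1.
  have a2 : a ^+ 2 = (ip mu f f)^-1 by rewrite exprVn sqr_sqrtr// ltW.
  exists (fun x => a * f x); split; first exact: test_functionZ.
    rewrite (ipZl a sf (sqintZ a sf)) (ipZr a sf sf) mulrA -expr2 a2 mulVf//.
    by rewrite gt_eqF.
  by rewrite (energyZ a cf) a2 mulrC ltW.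
pose g k := projT1 (cid (minim k)).
have tg k : test_function A (g k) by have [] := projT2 (cid (minim k)).
have g1 k : ip mu (g k) (g k) = 1 by have [] := projT2 (cid (minim k)).
have gm k : energy (g k) <= m + (2^-1 ^+ k) ^+ 2 by have [] := projT2 (cid (minim k)).
have cg k := test_function_Cc (tg k).
have d1 k : (2^-1 ^+ k) ^+ 2 <= 1 :> R.
  by rewrite -exprM exprn_ile1 ?invr_ge0 ?invf_le1 ?ler1n.
have nb f i (C : R) : energy f <= C ^+ 2 -> 0 <= C -> nrm mu (partial i f) <= C.
  move=> fC C0; rewrite -(@ler_pXn2r _ 2)// ?nnegrE ?nrm_ge0//.
  apply: le_trans fC; rewrite nrm_sqr /energy (bigD1 i)//= lerDl.
  by apply: sumr_ge0 => j _; exact: ip_ge0.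
have gK k : nrm mu (g k) <= m + 2 by rewrite /nrm g1 sqrtr1; lra.
have dgK k i : nrm mu (partial i (g k)) <= m + 2.
  apply: nb; last by lra.
  apply: le_trans (gm k) _; apply: le_trans (lerD (lexx _) (d1 k)) _.
  by have := sqr_ge0 m; rewrite !expr2; nra.
have [phi [phik phid]] := @rellich R n g B (m + 2) B0 cg (fun k => suppA (tg k)) gK dgK.
pose u k := g (phi k).
have tu k : test_function A (u k) by exact: tg.
have cu k : Cc (u k) by exact: cg.
have u1 k : ip mu (u k) (u k) = 1 by exact: g1.
have pow_le (k l : nat) : (k <= l)%N -> (2^-1 ^+ l) ^+ 2 <= (2^-1 ^+ k) ^+ 2 :> R.
  move=> kl; rewrite -!exprM ler_wiXn2l ?invr_ge0 ?invf_le1 ?ler1n//.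
  by rewrite leq_mul2r kl.
have um k : energy (u k) <= m + (2^-1 ^+ k) ^+ 2.
  by apply: le_trans (gm (phi k)) _; rewrite lerD2l; exact: pow_le.
(* Parallelogram law for consecutive terms [a], [b]: the energy of [a - b] is twice the two
   energies, minus that of [a + b], and the latter is at least [m |a + b|^2 = m (4 - |a - b|^2)].
   What remains is [m |a - b|^2] plus errors of at most [4 (2^-k)^2], hence [4 + m]. *)
have ud k : energy (fun x => u k.+1 x - u k x) <= (Num.sqrt (4 + m) * 2^-1 ^+ k) ^+ 2.
  have := energy_parallelogram (cu k.+1) (cu k).
  have := ip_parallelogram (cu k.+1) (cu k).
  rewrite !u1.
  have := mE _ (test_functionD (tu k.+1) (tu k)).
  have := um k.+1; have := um k; have := pow_le k k.+1 (leqnSn k).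
  have : ip mu (fun x => u k.+1 x - u k x) (fun x => u k.+1 x - u k x) <= (2^-1 ^+ k) ^+ 2.
    by rewrite -nrm_sqr ler_pXn2r ?nnegrE ?nrm_ge0 ?exprn_ge0 ?invr_ge0//; exact: phid.
  rewrite exprMn sqr_sqrtr; last by lra.
  move: (ip mu _ _) (ip mu _ _) (energy _) (energy _) (energy _) (energy _) => b a c d e f.
  move: (2^-1 ^+ k) (2^-1 ^+ k.+1) => p q h1 h2 h3 h4 h5 h6 h7.
  have h8 : m * b = m * (2 * 1 + 2 * 1) - m * a by rewrite -mulrBr -h6 addrK.
  have h9 : m * a <= m * p ^+ 2 by exact: ler_wpM2l.
  by rewrite mulrDl; lra.
have C0 : 0 < Num.sqrt (4 + m) by rewrite sqrtr_gt0; lra.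
have su k := Cc_sqint (cu k).
have sp i k := Cc_sqint (Cc_partial i (cu k)).
have [v [sv cv]] := sqint_complete su phid.
have lim_p i : exists G, sqint mu G /\ nrm mu (fun x => partial i (u k) x - G x) @[k --> \oo] --> 0.
  apply: (@sqint_complete_scaled (fun k => partial i (u k)) _ C0 (sp i)) => k.
  have := nb _ i _ (ud k).
  rewrite (partialB i (cu k.+1).1 (cu k).1); apply.
  by rewrite mulr_ge0 ?(ltW C0)// exprn_ge0// invr_ge0.
pose G i := projT1 (cid (lim_p i)).
have sG i : sqint mu (G i) by have [] := projT2 (cid (lim_p i)).
have cG i : nrm mu (fun x => partial i (u k) x - G i x) @[k --> \oo] --> 0.
  by have [] := projT2 (cid (lim_p i)).
have vv : ip mu v v = 1.
  have c1 : ip mu (u k) (u k) @[k --> \oo] --> ip mu v v by exact: ip_cvg.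
  move: c1; under eq_fun do rewrite u1; move=> c1.
  by rewrite -(cvg_lim _ c1)// lim_cst.
exists v; split.
  by move=> /(@ae0_nrm _ _ _ mu); case: sv => mv _ /(_ mv) v0; move: vv; rewrite -nrm_sqr v0; lra.
exists G; split.
  split; [exact/L2_sqint|by move=> i; exact/L2_sqint|].
  exists u; split => //; first exact/L2_cvgP.
  by move=> i; exact/L2_cvgP.
move=> w tw; have cw := test_function_Cc tw.
have sw := Cc_sqint cw; have spw i := Cc_sqint (Cc_partial i cw).
rewrite (Rintegral_energy2 sG spw) -/(ip mu v w).
pose P k := energy2 (fun i => partial i (u k)) (fun i => partial i w).
have cP : P k @[k --> \oo] --> energy2 G (fun i => partial i w).
  by apply: (@energy2_cvg (fun k i => partial i (u k)) (fun=> (fun i => partial i w))) => // i; exact: nrm_cvg_cst.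
have cQ : ip mu (u k) w @[k --> \oo] --> ip mu v w.
  by apply: (ip_cvg (g := fun=> w)) => //; exact: nrm_cvg_cst.
(* First variation: [u k + t w] is a competitor for the infimum [m]. In the limit a quadratic
   [2 t D + t^2 c] is nonnegative for all [t], so [D = 0], which is the weak equation. *)
have ineq t k : 0 <= (2^-1 ^+ k) ^+ 2 + 2 * t * (P k - m * ip mu (u k) w) +
    t ^+ 2 * (energy w - m * ip mu w w).
  have := mE _ (test_functionD (tu k) (test_functionZ t tw)).
  rewrite (energyD (cu k) (CcZ t cw)) (energyZ t cw) (ipD_sqr (su k) (sqintZ t sw)).
  rewrite (ipZr t (su k) sw) (ipZl t sw (sqintZ t sw)) (ipZr t sw sw) u1.
  have -> : energy2 (fun i => partial i (u k)) (fun i => partial i (fun x => t * w x)) = t * P k.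
    rewrite /P /energy2 mulr_sumr; apply: eq_bigr => i _.
    by rewrite (partialZ i t cw.1) (ipZr t (sp i k) (spw i)).
  have := um k; move: (energy _) (energy w) (P k) (ip mu (u k) w) (ip mu w w) (2^-1 ^+ k).
  by move=> a b p q r s; lra.
pose D := energy2 G (fun i => partial i w) - m * ip mu v w.
pose c := energy w - m * ip mu w w.
have lim_ineq t : 0 <= 2 * t * D + t ^+ 2 * c.
  have cc : (2^-1 ^+ k) ^+ 2 + 2 * t * (P k - m * ip mu (u k) w) + t ^+ 2 * c
      @[k --> \oo] --> 0 * 0 + 2 * t * D + t ^+ 2 * c.
    apply: cvgD; last exact: cvg_cst.
    apply: cvgD; last first.
      apply: cvgM; first exact: cvg_cst.
      by apply: cvgB => //; apply: cvgM => //; exact: cvg_cst.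
    under eq_fun do rewrite expr2.
    have cp : 2^-1 ^+ k @[k --> \oo] --> (0 : R).
      have := @cvg_geometric R 1 2^-1; rewrite /geometric/=.
      under eq_fun do rewrite mul1r; apply.
      by rewrite ger0_norm ?invr_ge0// invf_lt1 ?ltr1n.
    exact: cvgM.
  have := cvg_lim _ cc; rewrite mul0r add0r => <- //.
  apply: limr_ge; first by apply/cvg_ex; eexists; exact: cc.
  by apply: nearW => k; exact: ineq.
suff : D = 0 by rewrite /D => /eqP; rewrite subr_eq0 => /eqP.
move: lim_ineq; move: D c => D c H.
apply/eqP/negP => /negP D0.
(* This [t] has sign opposite to [D] and is small enough for the linear term to win, also when [c]
   is zero or negative. *)
have := H (- D / (`|c| + 1)); have c0 : 0 < `|c| + 1 by rewrite ltr_wpDl.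
have -> : 2 * (- D / (`|c| + 1)) * D + (- D / (`|c| + 1)) ^+ 2 * c =
    D ^+ 2 / (`|c| + 1) ^+ 2 * (c - 2 * (`|c| + 1)) by field; rewrite gt_eqF.
have D2 : 0 < D ^+ 2 / (`|c| + 1) ^+ 2.
  by apply: divr_gt0; [rewrite exprn_even_gt0//=; exact/negP|exact: exprn_gt0].
rewrite pmulr_rge0//; have := ler_norm c; have := normr_ge0 c; lra.
Qed.

(** Rests on [rayleigh_min]: the infimum of the Rayleigh quotients is itself an eigenvalue, hence an
    element of the set defining [lambda1]. *)
Lemma lambda1_le f : test_function A f -> 0 < ip mu f f ->
  (lambda1 A <= (energy f / ip mu f f)%:E)%E.
Proof.
move=> tf f0; have [m [Am mP]] := rayleigh_min (ex_intro _ f (conj tf f0)).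
apply: (@le_trans _ _ m%:E); last by rewrite lee_fin ler_pdivlMr//; exact: mP.
by apply: ereal_inf_lbound; exists m.
Qed.

End existence.

End eigenvalues.

(** * Comparison with an exponential barrier: the maximum point is far from supporting
    hyperplanes *)

Section comparison.
Variables (R : realType) (n : nat).
Local Notation mu := (lebesgue R n).
Implicit Types (f g : 'rV[R]_n -> R) (x y z e : 'rV[R]_n).

(** The Poincare inequality in one coordinate bounds all Rayleigh quotients below; [i] witnesses
    that the dimension is positive. *)
Lemma eigenvalue_gt0 (A : set 'rV[R]_n) (B l : R) (i : 'I_n) : 0 <= B ->
  A `<=` cube B -> dirichlet_eigenvalue A l -> 0 < l.
Proof.
move=> B0 AB Al.
have c0 : 0 < 2 * B + 1 by lra.
apply: (@lt_le_trans _ _ ((2 * B + 1) ^- 2)); first by rewrite invr_gt0 exprn_gt0.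
apply: (eigenvalue_ge Al) => f tf; have cf := test_function_Cc tf.
have sf : suppc B f.
  have [_ [K [_ KA Kf]]] := tf; move=> x fx; apply: AB; apply: KA.
  by apply: contrapT => nK; move: fx; rewrite Kf ?eqxx.
have := poincare i B0 cf sf.
rewrite -(@ler_pXn2r _ 2)// ?nnegrE ?mulr_ge0 ?nrm_ge0 ?(ltW c0)// exprMn !nrm_sqr => H.
rewrite mulrC ler_pdivrMr ?exprn_gt0//; apply: le_trans H _; rewrite mulrC.
rewrite ler_wpM2r ?sqr_ge0// /energy (bigD1 i)//= lerDl.
by apply: sumr_ge0 => j _; exact: ip_ge0.
Qed.

Definition dot e x : R := \sum_i e 0 i * x 0 i.

Lemma dotD e x y : dot e (x + y) = dot e x + dot e y.
Proof. by rewrite /dot -big_split; apply: eq_bigr => i _; rewrite mxE mulrDr. Qed.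

Lemma dotZ e (a : R) x : dot e (a *: x) = a * dot e x.
Proof. by rewrite /dot mulr_sumr; apply: eq_bigr => i _; rewrite mxE mulrCA. Qed.

Lemma dotN e x : dot e (- x) = - dot e x.
Proof. by rewrite -scaleN1r dotZ mulN1r. Qed.

Lemma dotB e x y : dot e (x - y) = dot e x - dot e y.
Proof. by rewrite dotD dotN. Qed.

Lemma smooth_dot e : smooth (dot e).
Proof. by apply: smooth_sum => i _; apply: smoothZ; exact: smooth_coord. Qed.

Lemma is_partial_dot e i : is_partial i (dot e) (cst (e 0 i)).
Proof.
move=> x; apply/is_deriveP.
have /is_derive_eq := is_deriveD
  (is_deriveZ (e 0 i) (is_derive_id (0 : R) (1 : R))) (is_derive_cst (dot e x) (0 : R) (1 : R)).
move=> /(_ (e 0 i)) H.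
rewrite (_ : (fun h : R => _) = ((e 0 i \*: id) + cst (dot e x))).
  by apply: H; rewrite addr0 /GRing.scale/= mulr1.
apply/funext => h; rewrite dotD dotZ (_ : dot e (delta_mx 0 i) = e 0 i); last first.
  rewrite /dot (bigD1 i)//= big1; first by rewrite mxE !eqxx mulr1 addr0.
  by move=> j ji; rewrite mxE (negbTE ji) andbF mulr0.
by rewrite mulrC.
Qed.

Lemma continuous_pos_ball f x : continuous f -> 0 < f x ->
  exists2 r : R, 0 < r & forall y, ball x r y -> 0 < f y.
Proof.
move=> cf fx.
have : nbhs x (f @^-1` [set s | 0 < s]).
  by apply: cf; apply: lt_nbhsr.
by move=> /nbhs_ballP[r /= r0 H]; exists r.
Qed.

Lemma closed_ball_out (K : set 'rV[R]_n) x : compact K -> ~ K x ->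
  exists2 r : R, 0 < r & forall y, ball x r y -> ~ K y.
Proof.
move=> cK nKx.
have /nbhs_ballP[r /= r0 H] : nbhs x (~` K).
  apply: open_nbhs_nbhs; split => //; apply: closed_openC.
  by apply: compact_closed => //; exact: norm_hausdorff.
by exists r.
Qed.

(** Smoothness of functions defined by cases: near a point of [K] the function is the smooth [h],
    and around a point outside [K], which is closed, it vanishes. *)
Lemma test_function_patch (A K : set 'rV[R]_n) g h : compact K -> K `<=` A -> smooth h ->
  (forall x, K x -> exists2 r : R, 0 < r & forall y, ball x r y -> g y = h y) ->
  (forall x, ~ K x -> g x = 0) -> test_function A g.
Proof.
move=> cK KA sh gh g0; split; last by exists K.
apply: smooth_local => x; have [Kx|nKx] := pselect (K x).
  by have [r r0 H] := gh x Kx; exists h, r; split => // y /H.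
have [r r0 H] := closed_ball_out cK nKx.
exists (cst 0), r; split; [exact: smooth_cst|exact: r0|].
by move=> y /H /g0.
Qed.

Section max_point.
Variables (A : set 'rV[R]_n) (B l : R) (phi : 'rV[R]_n -> R) (x0 e z : 'rV[R]_n).
Variable i0 : 'I_n.
Hypotheses (B0 : 0 <= B) (AB : A `<=` cube B) (oA : open A) (Ax0 : A x0).
Hypothesis Ephi : dirichlet_eigenfunction A l phi.
Hypothesis phi0 : forall x, A x -> 0 <= phi x <= phi x0.
Hypothesis cphi : {for x0, continuous phi}.
Hypothesis e1 : \sum_i e 0 i ^+ 2 = 1.
Hypothesis Ae : forall x, A x -> 0 < dot e (z - x).

Let M := phi x0.
Let s := Num.sqrt l.

Let l0 : 0 < l. Proof. by apply: (eigenvalue_gt0 i0 B0 AB); exists phi. Qed.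

Let s2 : s ^+ 2 = l. Proof. by rewrite sqr_sqrtr// ltW. Qed.

Let s0 : 0 < s. Proof. by rewrite sqrtr_gt0. Qed.

(* [w = 2 M (1 - exp (- s t))], where [t] is the distance to the hyperplane, is
   a supersolution as long as [w <= M]. *)
Let E x := expR (- s * dot e (z - x)).
Let w x := 2 * M - 2 * M * E x.

Let smooth_t : smooth (fun x => dot e (z - x)).
Proof.
under eq_fun do rewrite dotB.
by apply: smoothB; [exact: smooth_cst|exact: smooth_dot].
Qed.

Let smooth_E : smooth E.
Proof.
apply: (@smooth_comp _ _ (fun r : R => expR (- s * r))) smooth_t.
move=> k; apply: diffn_comp; first exact: diffn_expR.
by have := diffn_affine k (- s) 0; under eq_fun do rewrite addr0.
Qed.

Let partial_E i : partial i E = fun x => s * e 0 i * E x.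
Proof.
have D (r : R) : is_derive r (1 : R) (fun r : R => expR (- s * r)) (- s * expR (- s * r)).
  have Da : is_derive r (1 : R) (fun r : R => - s * r) (- s).
    have /is_derive_eq := is_deriveZ (- s) (is_derive_id r (1 : R)).
    by apply; rewrite /GRing.scale/= mulr1.
  have := @is_derive1_comp _ expR (fun r : R => - s * r) r _ _ (is_derive_expR _) Da.
  by rewrite mulrC.
have Pt : partial i (fun x => dot e (z - x)) = cst (- e 0 i).
  under eq_fun do rewrite dotB.
  rewrite (partialB i (smooth_cst _) (smooth_dot e)) partial_cst (is_partialE (is_partial_dot e i)).
  by apply/funext => x; rewrite sub0r.
rewrite (partial_compE i D smooth_t) Pt; apply/funext => x /=.
by rewrite /E; move: (expR _) => a; ring.
Qed.

Let smooth_w : smooth w.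
Proof. by apply: smoothB; [exact: smooth_cst|exact: smoothZ]. Qed.

Let partial_w i : partial i w = fun x => - 2 * M * s * e 0 i * E x.
Proof.
rewrite (partialB i (smooth_cst _) (smoothZ _ smooth_E)) partial_cst partialZ// partial_E.
by apply/funext => x /=; move: (E x) => a; ring.
Qed.

Let partial2_w i : partial i (partial i w) = fun x => - 2 * M * l * e 0 i ^+ 2 * E x.
Proof.
rewrite partial_w partialZ// partial_E; apply/funext => x.
by move: (E x) => a; rewrite -s2; ring.
Qed.

Let laplace_w x : \sum_i partial i (partial i w) x = l * (w x - 2 * M).
Proof.
under eq_bigr do rewrite partial2_w.
rewrite -mulr_suml -mulr_sumr e1 /w; move: (E x) => a; ring.
Qed.

Let w_le x : w x <= 2 * M.
Proof.
have /andP[M0 _] := phi0 Ax0.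
by rewrite /w lerBlDr lerDl !mulr_ge0 ?expR_ge0.
Qed.

Let w_ge0 x : 0 <= dot e (z - x) -> 0 <= w x.
Proof.
move=> t0; have /andP[M0 _] := phi0 Ax0.
rewrite /w subr_ge0 ler_piMr ?mulr_ge0// /E -expR0 ler_expR mulNr oppr_le0.
by rewrite mulr_ge0// ltW.
Qed.

Section approximation.
Variables (f : 'rV[R]_n -> R) (tf : test_function A f).

(** A smooth stand-in for the positive part of [f - w]. Beyond the hyperplane [w] may be negative
    and [theta (f - w)] positive, hence the cut; at the hyperplane and beyond, [f] vanishes
    anyway. *)
Let v x := if 0 < dot e (z - x) then theta (f x - w x) else 0.

Let smooth_h : smooth (fun x => theta (f x - w x)).
Proof. by apply: smooth_comp; [exact: smooth1_theta|apply: smoothB; [case: tf|]]. Qed.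

Let v_local x : A x -> exists2 r : R, 0 < r & forall y, ball x r y -> v y = theta (f y - w y).
Proof.
move=> Ax; have [r r0 H] := continuous_pos_ball (smooth_continuous smooth_t) (Ae Ax).
by exists r => // y /H ty; rewrite /v ty.
Qed.

Let v_out x : f x = 0 -> v x = 0.
Proof.
move=> fx; rewrite /v; case: ifP => // t0; rewrite fx sub0r theta_le0// oppr_le0.
by rewrite w_ge0// ltW.
Qed.

Lemma test_v : test_function A v.
Proof.
have [sf [K [cK KA Kf]]] := tf.
apply: (test_function_patch cK KA smooth_h) => x; first by move/KA; exact: v_local.
by move/Kf; exact: v_out.
Qed.

Lemma v_notin x : ~ A x -> v x = 0.
Proof.
have [sf [K [cK KA Kf]]] := tf.
by move=> nA; apply: v_out; apply: Kf => /KA.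
Qed.

Lemma v_in x : A x -> v x = theta (f x - w x).
Proof. by move=> /Ae t0; rewrite /v t0. Qed.

(** Where [v] is [theta (f - w)], its derivative is [theta'] times that of [f - w], and
    [0 <= theta' <= 1] gives [theta'^2 <= theta']. *)
Lemma partial_v i x :
  partial i v x ^+ 2 <= partial i f x * partial i v x - partial i w x * partial i v x.
Proof.
have [sf [K [cK KA Kf]]] := tf.
have [Kx|nKx] := pselect (K x); last first.
  have [r r0 H] := closed_ball_out cK nKx.
  rewrite (@partial_local _ _ i v (cst 0) x r)//; last first.
    by move=> y /H /Kf fy; rewrite v_out.
  by rewrite partial_cst expr0n !mulr0 subrr.
have [r r0 H] := v_local (KA _ Kx).
rewrite (@partial_local _ _ i v (fun y => theta (f y - w y)) x r)//; last first.
  by move=> y /H.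
rewrite (partial_compE i (@theta_derive R) (smoothB (sf : smooth f) smooth_w)).
rewrite (partialB i (sf : smooth f) smooth_w).
have /andP[] := theta'_itv (f x - w x).
move: (theta' _) (partial i f x) (partial i w x) => a b c a0 a1.
rewrite -mulrBl exprMn expr2; have := sqr_ge0 (b - c); rewrite expr2; move: (b - c) => t t0.
have : a * (t * t) <= 1 * (t * t) by exact: ler_wpM2r.
have := mulr_ge0 a0 t0; nra.
Qed.

Variable G : 'I_n -> 'rV[R]_n -> R.
Hypotheses (sG : forall i, sqint mu (G i)) (sphi : sqint mu phi).
Hypothesis EL : forall u, test_function A u ->
  energy2 G (fun i => partial i u) = l * ip mu phi u.

Let cf : Cc f. Proof. exact: test_function_Cc tf. Qed.
Let cv : Cc v. Proof. exact: test_function_Cc test_v. Qed.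
(** [delta] and [eta] measure how far [f] is from the eigenfunction, [delta] in gradient and [eta],
    through Cauchy-Schwarz, in L1 of the cube. Both tend to zero along the approximating
    sequence. *)
Let delta := \sum_i nrm mu (fun x => partial i f x - G i x).
Let eta := nrm mu (fun x => f x - phi x) * nrm mu (\1_(cube B) : 'rV[R]_n -> R).

Let sc : sqint mu (\1_(cube B) : 'rV[R]_n -> R).
Proof. by have := @sqint_cube R n B 1; under eq_fun do rewrite mul1r. Qed.

Let err1 : energy2 (fun i x => partial i f x - G i x) (fun i => partial i v) <=
  delta * Num.sqrt (energy v).
Proof.
rewrite /delta mulr_suml /energy2; apply: ler_sum => i _.
have sp := Cc_sqint (Cc_partial i cf); have sv := Cc_sqint (Cc_partial i cv).
apply: le_trans (ler_norm _) _; apply: le_trans (ip_normrM (sqintB sp (sG i)) sv) _.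
rewrite ler_wpM2l ?nrm_ge0// /nrm ler_wsqrtr// /energy (bigD1 i)//= lerDl.
by apply: sumr_ge0 => j _; exact: ip_ge0.
Qed.

(** If [w <= M], the first factor is at most 0 because [phi <= M]. If [w > M >= phi], then
    [v <= f - w <= |f - phi|] is a mere approximation error, and the first factor is at most [M]. *)
Let pointwise x : (phi x + (w x - 2 * M)) * v x <= M * (`|f x - phi x| * \1_(cube B) x).
Proof.
have /andP[M0 _] := phi0 Ax0.
have [Ax|nAx] := pselect (A x); last first.
  by rewrite v_notin// mulr0 mulr_ge0// mulr_ge0.
rewrite indicE mem_set ?mulr1; last exact: AB.
have /andP[_ pM] := phi0 Ax; rewrite -/M in pM.
have v0 : 0 <= v x by rewrite v_in// theta_ge0.
have wM := w_le x.
have [w1|w1] := leP (w x) M.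
  by apply: (@le_trans _ _ 0); [rewrite mulr_le0_ge0//; lra|rewrite mulr_ge0].
have vle : v x <= `|f x - phi x|.
  rewrite v_in//; have [h|h] := leP (f x - w x) 0; first by rewrite theta_le0.
  apply: le_trans (theta_le (ltW h)) _; apply: le_trans _ (ler_norm _); lra.
apply: (@le_trans _ _ (M * v x)); first by apply: ler_wpM2r => //; lra.
exact: ler_wpM2l.
Qed.

(** Sums [partial_v] over the coordinates and moves the derivatives of [w] onto its Laplacian by
    parts. Replacing the gradient of [f] by the weak gradient costs [delta]; the weak equation
    tested with [v] then leaves the integral bounded by [pointwise]. *)
Let energy_v : energy v <= delta * Num.sqrt (energy v) + l * (M * eta).
Proof.
have Ip i := Cc_integrable (CcM cf.1 cv).
have sv := Cc_sqint cv.
have spv i := Cc_sqint (Cc_partial i cv).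
have spf i := Cc_sqint (Cc_partial i cf).
have step1 i : ip mu (partial i v) (partial i v) <=
    ip mu (partial i f) (partial i v) + \int[mu]_x (partial i (partial i w) x * v x).
  have -> : \int[mu]_x (partial i (partial i w) x * v x) = - ip mu (partial i w) (partial i v).
    by rewrite (integration_by_parts_Cc i smooth_w cv) opprK.
  have Iw : mu.-integrable setT (EFin \o (fun x => partial i w x * partial i v x)).
    exact: (Cc_integrable (CcM (smooth_partial i smooth_w) (Cc_partial i cv))).
  have If := sqint_mul (spf i) (spv i).
  rewrite /ip -RintegralB//; apply: le_Rintegral => //.
  - exact: sqint_mul.
  - have := @integrableB _ _ _ mu setT measurableT _ _ If Iw.
    by apply: eq_integrable.
  - by move=> x _; rewrite -expr2; exact: partial_v.
have sumw : \sum_i \int[mu]_x (partial i (partial i w) x * v x) =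
    \int[mu]_x (l * (w x - 2 * M) * v x).
  under [RHS]eq_Rintegral do rewrite -laplace_w mulr_suml.
  rewrite Rintegral_sum// => i.
  exact: (Cc_integrable (CcM (smooth_partial i (smooth_partial i smooth_w)) cv)).
have Iwv : mu.-integrable setT (EFin \o (fun x => (w x - 2 * M) * v x)).
  exact: (Cc_integrable (CcM (smoothB smooth_w (smooth_cst (2 * M))) cv)).
have Iphi := sqint_mul sphi sv.
have bound : ip mu phi v + \int[mu]_x ((w x - 2 * M) * v x) <= M * eta.
  rewrite /ip -RintegralD//.
  have sd : sqint mu (fun x => `|f x - phi x|).
    have sd := sqintB (Cc_sqint cf) sphi.
    apply: (sqint_dom _ _ sd); first by apply: measurableT_comp => //; case: sd.
    by move=> x; rewrite real_normK ?num_real.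
  have In := sqint_mul sd sc.
  apply: (@le_trans _ _ (\int[mu]_x (M * (`|f x - phi x| * \1_(cube B) x)))).
    apply: le_Rintegral => //.
    - have := @integrableD _ _ _ mu setT measurableT _ _ Iphi Iwv.
      by apply: eq_integrable.
    - have := @integrableZl _ _ _ mu setT measurableT M _ In.
      by apply: eq_integrable.
    - by move=> x _; rewrite -mulrDl; exact: pointwise.
  rewrite RintegralZl//; have /andP[M0 _] := phi0 Ax0; rewrite ler_wpM2l//.
  apply: le_trans (ler_norm _) _; apply: le_trans (ip_normrM sd sc) _.
  rewrite /eta ler_wpM2r ?nrm_ge0//; apply: nrm_le => //.
    exact: sqintB (Cc_sqint cf) sphi.
  by move=> x; rewrite real_normK ?num_real.
have split : energy2 (fun i => partial i f) (fun i => partial i v) =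
    energy2 (fun i x => partial i f x - G i x) (fun i => partial i v) + l * ip mu phi v.
  rewrite -(EL test_v) /energy2 -big_split/=; apply: eq_bigr => i _.
  by rewrite (ipBl (spf i) (sG i) (spv i)) subrK.
apply: (@le_trans _ _ (energy2 (fun i => partial i f) (fun i => partial i v) +
    \int[mu]_x (l * (w x - 2 * M) * v x))).
  by rewrite -sumw /energy2 -big_split/=; apply: ler_sum => i _; exact: step1.
rewrite split -addrA; apply: lerD; first exact: err1.
have -> : \int[mu]_x (l * (w x - 2 * M) * v x) = l * \int[mu]_x ((w x - 2 * M) * v x).
  by rewrite -RintegralZl//; apply: eq_Rintegral => x _; rewrite mulrA.
by rewrite -mulrDr ler_wpM2l// ltW.
Qed.

(** With [a] the root of the energy, [2 delta a <= delta^2 + a^2] absorbs the linear term. *)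
Lemma energy_v_le : energy v <= delta ^+ 2 + 2 * (l * (M * eta)).
Proof.
have a0 := energy_ge0 v; have := energy_v; rewrite -{1}(sqr_sqrtr a0) -{3}(sqr_sqrtr a0).
move: (Num.sqrt _) => a H; have := sqr_ge0 (a - delta); nra.
Qed.

Lemma nrm_v_le : nrm mu v ^+ 2 <= (2 * B + 1) ^+ 2 * (delta ^+ 2 + 2 * (l * (M * eta))).
Proof.
have sv : suppc B v.
  move=> x vx; apply: AB; apply: contrapT => /v_notin vx0.
  by move: vx; rewrite vx0 eqxx.
have := poincare i0 B0 cv sv; have c0 : 0 <= 2 * B + 1 by have b0 := B0; lra.
rewrite -(@ler_pXn2r _ 2)// ?nnegrE ?mulr_ge0 ?nrm_ge0// exprMn => H.
apply: le_trans H _; rewrite ler_wpM2l ?sqr_ge0//; apply: le_trans _ energy_v_le.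
rewrite nrm_sqr /energy (bigD1 i0)//= lerDl.
by apply: sumr_ge0 => j _; exact: ip_ge0.
Qed.

End approximation.

(** Otherwise [w x0 < phi x0], so [phi - w] stays above a positive [eta] on a box around [x0]. There
    [theta (f k - w)] cannot tend to zero in L2, contrary to [nrm_v_le]. *)
Lemma max_point_dist : 1 <= 2 * s * dot e (z - x0).
Proof.
have [phi_neq0 [G [[/L2_sqint sphi LG [f [tf cf cG]]] EL]]] := Ephi.
have sG i : sqint mu (G i) by apply/L2_sqint; exact: LG.
have Cf k : Cc (f k) by exact: test_function_Cc (tf k).
have sf k := Cc_sqint (Cf k).
have sp k i := Cc_sqint (Cc_partial i (Cf k)).
have {}cf : nrm mu (fun x => f k x - phi x) @[k --> \oo] --> 0 by apply/L2_cvgP.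
have {}cG i : nrm mu (fun x => partial i (f k) x - G i x) @[k --> \oo] --> 0.
  by have /L2_cvgP := cG i; apply.
have EL' u : test_function A u -> energy2 G (fun i => partial i u) = l * ip mu phi u.
  move=> tu; rewrite -(EL _ tu) Rintegral_energy2// => i.
  exact: (Cc_sqint (Cc_partial i (test_function_Cc tu))).
have /andP[M0 _] := phi0 Ax0; rewrite -/M in M0.
have f_out k x : ~ A x -> f k x = 0.
  by have [_ [K [_ KA Kf]]] := tf k; move=> nA; apply: Kf => /KA.
(* If [M = 0] then [phi] vanishes on [A], and off [A] the approximants do; either way
   [|phi| <= |f k - phi|], so [phi] would be null. *)
have Mp : 0 < M.
  rewrite lt_neqAle M0 andbT eq_sym; apply/eqP => M_eq0.
  apply: phi_neq0; apply: nrm0_ae => //; apply/eqP; rewrite eq_le nrm_ge0 andbT.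
  rewrite -(cvg_lim _ cf)//; apply: limr_ge; first by apply/cvg_ex; eexists; exact: cf.
  apply: nearW => k; apply: nrm_le => //; first exact: sqintB.
  move=> x; have [Ax|nAx] := pselect (A x); last by rewrite f_out// sub0r sqrrN.
  have /andP[h1 h2] := phi0 Ax; rewrite -/M M_eq0 in h2.
  have -> : phi x = 0 by apply/eqP; rewrite eq_le h1 h2.
  by rewrite expr0n sqr_ge0.
rewrite leNgt; apply/negP => t0.
pose v k x := if 0 < dot e (z - x) then theta (f k x - w x) else 0.
have vbound k : nrm mu (v k) ^+ 2 <= (2 * B + 1) ^+ 2 *
    ((\sum_i nrm mu (fun x => partial i (f k) x - G i x)) ^+ 2 +
     2 * (l * (M * (nrm mu (fun x => f k x - phi x) * nrm mu (\1_(cube B) : 'rV[R]_n -> R))))).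
  exact: (nrm_v_le (tf k) sG sphi EL').
have cv2 : nrm mu (v k) ^+ 2 @[k --> \oo] --> 0.
  apply: (@squeeze_cvgr _ _ _ _ (cst 0) (fun k => (2 * B + 1) ^+ 2 *
    ((\sum_i nrm mu (fun x => partial i (f k) x - G i x)) ^+ 2 +
     2 * (l * (M * (nrm mu (fun x => f k x - phi x) * nrm mu (\1_(cube B) : 'rV[R]_n -> R))))))).
  - by apply: nearW => k; rewrite sqr_ge0 vbound.
  - exact: cvg_cst.
  - have cD : \sum_i nrm mu (fun x => partial i (f k) x - G i x) @[k --> \oo] --> 0.
      elim: (index_enum _) => [|i r IH].
        by under eq_fun do rewrite big_nil; exact: cvg_cst.
      under eq_fun do rewrite big_cons.
      by have c := cvgD (cG i) IH; rewrite addr0 in c; exact: c.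
    have c := cvgM (cvg_cst ((2 * B + 1) ^+ 2)) (cvgD (cvgM cD cD) (cvgM (cvg_cst (2 : R))
      (cvgM (cvg_cst l) (cvgM (cvg_cst M)
        (cvgM cf (cvg_cst (nrm mu (\1_(cube B) : 'rV[R]_n -> R)))))))).
    rewrite !mul0r !mulr0 addr0 mulr0 in c; exact: c.
have cv : nrm mu (v k) @[k --> \oo] --> 0.
  move: cv2 => /(continuous_cvg _ (@sqrt_continuous R 0)).
  rewrite sqrtr0; apply: cvg_trans; apply: near_eq_cvg; apply: nearW => k /=.
  by rewrite sqrtr_sqr ger0_norm// nrm_ge0.
(* With [t] the distance from [x0] to the hyperplane, [exp (- s t) >= 1 - s t > 1 / 2]. *)
have wx0 : w x0 < M.
  rewrite /w /E; have := expR_ge1Dx (- s * dot e (z - x0)); move: (expR _) => a ha.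
  have : 1 < 2 * a by lra.
  move: Mp; move: M => m; nra.
pose eta := (M - w x0) / 2.
have eta0 : 0 < eta by rewrite divr_gt0// subr_gt0.
have [r r0 Nr] : exists2 r : R, 0 < r & forall y, ball x0 r y -> A y /\ eta <= phi y - w y.
  have cw : {for x0, continuous (fun y => phi y - w y)}.
    exact: (cvgB cphi (@smooth_continuous _ _ _ smooth_w x0)).
  have n1 : nbhs x0 A by apply: open_nbhs_nbhs.
  have n2 : nbhs x0 ((fun y => phi y - w y) @^-1` [set a | eta < a]).
    by apply: cw; apply: lt_nbhsr; rewrite -/M /eta; lra.
  have /nbhs_ballP[r /= r0 H] :
    nbhs x0 (A `&` (fun y => phi y - w y) @^-1` [set a | eta < a]) by exact: filterI.
  by exists r => // y /H[? /ltW].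
pose N : set 'rV[R]_n := box (fun i => `[x0 0 i - r / 2, x0 0 i + r / 2]%classic).
have mN : measurable N by exact: measurable_box.
have muN : mu N = (r ^+ n)%:E.
  rewrite (@lebesgue_box _ _ _ (fun=> r)) ?prodr_const ?card_ord//.
  move=> i; rewrite lebesgue_measure_itv/= lte_fin.
  by rewrite ifT; [rewrite -EFinB; congr EFin; field|lra].
have NA x : N x -> A x /\ eta <= phi x - w x.
  move=> Nx; apply: Nr; apply/rV_ballP => // i.
  by have := Nx i; rewrite /= in_itv/= => /andP[? ?]; rewrite ltr_norml; apply/andP; split; lra.
have sN := sqint_indic mN muN.
have sv k := Cc_sqint (test_function_Cc (test_v (tf k))).
have sd k : sqint mu (fun x => `|f k x - phi x|).
  have sd := sqintB (sf k) sphi.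
  apply: (sqint_dom _ _ sd); first by apply: measurableT_comp => //; case: sd.
  by move=> x; rewrite real_normK ?num_real.
have nd k : nrm mu (fun x => `|f k x - phi x|) <= nrm mu (fun x => f k x - phi x).
  apply: nrm_le => //; first exact: sqintB.
  by move=> x; rewrite real_normK ?num_real.
(* On [N], monotonicity and the Lipschitz bound give [theta eta <= theta (phi - w) <= theta (f k -
   w) + |f k - phi|]. *)
have key k : nrm mu (fun x => theta eta * \1_N x) <= nrm mu (v k) + nrm mu (fun x => f k x - phi x).
  apply: (@le_trans _ _ (nrm mu (v k) + nrm mu (fun x => `|f k x - phi x|))); last by rewrite lerD2l.
  apply: le_trans (nrmD (sv k) (sd k)).
  apply: nrm_le; [exact: sqintZ|exact: sqintD (sv k) (sd k)|move=> x].
  have v0 : 0 <= v k x by rewrite /v; case: ifP => // _; exact: theta_ge0.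
  rewrite ler_pXn2r ?nnegrE ?addr_ge0 ?mulr_ge0 ?theta_ge0//.
  rewrite indicE; have [|_] := boolP (x \in N); last by rewrite mulr0 addr_ge0.
  rewrite inE mulr1 => /NA[Ax etax]; rewrite -/(v k x).
  have -> : v k x = theta (f k x - w x) by exact: v_in.
  apply: le_trans (theta_homo etax) _.
  have := theta_lip (phi x - w x) (f k x - w x).
  have -> : phi x - w x - (f k x - w x) = - (f k x - phi x) by ring.
  rewrite normrN; have := ler_norm (theta (phi x - w x) - theta (f k x - w x)).
  by move: (theta _) (theta _) (`|_|) (`|_|) => a b c d; lra.
have pos : 0 < nrm mu (fun x => theta eta * \1_N x).
  rewrite nrmZ// mulr_gt0 ?normr_gt0 ?gt_eqF ?theta_gt0//.
  by rewrite /nrm (ip_indic mN muN) sqrtr_gt0 exprn_gt0.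
have c0 : nrm mu (v k) + nrm mu (fun x => f k x - phi x) @[k --> \oo] --> 0.
  by have c := cvgD cv cf; rewrite addr0 in c; exact: c.
suff : nrm mu (fun x => theta eta * \1_N x) <= 0 by move: pos; rewrite ltNge => /negP.
rewrite -(cvg_lim _ c0)//; apply: limr_ge; first by apply/cvg_ex; eexists; exact: c0.
exact: nearW.
Qed.

End max_point.

End comparison.

(** * Separation of a point from a bounded convex set *)

Section separation.
Variables (R : realType) (n : nat).
Implicit Types (x y z e a : 'rV[R]_n) (S A : set 'rV[R]_n).

Lemma convex_set_segment S x y (t : R) : convex_set S -> S x -> S y ->
  0 <= t -> t <= 1 -> S (t *: x + (1 - t) *: y).
Proof.
move=> cS Sx Sy t0 t1.
by have := cS x y (Itv01 t0 t1); rewrite !inE => /(_ Sx Sy).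
Qed.

Lemma dotC x y : dot x y = dot y x.
Proof. by apply: eq_bigr => i _; rewrite mulrC. Qed.

Lemma dotZl (t : R) x y : dot (t *: x) y = t * dot x y.
Proof. by rewrite dotC dotZ dotC. Qed.

Lemma dot_ge0 x : 0 <= dot x x.
Proof. by apply: sumr_ge0 => i _; rewrite -expr2 sqr_ge0. Qed.

Lemma dotxx x : dot x x = \sum_i x 0 i ^+ 2.
Proof. by apply: eq_bigr => i _; rewrite expr2. Qed.

Lemma enorm_ge0 x : 0 <= enorm x.
Proof. exact: sqrtr_ge0. Qed.

Lemma enorm_sqr x : enorm x ^+ 2 = dot x x.
Proof. by rewrite /enorm -dotxx sqr_sqrtr ?dot_ge0. Qed.

Lemma dot_sqr_addZ x y (t : R) :
  dot (x + t *: y) (x + t *: y) = dot x x + 2 * t * dot x y + t ^+ 2 * dot y y.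
Proof.
rewrite dotD dotC dotD [dot (x + _) _]dotC dotD !dotZ !dotZl (dotC y x).
by move: (dot x x) (dot x y) (dot y y) => a b c; ring.
Qed.

Lemma dot_le x y : `|dot x y| <= enorm x * enorm y.
Proof.
rewrite -(@ler_pXn2r _ 2)// ?nnegrE ?mulr_ge0 ?enorm_ge0// exprMn !enorm_sqr.
rewrite real_normK ?num_real//.
have H (t : R) := dot_ge0 (x + t *: y); have y0 := dot_ge0 y.
have {}H t : 0 <= dot x x + 2 * t * dot x y + t ^+ 2 * dot y y by rewrite -dot_sqr_addZ.
move: (dot x x) (dot x y) (dot y y) y0 H => a b c c0 H.
have [c_eq|cn] := eqVneq c 0.
  have [->|bn] := eqVneq b 0; first by rewrite c_eq expr0n mulr0.
  have := H (- (a + 1) / (2 * b)); rewrite c_eq mulr0 addr0.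
  have -> : 2 * (- (a + 1) / (2 * b)) * b = - (a + 1) by field.
  lra.
have {}c0 : 0 < c by rewrite lt_neqAle eq_sym cn.
have := H (- b / c).
have -> : a + 2 * (- b / c) * b + (- b / c) ^+ 2 * c = (a * c - b ^+ 2) / c by field.
by rewrite ler_pdivlMr// mul0r subr_ge0.
Qed.

Lemma enorm_le_sum x : enorm x <= \sum_i `|x 0 i|.
Proof.
rewrite -(@ler_pXn2r _ 2)// ?nnegrE ?enorm_ge0 ?sumr_ge0// enorm_sqr dotxx.
rewrite [leRHS]expr2 mulr_suml; apply: ler_sum => i _.
rewrite -real_normK ?num_real// expr2 ler_wpM2l// (bigD1 i)//= lerDl.
exact: sumr_ge0.
Qed.

Lemma coord_le_enorm x i : `|x 0 i| <= enorm x.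
Proof.
rewrite -(@ler_pXn2r _ 2)// ?nnegrE ?enorm_ge0// enorm_sqr dotxx real_normK ?num_real//.
by rewrite (bigD1 i)//= lerDl; apply: sumr_ge0 => j _; exact: sqr_ge0.
Qed.

Lemma enormZ (t : R) x : enorm (t *: x) = `|t| * enorm x.
Proof.
apply/eqP; rewrite -(@eqrXn2 _ 2)// ?mulr_ge0 ?enorm_ge0// exprMn !enorm_sqr.
by rewrite real_normK ?num_real// dotZl dotZ mulrA expr2.
Qed.

(* An almost nearest point is enough: no compactness is needed. *)
Lemma separation S x (delta L : R) : convex_set S -> S !=set0 -> 0 < delta ->
  (forall a, S a -> delta <= enorm (x - a)) ->
  (forall a b, S a -> S b -> enorm (a - b) <= L) ->
  exists2 e : 'rV[R]_n, \sum_i e 0 i ^+ 2 = 1 & forall a, S a -> delta / 2 <= dot e (x - a).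
Proof.
move=> cS [s0 Ss0] d0 Sd SL.
have L0 : 0 <= L by apply: le_trans (SL _ _ Ss0 Ss0); exact: enorm_ge0.
pose E := [set dot (x - a) (x - a) | a in S].
have hE : has_inf E.
  by split; [exists (dot (x - s0) (x - s0)), s0|exists 0 => _ [a _ <-]; exact: dot_ge0].
(* The infimum is missed by less than [t delta^2 / 2]. Moving from [a0] towards [a] by the fraction
   [t] then gives [dot p (a - a0) <= delta^2 / 4 + t L^2 / 2 <= delta^2 / 2], so half of [delta]
   survives. *)
pose t := Num.min 1 (delta ^+ 2 / (2 * (L ^+ 2 + 1))).
have L2 : 0 < 2 * (L ^+ 2 + 1) by have := sqr_ge0 L; lra.
have t0 : 0 < t by rewrite lt_min ltr01 divr_gt0// exprn_gt0.
have t1 : t <= 1 by rewrite ge_min lexx.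
have tL : t * L ^+ 2 <= delta ^+ 2 / 2.
  have : t <= delta ^+ 2 / (2 * (L ^+ 2 + 1)) by rewrite ge_min lexx orbT.
  rewrite ler_pdivlMr// => H; have := mulr_ge0 (ltW t0) (sqr_ge0 L); lra.
have [_ [a0 Sa0 <-] Ha0] := inf_adherent (mulr_gt0 t0 (divr_gt0 (exprn_gt0 2 d0) (ltr0Sn R 1))) hE.
set p := x - a0 in Ha0.
have np : delta <= enorm p by exact: Sd.
have np0 : 0 < enorm p by exact: lt_le_trans np.
have key a : S a -> dot p (a - a0) <= delta ^+ 2 / 4 + t * L ^+ 2 / 2.
  move=> Sa.
  have : inf E <= dot (p + - t *: (a - a0)) (p + - t *: (a - a0)).
    apply: ge_inf; first by case: hE.
    exists (t *: a + (1 - t) *: a0); first exact: (convex_set_segment cS Sa Sa0 (ltW t0) t1).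
    by congr dot; apply/rowP => i; rewrite !mxE; ring.
  rewrite dot_sqr_addZ -[dot (a - a0) _]enorm_sqr.
  have : enorm (a - a0) ^+ 2 <= L ^+ 2.
    by rewrite ler_pXn2r ?nnegrE ?enorm_ge0//; exact: SL.
  move: Ha0 (enorm_ge0 (a - a0)); move: (inf E) (dot p p) (dot p _) (enorm _ ^+ 2) => I P Q N.
  move=> h1 h2 h3 h4.
  have h5 : t ^+ 2 * N <= t ^+ 2 * L ^+ 2 by rewrite ler_wpM2l ?sqr_ge0.
  rewrite -(ler_pM2l t0); move: h1 h4 h5; move: (L ^+ 2) (delta ^+ 2) => l d.
  rewrite expr2; lra.
exists ((enorm p)^-1 *: p).
  rewrite -dotxx dotZl dotZ -enorm_sqr expr2 mulrA; move: np0; move: (enorm p) => a a0'.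
  by field; rewrite gt_eqF.
move=> a Sa; rewrite dotZl.
have -> : x - a = p - (a - a0) by rewrite /p opprB addrA subrK.
rewrite dotB -enorm_sqr ler_pdivlMl//.
have := key a Sa; have : delta ^+ 2 <= enorm p * delta by rewrite expr2 ler_wpM2r// ltW.
have : delta * enorm p <= enorm p ^+ 2 by rewrite expr2 ler_wpM2r// ltW.
move: tL; move: (dot _ _) (enorm p) (delta ^+ 2) (L ^+ 2) => q m d l.
rewrite (mulrC m); lra.
Qed.

End separation.

(** * A ball around the maximum point inside the convex base *)

Section inner_ball.
Variables (R : realType) (n : nat).
Local Notation mu := (lebesgue R n).

Lemma enormD (x y : 'rV[R]_n) : enorm (x + y) <= enorm x + enorm y.
Proof.
rewrite -(@ler_pXn2r _ 2)// ?nnegrE ?addr_ge0 ?enorm_ge0// enorm_sqr -[y in dot _ (x + y)]scale1r.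
rewrite -[y in dot (x + y) _]scale1r dot_sqr_addZ -!enorm_sqr.
have := le_trans (ler_norm _) (dot_le x y).
move: (dot x y) (enorm x) (enorm y) => a b c; rewrite !expr2; lra.
Qed.

Lemma cube_enorm (B : R) (x y : 'rV[R]_n) : cube B x -> cube B y ->
  enorm (x - y) <= n%:R * (2 * B).
Proof.
move=> /cubeP xB /cubeP yB; apply: le_trans (enorm_le_sum _) _.
apply: le_trans (_ : \sum_(i < n) (2 * B) <= _); last first.
  by rewrite sumr_const card_ord [leRHS]mulr_natl.
apply: ler_sum => i _; rewrite !mxE; apply: le_trans (ler_normB _ _) _.
by have := xB i; have := yB i; lra.
Qed.

(** A point [z] outside [A] may be at distance zero from it, but [z'], the reflection of [x0] in
    [z], is at distance at least [r], so it can be separated strictly. Doubling the distance turns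
    the 2 of [max_point_dist] into the 4 of the radius. *)
Lemma inner_ball (A : set 'rV[R]_n) (B l : R) (phi : 'rV[R]_n -> R) (x0 : 'rV[R]_n) (i0 : 'I_n) :
  0 <= B -> A `<=` cube B -> open A -> A x0 -> convex_set A ->
  dirichlet_eigenfunction A l phi ->
  (forall x, A x -> 0 <= phi x <= phi x0) -> {for x0, continuous phi} ->
  forall z, enorm (z - x0) < (4 * Num.sqrt l)^-1 -> A z.
Proof.
move=> B0 AB oA Ax0 cA Ephi phi0 cphi z zx0; apply: contrapT => nAz.
have l0 : 0 < l by apply: (eigenvalue_gt0 i0 B0 AB); exists phi.
have s0 : 0 < Num.sqrt l by rewrite sqrtr_gt0.
have [r r0 rA] : exists2 r : R, 0 < r & forall y, ball x0 r y -> A y.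
  have /nbhs_ballP[r /= r0 H] : nbhs x0 A by exact: open_nbhs_nbhs.
  by exists r.
pose z' := z + (z - x0).
(* [z] is the midpoint of [a] and [x0 + (z' - a)] *)
have far a : A a -> r <= enorm (z' - a).
  move=> Aa; rewrite leNgt; apply/negP => az; apply: nAz.
  have Ab : A (x0 + (z' - a)).
    apply: rA; apply/rV_ballP => // i; apply: le_lt_trans az.
    rewrite -normrN; apply: le_trans _ (coord_le_enorm (z' - a) i).
    by rewrite !mxE le_eqVlt; apply/orP; left; apply/eqP; congr (`|_|); ring.
  have := @convex_set_segment R n A a (x0 + (z' - a)) 2^-1 cA Aa Ab.
  have h0 : 0 <= 2^-1 :> R by rewrite invr_ge0.
  have h1 : 2^-1 <= 1 :> R by rewrite invf_le1// ler1n.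
  move=> /(_ h0 h1); congr A; apply/rowP => i; rewrite !mxE; by field.
have [|e e1 eA] := separation cA (ex_intro _ x0 Ax0) r0 far (L := n%:R * (2 * B)).
  by move=> a b /AB aB /AB bB; exact: cube_enorm.
have Ae x : A x -> 0 < dot e (z' - x).
  by move=> /eA; apply: lt_le_trans; rewrite divr_gt0.
have := max_point_dist i0 B0 AB oA Ax0 Ephi phi0 cphi e1 Ae.
have -> : z' - x0 = 2 *: (z - x0) by apply/rowP => i; rewrite !mxE; ring.
have ne : enorm e = 1 by rewrite /enorm e1 sqrtr1.
have := le_trans (ler_norm _) (dot_le e (z - x0)); rewrite ne mul1r dotZ.
move: zx0; rewrite -[(4 * _)^-1]mul1r ltr_pdivlMr ?mulr_gt0//.
move: (dot e _) (enorm (z - x0)) (Num.sqrt l) s0 => d m s s0 h1 h2 h3.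
have : s * d <= s * m by rewrite ler_wpM2l// ltW.
lra.
Qed.

End inner_ball.

(** * Product cutoffs on cubes, and the eigenvalue bound they give *)

Section cutoff.
Variables (R : realType) (n : nat).
Local Notation mu := (lebesgue R n).
Implicit Types (c x : 'rV[R]_n) (r : R).

Definition ccube c r : set 'rV[R]_n := [set x | forall i, `|x 0 i - c 0 i| <= r].

Lemma ccubeE c r : ccube c r = box (fun i => `[c 0 i - r, c 0 i + r]%classic).
Proof.
apply/seteqP; split => x xc i; have := xc i; rewrite /= in_itv/= ler_distl => //.
Qed.

Lemma measurable_ccube c r : measurable (ccube c r).
Proof. by rewrite ccubeE; exact: measurable_box. Qed.

Lemma lebesgue_ccube c r : 0 <= r -> mu (ccube c r) = ((2 * r) ^+ n)%:E.
Proof.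
move=> r0; rewrite ccubeE (@lebesgue_box _ _ _ (fun=> 2 * r)) ?prodr_const ?card_ord//.
move=> i; rewrite lebesgue_measure_itv/= lte_fin.
case: ltP => h; first by rewrite -EFinB; congr EFin; ring.
by congr EFin; lra.
Qed.

Lemma compact_ccube c r : compact (ccube c r).
Proof. by rewrite ccubeE; apply: (@rV_compact _ _ (fun i => `[c 0 i - r, c 0 i + r]%classic)) => i; exact: segment_compact. Qed.

Definition cutoff c r x : R := \prod_i bump ((x 0 i - c 0 i) / r).

Definition cutoff_slope : R := 2 * expR 1 ^+ 2.

Lemma smooth_cutoff c r : smooth (cutoff c r).
Proof.
apply: smooth_prod => i _; apply: smooth_comp; first exact: smooth1_bump.
under eq_fun do rewrite mulrC.
by apply: smoothZ; apply: smoothB; [exact: smooth_coord|exact: smooth_cst].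
Qed.

Lemma cutoff_itv c r x : 0 <= cutoff c r x <= 1.
Proof.
apply/andP; split; first by apply: prodr_ge0 => i _; case/andP: (bump_itv ((x 0 i - c 0 i) / r)).
by apply: prodr_ile1 => i _; exact: bump_itv.
Qed.

Lemma cutoff1 c r x : 0 < r -> ccube c r x -> cutoff c r x = 1.
Proof.
move=> r0 xc; apply: big1 => i _; apply: bump1.
by rewrite normrM normfV (gtr0_norm r0) ler_pdivrMr// mul1r.
Qed.

Lemma partial_cutoff c r i : partial i (cutoff c r) =
  fun x => bump' ((x 0 i - c 0 i) / r) / r * \prod_(j | j != i) bump ((x 0 j - c 0 j) / r).
Proof.
apply: is_partialE => x.
pose g := fun x : 'rV[R]_n => bump ((x 0 i - c 0 i) / r).
pose h := fun x : 'rV[R]_n => \prod_(j | j != i) bump ((x 0 j - c 0 j) / r).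
have Pc : is_partial i (fun x : 'rV[R]_n => (x 0 i - c 0 i) / r) (cst (r^-1)).
  move=> y; have /is_derive_eq := is_deriveZ (r^-1)
    (is_deriveB (is_partial_coord i i y) (is_derive_cst (c 0 i) y (delta_mx 0 i))).
  move=> /(_ (r^-1)); rewrite eqxx subr0 /GRing.scale/= mulr1 => /(_ erefl).
  by congr is_derive; apply/funext => w; rewrite mulrC.
have Pg := is_partial_comp (@bump_derive R) Pc.
have Ph : is_derive x (delta_mx 0 i) h 0.
  apply/is_deriveP.
  rewrite (_ : (fun t : R => _) = cst (h x)); first exact: is_derive_cst.
  apply/funext => t; apply: eq_bigr => j ji.
  by rewrite !mxE (negbTE ji) andbF mulr0 add0r.
rewrite (_ : cutoff c r = fun x => g x * h x); last first.
  by apply/funext => y; rewrite /cutoff (bigD1 i).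
have /is_derive_eq := is_deriveM (Pg x) Ph; apply.
by rewrite scaler0 add0r /GRing.scale/= mulrC.
Qed.

Lemma partial_cutoff_le c r i x : 0 < r ->
  `|partial i (cutoff c r) x| <= cutoff_slope / r * \1_(ccube c (2 * r)) x.
Proof.
move=> r0; rewrite partial_cutoff indicE.
have pos j : 0 <= bump ((x 0 j - c 0 j) / r) <= 1 by exact: bump_itv.
have [|/negP] := boolP (x \in ccube c (2 * r)); rewrite inE => xc.
- rewrite mulr1 normrM normrM normfV (gtr0_norm r0) -[leRHS]mulr1.
  apply: ler_pM => //; first by rewrite mulr_ge0// invr_ge0 ltW.
    by rewrite ler_wpM2r ?invr_ge0 ?(ltW r0)//; exact: bump'_le.
  rewrite ger0_norm; last by apply: prodr_ge0 => j _; case/andP: (pos j).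
  by apply: prodr_ile1.
- rewrite mulr0 normr_le0.
  have [j xj] : exists j, 2 * r < `|x 0 j - c 0 j|.
    by move/existsNP: xc => [j /negP]; rewrite -ltNge => xj; exists j.
  have [b0 b'0] : bump ((x 0 j - c 0 j) / r) = 0 /\ bump' ((x 0 j - c 0 j) / r) = 0.
    by apply: bump_out; rewrite normrM normfV (gtr0_norm r0) ler_pdivlMr// ltW.
  have [<-|ji] := eqVneq j i; first by rewrite b'0 !mul0r.
  by rewrite (bigD1 j)//= b0 mul0r mulr0.
Qed.

Lemma cutoff_out c r x : 0 < r -> ~ ccube c (2 * r) x -> cutoff c r x = 0.
Proof.
move=> r0 /existsNP[j /negP]; rewrite -ltNge => xj.
have [b0 _] : bump ((x 0 j - c 0 j) / r) = 0 /\ bump' ((x 0 j - c 0 j) / r) = 0.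
  by apply: bump_out; rewrite normrM normfV (gtr0_norm r0) ler_pdivlMr// ltW.
by rewrite /cutoff (bigD1 j)//= b0 mul0r.
Qed.

Lemma test_function_cutoff A c r : 0 < r -> ccube c (2 * r) `<=` A ->
  test_function A (cutoff c r).
Proof.
move=> r0 cA; split; first exact: smooth_cutoff.
exists (ccube c (2 * r)); split => //; first exact: compact_ccube.
by move=> x; exact: cutoff_out.
Qed.

(** Rayleigh quotient of the cutoff: its mass is at least [(2 r)^n], and each of its [n] derivatives
    is at most [cutoff_slope / r] on a cube of volume [(4 r)^n]. *)
Lemma ccube_lambda1_le (A : set 'rV[R]_n) (B : R) c r : 0 <= B -> A `<=` cube B -> 0 < r -> ccube c (2 * r) `<=` A ->
  (lambda1 A <= (n%:R * 2 ^+ n * (cutoff_slope / r) ^+ 2)%:E)%E.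
Proof.
move=> B0 AB r0 cA; have tc := test_function_cutoff r0 cA; have Cf := test_function_Cc tc.
have sI s : 0 <= s -> sqint mu (\1_(ccube c s)) /\
    ip mu (\1_(ccube c s)) (\1_(ccube c s)) = (2 * s) ^+ n.
  move=> s0; split.
    by apply: (sqint_indic (measurable_ccube c s) (lebesgue_ccube c s0)).
  by rewrite (ip_indic (measurable_ccube c s) (lebesgue_ccube c s0)).
have r2 : 0 <= 2 * r by rewrite mulr_ge0// ltW.
have [s1 i1] := sI r (ltW r0); have [s2 i2] := sI (2 * r) r2.
have low : (2 * r) ^+ n <= ip mu (cutoff c r) (cutoff c r).
  rewrite -i1 -!nrm_sqr ler_pXn2r ?nnegrE ?nrm_ge0//; apply: nrm_le => //.
    exact: Cc_sqint.
  move=> x; rewrite indicE; have [|_] := boolP (x \in ccube c r); last by rewrite expr0n sqr_ge0.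
  by rewrite inE => xc; rewrite cutoff1.
have low0 : 0 < (2 * r) ^+ n by rewrite exprn_gt0// mulr_gt0.
have ip0 := lt_le_trans low0 low.
have K0 : 0 <= cutoff_slope / r by rewrite divr_ge0 ?(ltW r0)// mulr_ge0// exprn_ge0 ?expR_ge0.
have high : energy (cutoff c r) <= n%:R * ((cutoff_slope / r) ^+ 2 * (2 * (2 * r)) ^+ n).
  rewrite -i2 mulr_natl -[X in _ *+ X]card_ord -sumr_const; apply: ler_sum => i _.
  have -> : (cutoff_slope / r) ^+ 2 * ip mu \1_(ccube c (2 * r)) \1_(ccube c (2 * r)) =
      nrm mu (fun x => cutoff_slope / r * \1_(ccube c (2 * r)) x) ^+ 2.
    by rewrite nrmZ// [RHS]exprMn real_normK ?num_real// nrm_sqr.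
  rewrite -nrm_sqr ler_pXn2r ?nnegrE ?nrm_ge0//; apply: nrm_le => //.
  - exact: Cc_sqint (Cc_partial i Cf).
  - exact: sqintZ.
  - move=> x; rewrite -real_normK ?num_real// ler_pXn2r ?nnegrE//; last exact: mulr_ge0.
    exact: partial_cutoff_le.
apply: (@le_trans _ _ (energy (cutoff c r) / ip mu (cutoff c r) (cutoff c r))%:E).
  exact: (lambda1_le B0 AB tc ip0).
rewrite lee_fin ler_pdivrMr//.
apply: le_trans high _; rewrite [(2 * (2 * r)) ^+ n]exprMn.
move: ((2 * r) ^+ n) (ip mu _ _) low ((cutoff_slope / r) ^+ 2) (sqr_ge0 (cutoff_slope / r)).
move=> Q I QI K' K'0; rewrite [K' * _]mulrCA -!mulrA.
by do 3! rewrite ler_wpM2l ?exprn_ge0//.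
Qed.

End cutoff.

(** * Upper bound for the dumbbell with an obstacle away from the maximum point *)

Section obstacle.
Variables (R : realType) (n : nat).
Implicit Types (A S D : set 'rV[R]_n) (x y z : 'rV[R]_n).

Lemma translate_convex y D : convex_set D -> convex_set (translate y D).
Proof.
move=> cD _ _ t /[!inE] -[a Da <-] [b Db <-].
have /[!inE] Dab := cD a b t (mem_set Da) (mem_set Db).
exists (conv t (a : convex_lmodType _) b) => //; apply/rowP => i.
rewrite /conv/= !mxE /unstable.onem.
by move: (t%:num) (y 0 i) (a 0 i) (b 0 i) => s u v w; ring.
Qed.

Lemma bounded_sub_cube S : bounded_set S -> exists2 B : R, 0 <= B & S `<=` cube B.
Proof.
move=> [B [_ SB]]; exists (Num.max 0 (B + 1)); first by rewrite le_max lexx.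
move=> x Sx; apply/cubeP => i; rewrite le_max; apply/orP; right.
apply: le_trans (SB (B + 1) _ x Sx); last by rewrite ltrDl.
rewrite [leRHS]mx_normrE.
by apply/bigmax_geP; right => /=; exists (0, i).
Qed.

Lemma translate_bounded y D (B : R) : D `<=` cube B ->
  forall a b, translate y D a -> translate y D b -> enorm (a - b) <= n%:R * (2 * B).
Proof.
move=> DB _ _ [a /DB aB <-] [b /DB bB <-].
rewrite (_ : y + a - (y + b) = a - b); first exact: cube_enorm.
by apply/rowP => i; rewrite !mxE; ring.
Qed.

Lemma eucl_dist_le x S z : S z -> eucl_dist x S <= enorm (x - z).
Proof.
move=> Sz; apply: ge_inf; last by exists z.
by exists 0 => _ [a _ <-]; exact: enorm_ge0.
Qed.

(** The bound of [ccube_lambda1_le] at [r = 1 / (32 n sqrt l)], with the factor [l] taken out. *)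
Definition inradius_cst : R := n%:R * 2 ^+ n * (cutoff_slope R * (32 * n%:R)) ^+ 2.

Lemma perforated_lambda1_le A0 A D y x0 (B B' l : R) phi (i0 : 'I_n) :
  0 <= B -> A0 `<=` cube B -> open A0 -> A0 x0 -> convex_set A0 ->
  dirichlet_eigenfunction A0 l phi ->
  (forall x, A0 x -> 0 <= phi x <= phi x0) -> {for x0, continuous phi} ->
  0 <= B' -> A `<=` cube B' -> A0 `<=` A ->
  D !=set0 -> bounded_set D -> convex_set D ->
  0 < eucl_dist x0 (translate y D) ->
  (lambda1 (perforated A D y) <= (inradius_cst * l)%:E)%E.
Proof.
move=> B0 A0B oA0 A0x0 cA0 Ephi phi0 cphi B'0 AB' A0A [d0 Dd0] bD cD dist0.
have l0 : 0 < l by apply: (eigenvalue_gt0 i0 B0 A0B); exists phi.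
have s0 : 0 < Num.sqrt l by rewrite sqrtr_gt0.
have [C C0 DC] := bounded_sub_cube bD.
have [|e e1 eD] := separation (translate_convex (y := y) cD) _ dist0
  (fun a Da => eucl_dist_le x0 Da) (translate_bounded DC); first by exists (y + d0), d0.
(* The separation has a margin of half the distance, so it stays strict on the closure. *)
have {}eD a : closure (translate y D) a -> 0 < dot e (x0 - a).
  move=> ca; rewrite ltNge; apply/negP => a0.
  have cda : {for a, continuous (fun a : 'rV[R]_n => dot e (x0 - a))}.
    apply: smooth_continuous; under eq_fun do rewrite dotB.
    by apply: smoothB; [exact: smooth_cst|exact: smooth_dot].
  have nb : nbhs a ((fun a : 'rV[R]_n => dot e (x0 - a)) @^-1` [set t | t < eucl_dist x0 (translate y D) / 2]).
    by apply: cda; apply: lt_nbhsl; rewrite (le_lt_trans a0)// divr_gt0.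
  by have [b [/eD + /=]] := ca _ nb; rewrite leNgt => /negP.
have n0 : 0 < n%:R :> R by rewrite ltr0n; case: (n) i0 => [[]|].
have ne : enorm e = 1 by rewrite /enorm e1 sqrtr1.
(* [rho] is the radius from [inner_ball]. The cube of half-side [2 r] has Euclidean radius at most
   [2 r n = rho / 4] about [c], which is at distance [rho / 2] from [x0] along [e]. So its points
   are within [3 rho / 4] of [x0] and on the side of [x0] away from the obstacle. *)
pose rho := (4 * Num.sqrt l)^-1.
have rho0 : 0 < rho by rewrite invr_gt0 mulr_gt0.
pose r := rho / (8 * n%:R).
have r0 : 0 < r by rewrite divr_gt0// mulr_gt0.
pose c := x0 + (rho / 2) *: e.
have near x : ccube c (2 * r) x -> enorm (x - c) <= rho / 4.
  move=> xc; apply: le_trans (enorm_le_sum _) _.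
  apply: le_trans (_ : \sum_(i < n) (2 * r) <= _); last first.
    rewrite sumr_const card_ord -mulr_natl /r le_eqVlt; apply/orP; left; apply/eqP.
    by field; rewrite gt_eqF.
  apply: ler_sum => i _; rewrite (_ : (x - c) 0 i = x 0 i - c 0 i); first exact: xc.
  by move: (c) => c'; rewrite !mxE.
have cS : ccube c (2 * r) `<=` perforated A D y.
  move=> x xc; have nx := near x xc.
  have E : x - x0 = (x - c) + (rho / 2) *: e by apply/rowP => i; rewrite !mxE; ring.
  split.
    apply: A0A; apply: (inner_ball i0 B0 A0B oA0 A0x0 cA0 Ephi phi0 cphi).
    rewrite E; apply: le_lt_trans (enormD _ _) _.
    rewrite enormZ ne mulr1 ger0_norm ?divr_ge0 ?(ltW rho0)//.
    by rewrite -/rho; lra.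
  move=> /eD; rewrite -opprB dotN E dotD dotZ dotxx e1 mulr1.
  have := dot_le e (x - c); rewrite ne mul1r ler_norml => /andP[+ _].
  by move: (dot e _) nx => q nx; lra.
have PB : perforated A D y `<=` cube B' by move=> x [/AB'].
apply: le_trans (ccube_lambda1_le B'0 PB r0 cS) _.
rewrite lee_fin /inradius_cst le_eqVlt; apply/orP; left; apply/eqP.
rewrite -[RHS]mulrA; congr (_ * _).
rewrite -[in RHS](sqr_sqrtr (ltW l0)) -exprMn; congr (_ ^+ 2).
by rewrite /r /rho; field; rewrite !gt_eqF.
Qed.

End obstacle.

Lemma ip_le_sum d (T : measurableType d) (R : realType)
    (mu : {measure set T -> \bar R}) (f : T -> R) (s : seq (T -> R)) :
  sqint mu f -> {in s, forall g, sqint mu g} ->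
  (forall x, f x ^+ 2 <= \sum_(g <- s) g x ^+ 2) ->
  ip mu f f <= \sum_(g <- s) ip mu g g.
Proof.
move=> sf ss fs.
have sI (i : 'I_(size s)) : mu.-integrable setT (EFin \o (fun x => s`_i x * s`_i x)).
  by apply: sqint_mul; apply: ss; exact: mem_nth.
have -> : \sum_(g <- s) ip mu g g = \int[mu]_x (\sum_(i < size s) s`_i x * s`_i x).
  by rewrite Rintegral_sum// (big_nth 0) big_mkord.
have fs' x : f x * f x <= \sum_(i < size s) s`_i x * s`_i x.
  rewrite -expr2; apply: le_trans (fs x) _; rewrite (big_nth 0) big_mkord.
  by apply: ler_sum => i _; rewrite expr2.
apply: le_Rintegral => //; first exact: sqint_mul.
rewrite (_ : EFin \o _ = (fun x => \sum_(i < size s) (s`_i x * s`_i x)%:E)%E).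
  by apply: integrable_sum => // i _; exact: sI.
by apply/funext => x /=; rewrite sumEFin.
Qed.

(** * Energy inequality on the dumbbell *)

Section dumbbell.
Variables (R : realType) (n : nat) (j1 : 'I_n).
Local Notation N := (1 + n)%N.
Local Notation mu := (lebesgue R N).
Local Notation i1 := (rshift 1 j1).
Local Notation i0 := (0 : 'I_N).
Implicit Types (A : set 'rV[R]_N) (x : 'rV[R]_N) (u : 'rV[R]_N -> R).
Variables (w r : R).
(** [r] bounds the radius of the connector and is the scale of the cutoff; [w] is the radius of the
    tube free of bases between the two faces. [2 n + 5]: cross coordinates of size at most [2 r],
    one of them moved by [4 r], have a sum of at most [(2 n + 4) r < w]. *)
Hypotheses (r0 : 0 < r) (r1 : 2 * r <= 1) (rw : (2 * n%:R + 5) * r <= w).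

(* Both bases at once: [s = -1] is the left one and [s = 1] the right one. *)
Definition side (s : R) A := open A /\
  forall x, closure A x -> s * axial x <= 1 -> enorm (cross x) < w ->
    s * axial x = 1 /\ ~ A x.

Definition mouth (s : R) : 'rV[R]_N := s *: e_ R i0.

(** Used with [a] in {0, 1, -1}. The cross part [4 r] leads out of the connector; the axial part
    brings a point near a mouth back between the two faces. A cross direction [j1] exists because
    the ambient dimension is at least 2. *)
Definition shift_out (a : R) : 'rV[R]_N := (2 * a * r) *: e_ R i0 + (4 * r) *: e_ R i1.

Lemma mouth0 s : mouth s 0 i0 = s.
Proof. by rewrite !mxE/= mulr1. Qed.

Lemma mouthS s j : mouth s 0 (rshift 1 j) = 0.
Proof. by rewrite !mxE/= mulr0. Qed.

Lemma shift_out0 a : shift_out a 0 i0 = 2 * a * r.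
Proof. by rewrite !mxE/= mulr1 mulr0 addr0. Qed.

Lemma shift_outS a j : shift_out a 0 (rshift 1 j) = (j == j1)%:R * (4 * r).
Proof. by rewrite !mxE/= mulr0 add0r mulrC (inj_eq (@rshift_inj _ _)). Qed.

Lemma crossE x j : cross x 0 j = x 0 (rshift 1 j).
Proof. by rewrite mxE. Qed.

(** [6 r] bounds the sum [2 |a| r + 4 r] of the absolute coordinates of the shift. *)
Lemma nrm_shift_out a u : Cc u -> `|a| <= 1 ->
  ip mu (fun x => u (x + shift_out a) - u x) (fun x => u (x + shift_out a) - u x) <=
  (6 * r) ^+ 2 * energy u.
Proof.
move=> cu a1; rewrite -nrm_sqr -[energy u]sqr_sqrtr ?energy_ge0// -exprMn.
rewrite ler_pXn2r ?nnegrE ?nrm_ge0 ?mulr_ge0 ?sqrtr_ge0 ?(ltW r0)//.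
apply: le_trans (nrm_translation_le _ cu) _.
have pE i : nrm mu (partial i u) <= Num.sqrt (energy u).
  rewrite ler_wsqrtr// /energy (bigD1 i)//= lerDl.
  by apply: sumr_ge0 => j _; exact: ip_ge0.
apply: le_trans (_ : \sum_i `|shift_out a 0 i| * Num.sqrt (energy u) <= _).
  by apply: ler_sum => i _; rewrite ler_wpM2l.
rewrite -mulr_suml ler_wpM2r ?sqrtr_ge0// big_ord_recl.
have -> : \sum_(i < n) `|shift_out a 0 (lift ord0 i)| = 4 * r.
  under eq_bigr => i _ do (rewrite (_ : lift ord0 i = rshift 1 i :> 'I_N); last exact/val_inj).
  under eq_bigr do rewrite shift_outS.
  rewrite (bigD1 j1)//= eqxx mul1r big1 ?addr0 ?ger0_norm ?mulr_ge0 ?(ltW r0)//.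
  by move=> j /negbTE ->; rewrite mul0r normr0.
rewrite shift_out0 !normrM (gtr0_norm r0) ger0_norm//.
by have := ler_wpM2r (ltW r0) a1; rewrite mul1r -(mulrA 2); move: (`|a| * r) => q; lra.
Qed.

Lemma cross_shift x a : (forall j, `|x 0 (rshift 1 j)| <= 2 * r) ->
  enorm (cross (x + shift_out a)) < w /\ r <= `|(x + shift_out a) 0 i1|.
Proof.
move=> xr; have r0' := r0; have rw' := rw; split; last first.
  rewrite mxE shift_outS eqxx mul1r; have := xr j1; rewrite ler_norml => /andP[h1 _].
  by apply: le_trans (ler_norm _); lra.
apply: le_lt_trans (enorm_le_sum _) _.
apply: (@le_lt_trans _ _ (\sum_(j < n) (2 * r + (j == j1)%:R * (4 * r)))).
  apply: ler_sum => j _; rewrite crossE mxE shift_outS; apply: le_trans (ler_normD _ _) _.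
  apply: lerD => //; rewrite ger0_norm// mulr_ge0// mulr_ge0// ltW//.
rewrite big_split/= sumr_const card_ord (bigD1 j1)//= eqxx mul1r big1 ?addr0; last first.
  by move=> j /negbTE ->; rewrite mul0r.
apply: lt_le_trans rw'; rewrite -[_ *+ n]mulr_natl; move: (n%:R : R) => m; lra.
Qed.

Section one_side.
Variables (s : R) (A A' Q : set 'rV[R]_N) (u : 'rV[R]_N -> R).
Hypotheses (s2 : `|s| = 1) (sA : side s A) (sA' : side (- s) A').
Hypothesis AA' : forall x, A x -> ~ A' x.
Hypothesis gQ : forall x, Q x -> `|axial x| <= 1 /\ enorm (cross x) < r.
Hypothesis tu : test_function (A `|` A' `|` Q) u.

Let su : smooth u. Proof. by case: tu. Qed.

(** Such a point lies outside the dumbbell: between the faces neither open base meets the tube of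
    radius [w], and the coordinate [i1] is too large for the connector. *)
Lemma gap_eq0 x : `|axial x| <= 1 -> enorm (cross x) < w -> r <= `|x 0 i1| -> u x = 0.
Proof.
move=> x1 xw xr; have [_ [K [_ KA Ku]]] := tu; apply: Ku => /KA [[Ax|A'x]|/gQ[_ xQ]].
- have [_] := sA; move=> /(_ x (subset_closure Ax)) H.
  by have [|//|] := H => //; apply: le_trans (ler_norm _) _; rewrite normrM s2 mul1r.
- have [_] := sA'; move=> /(_ x (subset_closure A'x)) H.
  by have [|//|] := H => //; apply: le_trans (ler_norm _) _; rewrite normrM normrN s2 mul1r.
- by have := le_lt_trans (coord_le_enorm (cross x) j1) xQ; rewrite crossE ltNge xr.
Qed.

Lemma connector_shift_eq0 x : Q x -> u (x + shift_out 0) = 0.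
Proof.
move=> /gQ[x1 xr]; have [|h1 h2] := @cross_shift x 0.
  move=> j; rewrite -crossE; apply: le_trans (coord_le_enorm _ _) _.
  by have r0' := r0; lra.
by apply: gap_eq0 => //; rewrite /axial mxE shift_out0 mulr0 mul0r addr0.
Qed.

(** In the mouth cube a point of [A] is beyond the flat face by at most [2 r]. The axial shift of
    [2 r] in the opposite direction puts it back between the faces, where [gap_eq0] applies. *)
Lemma mouth_shift_eq0 x : A x -> ccube (mouth s) (2 * r) x -> u (x + shift_out (- s)) = 0.
Proof.
move=> Ax xc; have xj j : `|x 0 (rshift 1 j)| <= 2 * r.
  by have := xc (rshift 1 j); rewrite mouthS subr0.
have [h1 h2] := cross_shift (- s) xj; apply: gap_eq0 => //.
have r0' := r0; have r1' := r1; have rw' := rw.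
have xw : enorm (cross x) < w.
  apply: le_lt_trans (enorm_le_sum _) _.
  apply: (@le_lt_trans _ _ (\sum_(j < n) (2 * r))).
    by apply: ler_sum => j _; rewrite crossE.
  rewrite sumr_const card_ord -[_ *+ n]mulr_natl; move: (n%:R : R) rw' => m; lra.
have sx : 1 < s * axial x.
  rewrite ltNge; apply/negP => sx; have [_ H] := sA.
  by have [] := H x (subset_closure Ax) sx xw.
have ss : s * s = 1 by rewrite -expr2 -real_normK ?num_real// s2 expr1n.
have xs : s * axial x <= 1 + 2 * r.
  have : `|s * (axial x - s)| <= 2 * r.
    by have := xc i0; rewrite mouth0 normrM s2 mul1r.
  by rewrite mulrBr ss ler_distl => /andP[_].
rewrite -[leLHS]mul1r -[X in X * _]s2 -normrM {1}/axial mxE shift_out0 mulrDr.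
have -> : s * (2 * - s * r) = - (2 * r) * (s * s) by ring.
rewrite ss mulr1 ler_norml; move: sx xs; rewrite /axial; move: (s * _) => q; lra.
Qed.

Let chi := cutoff (mouth s) r.
Let h x := (1 - chi x) * u x.

(** The restriction of [u] to [A], cut off near the mouth, the only place where the support of [u]
    can leave [A]; this makes it a test function on [A]. *)
Definition side_part x := if pselect (A x) then (1 - cutoff (mouth s) r x) * u x else 0.

Let smooth_h : smooth h.
Proof.
exact: (smoothM (smoothB (smooth_cst 1) (smooth_cutoff (mouth s) r)) su).
Qed.

(** Outside the mouth cube nothing was cut; inside it the shifted value is zero, so the difference
    is [- u x]. *)
Lemma side_mass x : A x ->
  u x ^+ 2 <= side_part x ^+ 2 + (u (x + shift_out (- s)) - u x) ^+ 2.
Proof.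
move=> Ax; have [xc|xc] := pselect (ccube (mouth s) (2 * r) x).
  by rewrite mouth_shift_eq0// sub0r sqrrN lerDr sqr_ge0.
rewrite /side_part; case: (pselect (A x)) => //= _.
by rewrite cutoff_out// subr0 mul1r lerDl sqr_ge0.
Qed.

Lemma side_part_spec : test_function A side_part /\
  forall i x, partial i side_part x ^+ 2 <= 2 * partial i u x ^+ 2 +
    2 * (cutoff_slope R / r * (u (x + shift_out (- s)) - u x)) ^+ 2.
Proof.
have [_ [K [cK KA Ku]]] := tu; have [oA sAE] := sA.
(* The cutoff is 1 on the removed ball. A point of [K] in the closure of [A] but not in [A] cannot
   lie in the open set [A'], which is disjoint from [A]; so it lies in [Q], hence on the flat face
   and in that ball. *)
pose K1 := K `&` (closure A `&` ~` ball (mouth s) r).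
have cK1 : compact K1.
  apply: compact_closedI => //; apply: closedI; first exact: closed_closure.
  by apply: open_closedC; exact: ball_open.
have K1A : K1 `<=` A.
  move=> x [/KA[[//|A'x]|/gQ[x1 xr]] [cAx nb]].
    have [oA' _] := sA'; have [y [Ay A'y]] := cAx A' (open_nbhs_nbhs (conj oA' A'x)).
    by have := AA' Ay.
  exfalso; apply: nb; apply/rV_ballP => //.
  have [|||sx _] := sAE x => //.
  - by apply: le_trans (ler_norm _) _; rewrite normrM s2 mul1r.
  - apply: lt_le_trans xr _; have r0' := r0; have rw' := rw; apply: le_trans rw'.
    have : 0 <= n%:R * r by rewrite mulr_ge0// ltW.
    by move: (n%:R : R) => m; lra.
  have ss : s * s = 1 by rewrite -expr2 -real_normK ?num_real// s2 expr1n.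
  move=> i; case: (splitP (i : 'I_(1 + n))) => k ik.
    have -> : i = i0 by apply/val_inj; rewrite /= ik ord1.
    rewrite mouth0; have -> : s = x 0 i0; last by rewrite subrr normr0.
    by rewrite -[s]mulr1 -sx mulrA ss mul1r.
  have -> : i = rshift 1 k by exact/val_inj.
  rewrite mouthS sub0r normrN -crossE; exact: le_lt_trans (coord_le_enorm _ _) xr.
have loc x : K1 x -> exists2 e : R, 0 < e & forall y, ball x e y -> side_part y = h y.
  move=> /K1A Ax; have /nbhs_ballP[e /= e0 eA] : nbhs x A by exact: open_nbhs_nbhs.
  by exists e => // y /eA Ay; rewrite /side_part; case: (pselect (A y)).
have out x : ~ K1 x -> side_part x = 0.
  move=> nK1; rewrite /side_part; case: (pselect (A x)) => //= Ax.
  have [Kx|/Ku ->] := pselect (K x); last by rewrite mulr0.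
  have [xb|nb] := pselect (ball (mouth s) r x).
    rewrite cutoff1 ?subrr ?mul0r// => i; rewrite distrC; apply: ltW.
    by move/rV_ballP: xb; apply.
  by exfalso; apply: nK1; split => //; split => //; exact: subset_closure.
split; first exact: test_function_patch cK1 K1A smooth_h loc out.
move=> i x; have rhs0 : 0 <= 2 * partial i u x ^+ 2 +
    2 * (cutoff_slope R / r * (u (x + shift_out (- s)) - u x)) ^+ 2.
  by rewrite addr_ge0// mulr_ge0// sqr_ge0.
have [K1x|nK1] := pselect (K1 x); last first.
  have [e e0 H] := closed_ball_out cK1 nK1.
  rewrite (@partial_local _ _ i side_part (cst 0) x e)//; last by move=> y /H /out.
  by rewrite partial_cst expr0n.
have [e e0 H] := loc x K1x.
rewrite (@partial_local _ _ i side_part h x e)//; last by move=> y /H.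
have sc : smooth (fun x => 1 - chi x).
  by apply: smoothB; [exact: smooth_cst|exact: smooth_cutoff].
rewrite (partialM i sc su) (partialB i (smooth_cst 1) (smooth_cutoff _ _)) partial_cst sub0r.
have /andP[c0 c1] := cutoff_itv (mouth s) r x; rewrite -/chi in c0 c1.
have := partial_cutoff_le (mouth s) i x r0; rewrite indicE.
have sl0 : 0 <= cutoff_slope R / r.
  by rewrite divr_ge0 ?(ltW r0)// mulr_ge0// exprn_ge0// expR_ge0.
have ineq (a b c : R) : 0 <= c <= 1 -> (c * a + b) ^+ 2 <= 2 * a ^+ 2 + 2 * b ^+ 2.
  move=> /andP[? ?]; have : (c * a) ^+ 2 <= a ^+ 2.
    by rewrite exprMn ler_piMl ?sqr_ge0// exprn_ile1.
  have := sqr_ge0 (c * a - b); move: (c * a) => q; rewrite !expr2; lra.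
have c01 : 0 <= 1 - chi x <= 1 by rewrite subr_ge0 c1 gerBl.
move=> hc; apply: le_trans (ineq _ _ _ c01) _; rewrite lerD2l ler_wpM2l//.
rewrite mulrN sqrrN; move: hc.
have [|_] := boolP (x \in ccube (mouth s) (2 * r)); last first.
  by rewrite mulr0 normr_le0 => /eqP ->; rewrite mulr0 expr0n sqr_ge0.
(* Where the cutoff varies, [u] is up to sign the shift difference, so the term [u] times the
   gradient of the cutoff is bounded by that difference. *)
rewrite inE mulr1 => xc; rewrite mouth_shift_eq0//; last exact: K1A.
rewrite sub0r mulrN sqrrN [u x * _]mulrC; move: (cutoff_slope R / r) sl0 => k k0 hc.
rewrite !exprMn -(@real_normK _ (partial _ _ _)) ?num_real//.
by rewrite ler_wpM2r ?sqr_ge0// ler_pXn2r ?nnegrE.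
Qed.

Lemma sqint_shift_diff a : sqint mu (fun x => u (x + shift_out a) - u x).
Proof.
have su2 := Cc_sqint (test_function_Cc tu).
exact: sqintB (sqint_translation (shift_out a) su2) su2.
Qed.

(** In each of the [N] coordinates the cutoff contributes [2 (cutoff_slope / r)^2 (6 r)^2], where
    [r] cancels; the leading 2 is the factor of the gradient of [u]. *)
Definition side_cst : R := 2 + 72 * N%:R * cutoff_slope R ^+ 2.

Lemma side_energy : energy side_part <= side_cst * energy u.
Proof.
have [tf grad] := side_part_spec; have cf := test_function_Cc tf.
have cu := test_function_Cc tu.
pose K := cutoff_slope R / r.
pose d x := u (x + shift_out (- s)) - u x.
have sd : sqint mu d by exact: sqint_shift_diff.
have part i : ip mu (partial i side_part) (partial i side_part) <=
    2 * ip mu (partial i u) (partial i u) + 2 * (K ^+ 2 * ip mu d d).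
  have sp := Cc_sqint (Cc_partial i cu).
  have sKd : sqint mu (fun x => K * d x) by exact: sqintZ.
  have -> : K ^+ 2 * ip mu d d = ip mu (fun x => K * d x) (fun x => K * d x).
    by rewrite -!nrm_sqr nrmZ// [RHS]exprMn real_normK ?num_real.
  have := @ip_le_sum _ _ R mu (partial i side_part)
    [:: partial i u; partial i u; fun x => K * d x; fun x => K * d x].
  rewrite !big_cons !big_nil => H.
  have {}H := H (Cc_sqint (Cc_partial i cf)).
  have {}H := H ltac:(by move=> g; rewrite !inE => /or4P[] /eqP ->).
  apply: (le_trans (H _)) => [x|].
    have := grad i x; rewrite -/K !big_cons big_nil -/(d x) /=.
    move: (partial i side_part x) (partial i u x) (K * d x) => a b c.
    by move=> H'; apply: le_trans H' _; rewrite !mulr_natl !mulr2n addr0 !addrA.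
  move: (ip mu (partial i u) (partial i u)) (ip mu (fun x => K * d x) (fun x => K * d x)).
  by move=> a b; rewrite !mulr_natl !mulr2n addr0 !addrA.
apply: (@le_trans _ _ (\sum_i (2 * ip mu (partial i u) (partial i u) + 2 * (K ^+ 2 * ip mu d d)))).
  by apply: ler_sum => i _; exact: part.
have -> : \sum_(i < N) (2 * ip mu (partial i u) (partial i u) + 2 * (K ^+ 2 * ip mu d d)) =
    2 * energy u + N%:R * (2 * (K ^+ 2 * ip mu d d)).
  by rewrite big_split/= -mulr_sumr sumr_const card_ord -/(energy u) [X in _ = _ + X]mulr_natl.
have : ip mu d d <= (6 * r) ^+ 2 * energy u by apply: nrm_shift_out => //; rewrite normrN s2.
move=> /(ler_wpM2l (sqr_ge0 K)).
have -> : K ^+ 2 * ((6 * r) ^+ 2 * energy u) = 36 * cutoff_slope R ^+ 2 * energy u.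
  by rewrite /K; move: (energy u) (cutoff_slope R) => E C; field; rewrite gt_eqF.
rewrite -mulrA => H; apply: le_trans (_ : 2 * energy u +
    N%:R * (2 * (36 * (cutoff_slope R ^+ 2 * energy u))) <= _).
  by rewrite lerD2l ler_wpM2l// ler_wpM2l.
rewrite /side_cst; move: (energy u) (cutoff_slope R) (N%:R : R) => E C m.
by rewrite le_eqVlt; apply/orP; left; apply/eqP; ring.
Qed.

End one_side.

(** One [side_cst] for each base, and 36 for each of the three shifts. *)
Definition dumbbell_cst : R := 2 * side_cst + 108.

Lemma dumbbell_cst_gt0 : 0 < dumbbell_cst.
Proof.
by rewrite /dumbbell_cst /side_cst ltr_wpDl// mulr_ge0// addr_ge0// !mulr_ge0// sqr_ge0.
Qed.

(** Pointwise, [u^2] is at most the squares of the two side parts plus those of three shift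
    differences: one for each mouth and one for the connector. The side parts obey the inequalities
    of the bases; a difference costs [l (6 r)^2 <= 36] energies. *)
Lemma dumbbell_energy A A' Q l u : side (-1) A -> side 1 A' ->
  (forall x, A x -> ~ A' x) -> (forall x, Q x -> `|axial x| <= 1 /\ enorm (cross x) < r) ->
  0 <= l -> l * r ^+ 2 <= 1 ->
  (forall f, test_function A f -> l * ip mu f f <= energy f) ->
  (forall f, test_function A' f -> l * ip mu f f <= energy f) ->
  test_function (A `|` A' `|` Q) u ->
  l * ip mu u u <= dumbbell_cst * energy u.
Proof.
have ar1 (U a b c p q : R) : 0 <= a -> 0 <= b -> 0 <= c -> 0 <= p -> 0 <= q ->
    [\/ U <= a + c, U <= b + p | U = q] -> U <= a + b + c + p + q.
  by move=> ? ? ? ? ? []; lra.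
have ar2 (q E t : R) : 0 <= E -> t * q <= 1 -> t * ((6 ^+ 2 * q) * E) <= 36 * E.
  by move=> E0 /(ler_wpM2r E0); lra.
have ar3 (t U a b p q s E C : R) : t * U <= t * (a + (b + (p + (q + (s + 0))))) ->
    t * a <= C * E -> t * b <= C * E -> t * p <= 36 * E -> t * q <= 36 * E ->
    t * s <= 36 * E -> t * U <= (2 * C + 108) * E.
  by rewrite !mulrDr mulr0; lra.
move=> sA sA' AA' gQ l0 lr lA lA' tu.
have tu' : test_function (A' `|` A `|` Q) u by rewrite (setUC A' A).
have A'A x : A' x -> ~ A x by move=> A'x /AA'.
have sA2 : side (- -1) A' by rewrite opprK.
have n1 : `|-1| = 1 :> R by rewrite normrN1.
have n2 : `|1| = 1 :> R by rewrite normr1.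
have [tf _] := side_part_spec n1 sA sA2 AA' gQ tu.
have [tg _] := side_part_spec n2 sA' sA A'A gQ tu'.
have Ef := side_energy n1 sA sA2 AA' gQ tu.
have Eg := side_energy n2 sA' sA A'A gQ tu'.
have cu := test_function_Cc tu.
set f := side_part (-1) A u in tf Ef; set g := side_part 1 A' u in tg Eg.
pose d a x := u (x + shift_out a) - u x.
have sd a : sqint mu (d a) by exact: sqint_shift_diff tu a.
have mass x : u x ^+ 2 <= f x ^+ 2 + g x ^+ 2 + d 1 x ^+ 2 + d (-1) x ^+ 2 + d 0 x ^+ 2.
  apply: ar1; rewrite ?sqr_ge0//.
  have [Ax|nAx] := pselect (A x).
    by apply: Or31; have := side_mass n1 sA sA2 gQ tu Ax; rewrite -/f opprK.
  have [A'x|nA'x] := pselect (A' x).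
    by apply: Or32; have := side_mass n2 sA' sA gQ tu' A'x; rewrite -/g.
  have [Qx|nQx] := pselect (Q x).
    by apply: Or33; rewrite /d (connector_shift_eq0 n1 sA sA2 gQ tu Qx) sub0r sqrrN.
  apply: Or31; have -> : u x = 0.
    by have [_ [K [_ KA Ku]]] := tu; apply: Ku => /KA [[]|].
  by rewrite expr0n addr_ge0 ?sqr_ge0.
have := @ip_le_sum _ _ R mu u [:: f; g; d 1; d (-1); d 0] (Cc_sqint cu).
rewrite !big_cons !big_nil => H.
have {}H : ip mu u u <= ip mu f f + (ip mu g g + (ip mu (d 1) (d 1) +
    (ip mu (d (-1)) (d (-1)) + (ip mu (d 0) (d 0) + 0)))).
  apply: H => [h|x].
    rewrite !inE => /orP[/eqP ->|]; first exact: Cc_sqint (test_function_Cc tf).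
    by move=> /or4P[] /eqP -> //; exact: Cc_sqint (test_function_Cc tg).
  by rewrite !big_cons big_nil addr0 !addrA; exact: mass.
have D a : `|a| <= 1 -> l * ip mu (d a) (d a) <= 36 * energy u.
  move=> a1; have := ler_wpM2l l0 (nrm_shift_out cu a1).
  by move/le_trans; apply; rewrite exprMn; exact: ar2 (energy_ge0 u) lr.
have D1 := D 1 ltac:(by rewrite n2); have D2 := D (-1) ltac:(by rewrite n1).
have D3 := D 0 ltac:(by rewrite normr0).
have {}H := ler_wpM2l l0 H.
have lf := le_trans (lA _ tf) Ef; have lg := le_trans (lA' _ tg) Eg.
exact: ar3 H lf lg D1 D2 D3.
Qed.

End dumbbell.

(** * The geometry of the dumbbell, and the lower bound for its first eigenvalue *)

Section geometry.
Variables (R : realType) (n : nat).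
Implicit Types (A : set 'rV[R]_(1 + n)) (x : 'rV[R]_(1 + n)) (rho : R -> R).

(** Continuity excludes -2, so the extreme value theorem is applied on [-1, 0] only; to the left of
    it the profile is 1. *)
Lemma profile_bounded rho : connector_profile rho ->
  exists2 M : R, 2 <= M & forall q, -2 <= q <= 0 -> rho q <= M.
Proof.
move=> [_ _ crho rho0 [rho1 rho2]].
have c : {within `[-1, 0], continuous rho}.
  apply: continuous_subspaceW crho => q /=; rewrite !in_itv/= => /andP[h ->].
  by rewrite andbT; apply: lt_le_trans h; rewrite ltrN2 ltr1n.
have [|q0 _ H] := EVT_max _ c; first by rewrite lerN10.
exists (rho q0); first by rewrite -rho0 H// in_itv/= lexx lerN10.
move=> q /andP[q2 q0'].
have r1 : 1 <= rho q0.
  apply: (@le_trans _ _ 2); first by rewrite ler1n.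
  by rewrite -rho0 H// in_itv/= lexx lerN10.
have [q1|q1] := leP (-1) q; first by apply: H; rewrite in_itv/= q1 q0'.
have [->|qn] := eqVneq q (-2); first by rewrite rho2.
by rewrite rho1// in_itv/= q1 andbT lt_neqAle eq_sym qn.
Qed.

Lemma left_base_side xi A : left_base xi A -> side (3 * xi) (-1) A.
Proof.
move=> [[_ oA _] _ _ E _]; split => // x cx x1 xw.
have : (closure A `&` [set x | -1 <= axial x /\ enorm (cross x) < 3 * xi]) x.
  by split => //; split => //; move: x1; rewrite mulN1r lerNl.
rewrite E => -[[_ nA] -> _]; rewrite mulN1r opprK; split => // Ax; apply: nA.
by move: (oA); rewrite openE => /(_ x Ax).
Qed.

Lemma right_base_side xi A : right_base xi A -> side (3 * xi) 1 A.
Proof.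
move=> [[_ oA _] _ _ E _]; split => // x cx x1 xw.
have : (closure A `&` [set x | axial x <= 1 /\ enorm (cross x) < 3 * xi]) x.
  by split => //; split => //; move: x1; rewrite mul1r.
rewrite E => -[[_ nA] -> _]; rewrite mul1r; split => // Ax; apply: nA.
by move: (oA); rewrite openE => /(_ x Ax).
Qed.

Lemma connector_bound rho (M eps : R) : 2 <= M -> 0 < eps -> eps < 1 / 2 ->
  (forall q, -2 <= q <= 0 -> rho q <= M) ->
  forall x, (connector_left rho eps `|` connector_cylinder eps `|` connector_right rho eps) x ->
    `|axial x| <= 1 /\ enorm (cross x) < M * eps.
Proof.
move=> M2 e0 e1 H x; rewrite ler_norml.
have rhoM q : -2 <= q <= 0 -> enorm (cross x) < eps * rho q -> enorm (cross x) < M * eps.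
  by move=> /H qM /lt_le_trans; apply; rewrite mulrC ler_wpM2r// ltW.
move=> [[[/andP[h1 h2] h3]|[/andP[h1 h2] h3]]|[/andP[h1 h2] h3]].
- split; first lra.
  apply: rhoM h3; apply/andP; split; last by rewrite ler_pdivrMr// mul0r; lra.
  by rewrite ler_pdivlMr//; lra.
- split; first lra.
  by apply: lt_le_trans h3 _; rewrite ler_peMl ?(ltW e0)//; lra.
- split; first lra.
  apply: rhoM h3; apply/andP; split; last by rewrite ler_pdivrMr// mul0r; lra.
  by rewrite ler_pdivlMr//; lra.
Qed.

Lemma connector_sub_cube (r : R) x : `|axial x| <= 1 -> enorm (cross x) < r -> cube (1 + r) x.
Proof.
move=> x1 xr; have r0 : 0 <= r by apply: ltW; apply: le_lt_trans xr; exact: enorm_ge0.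
apply/cubeP => i; case: (splitP (i : 'I_(1 + n))) => k ik.
  have -> : i = 0 by apply/val_inj; rewrite /= ik ord1.
  by apply: le_trans x1 _; rewrite lerDl.
have -> : i = rshift 1 k by exact/val_inj.
rewrite -crossE; apply: le_trans (coord_le_enorm _ _) _.
by apply: le_trans (ltW xr) _; rewrite lerDr.
Qed.

Lemma cubeW (B C : R) : B <= C -> @cube R (1 + n) B `<=` cube C.
Proof. by move=> BC x /cubeP xB; apply/cubeP => i; exact: le_trans (xB i) BC. Qed.

Lemma dumbbell_lambda1_ge (xi l M eps : R) A1 A2 rho : (0 < n)%N -> 0 < xi ->
  left_base xi A1 -> right_base xi A2 -> A1 `&` A2 = set0 ->
  2 <= M -> (forall q, -2 <= q <= 0 -> rho q <= M) ->
  lambda1 A1 = l%:E -> 0 < l -> (lambda1 A1 < lambda1 A2)%E ->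
  0 < eps -> eps < 1 / 2 -> 2 * (M * eps) <= 1 -> (2 * n%:R + 5) * (M * eps) <= 3 * xi ->
  l * (M * eps) ^+ 2 <= 1 ->
  ((l / dumbbell_cst R n)%:E <= lambda1 (dumbbell A1 A2 rho eps))%E.
Proof.
move=> n0 xi0 bA1 bA2 A12 M2 rhoM lE l0 l12 e0 e1 r1 rw lr.
have r0 : 0 < M * eps by rewrite mulr_gt0//; apply: lt_le_trans M2.
have bnd A : bounded_set A -> (l%:E <= lambda1 A)%E ->
    forall f, test_function A f -> l * ip (lebesgue R (1 + n)) f f <= energy f.
  move=> /bounded_sub_cube[B B0 AB] lA f tf.
  have [->|f0] := eqVneq (ip (lebesgue R (1 + n)) f f) 0.
    by rewrite mulr0 energy_ge0.
  have {}f0 : 0 < ip (lebesgue R (1 + n)) f f by rewrite lt_neqAle eq_sym f0 ip_ge0.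
  have := le_trans lA (lambda1_le B0 AB tf f0).
  by rewrite lee_fin ler_pdivlMr.
apply: lambda1_ge => u tu.
rewrite -mulrA mulrCA mulrC ler_pdivrMr ?dumbbell_cst_gt0// [leRHS]mulrC.
apply: (dumbbell_energy (Ordinal n0) r0 r1 rw (left_base_side bA1) (right_base_side bA2) _
  (connector_bound M2 e0 e1 rhoM) (ltW l0) lr _ _ tu).
- by move=> x A1x A2x; have : (A1 `&` A2) x by []; rewrite A12.
- by apply: bnd; [case: bA1|rewrite lE].
- by apply: bnd; [case: bA2|rewrite -lE ltW].
Qed.

End geometry.

(* The ambient space is R^(1 + n), of dimension at least 2. *)
Theorem corollary1p2 (R : realType) (n : nat) (n_ge1 : (2 <= 1 + n)%N) :
  exists C0 : R,
  forall (xi : R) (Omega1 Omega2 : set 'rV[R]_(1 + n)) (rho : R -> R)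
    (phi : 'rV[R]_(1 + n) -> R) (x0 : 'rV[R]_(1 + n))
    (D : set 'rV[R]_(1 + n)) (y : R -> 'rV[R]_(1 + n)),
    0 < xi ->
    left_base xi Omega1 -> right_base xi Omega2 ->
    Omega1 `&` Omega2 = set0 ->
    connector_profile rho ->
    convex_set Omega1 ->
    simply_connected Omega2 ->
    (lambda1 Omega1 < lambda1 Omega2)%E ->
    nonneg_first_eigenfunction Omega1 phi ->
    unique_max_point Omega1 phi x0 ->
    domain D -> bounded_set D -> convex_set D ->
    (forall eps, admissible xi eps ->
       optimal_translate (dumbbell Omega1 Omega2 rho eps) D (y eps)) ->
    forall delta : R, 0 < delta ->
    exists eps' : R, 0 < eps' /\
    forall eps : R, admissible xi eps -> eps < eps' ->
      (exists C : R, C0 <= C /\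
         (C%:E * lambda1 (dumbbell Omega1 Omega2 rho eps) <
          lambda1 (perforated (dumbbell Omega1 Omega2 rho eps) D (y eps)))%E) ->
      eucl_dist x0 (translate (y eps) D) < delta.
Proof.
have n0 : (0 < n)%N by [].
pose K := dumbbell_cst R n; pose I := inradius_cst R (1 + n).
have K0 : 0 < K by exact: dumbbell_cst_gt0.
have I0 : 0 <= I by rewrite /I /inradius_cst mulr_ge0 ?sqr_ge0// mulr_ge0// exprn_ge0.
exists (I * K) => xi A1 A2 rho phi x0 D y xi0 bA1 bA2 A12 prho cA1 _ l12 [[l [lE Ephi]] phiA].
move=> [A1x0 x0max] [D0 _ _] bD cD _ delta delta0.
have [M M2 rhoM] := profile_bounded prho.
have M0 : 0 < M by exact: lt_le_trans M2.
have [B1 B10 A1B] := bounded_sub_cube (let: And5 _ b _ _ _ := bA1 in b).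
have [B2 B20 A2B] := bounded_sub_cube (let: And5 _ b _ _ _ := bA2 in b).
have oA1 : open A1 by case: bA1 => -[].
have l0 : 0 < l by apply: (eigenvalue_gt0 0 B10 A1B); exists phi.
have phi0 x : A1 x -> 0 <= phi x <= phi x0.
  move=> A1x; have [_ ->] := phiA x A1x; have [->|xx0] := pselect (x = x0); first exact: lexx.
  by rewrite ltW// x0max.
have m0 : 0 < 2 * n%:R + 5 :> R by rewrite ltr_wpDl// mulr_ge0.
(* Ceilings for [r = M eps], giving in turn [2 r <= 1], [(2 n + 5) r <= 3 xi] and [l r^2 <= 1]; the
   last uses [r (1 + l) <= 1] together with [r <= 1]. *)
pose t := Num.min (1 / 2) (Num.min (3 * xi / (2 * n%:R + 5)) (1 / (1 + l))).
have t0 : 0 < t.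
  rewrite !lt_min; apply/and3P; split; apply: divr_gt0 => //.
    by rewrite mulr_gt0.
  by rewrite addr_gt0.
exists (t / M); split; first exact: divr_gt0.
move=> eps [e0 _ e1] eM [C [C0 HC]].
(* Contraposition: a distance of at least [delta] is positive, which forces [lambda1] of the
   perforated dumbbell to be at most [C] times that of the dumbbell. *)
rewrite ltNge; apply/negP => dist; move: HC; apply/negP; rewrite -leNgt.
have : M * eps <= t by rewrite mulrC ltW// -ltr_pdivlMr.
rewrite !le_min => /andP[r1 /andP[r2 r3]].
have r0 : 0 < M * eps by exact: mulr_gt0.
have {}r1 : 2 * (M * eps) <= 1 by lra.
have {}r2 : (2 * n%:R + 5) * (M * eps) <= 3 * xi by rewrite mulrC -ler_pdivlMr.
have {}r3 : l * (M * eps) ^+ 2 <= 1.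
  move: r3; rewrite ler_pdivlMr ?addr_gt0// => r3.
  move: (M * eps) r0 r1 r3 => r r0 r1 r3; have : l * r <= 1 by lra.
  by move=> /(ler_wpM2r (ltW r0)); rewrite expr2; lra.
have low := dumbbell_lambda1_ge n0 xi0 bA1 bA2 A12 M2 rhoM lE l0 l12 e0 e1 r1 r2 r3.
have bnd := connector_bound M2 e0 e1 rhoM.
pose B := Num.max B1 (Num.max B2 (1 + M * eps)).
have B0 : 0 <= B by rewrite le_max B10.
have dB : dumbbell A1 A2 rho eps `<=` cube B.
  move=> x [[/A1B h|/A2B h]|/bnd[h1 h2]].
  - by apply: (cubeW _ h); rewrite le_max lexx.
  - by apply: (cubeW _ h); rewrite !le_max lexx orbT.
  - by apply: (cubeW _ (connector_sub_cube h1 h2)); rewrite !le_max lexx !orbT.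
have up := perforated_lambda1_le 0 B10 A1B oA1 A1x0 cA1 Ephi phi0 (phiA x0 A1x0).1 B0 dB
  (fun x A1x => or_introl (or_introl A1x)) D0 bD cD (lt_le_trans delta0 dist).
apply: le_trans up _.
(* Splits the upper bound into [C0 = I * K], at most [C], and [l / K], at most [lambda1] of the
   dumbbell. *)
have -> : inradius_cst R (1 + n) * l = I * K * (l / K) by rewrite /I; field; rewrite gt_eqF.
rewrite EFinM; apply: lee_pmul => //.
- by rewrite lee_fin mulr_ge0// ltW.
- by rewrite lee_fin divr_ge0// ltW.
Qed.
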